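(* Let $N\ge1$ be an integer, $p=2N+1$, and for $v\in\mathbb{R}^p$ let $\lambda_0(a,v)$ be the middle eigenvalue of $J_a$, and $\sigma_0(v)=[\lambda_0^-(v),\lambda_0^+(v)]$ the corresponding spectral band of $H=\Delta+V$, as in the context. i) As $\|v\|^2=\sum_{n=1}^p|v_n|^2\to0$, uniformly in $a\in[0,2]$, $$\lambda_0(a,v)=F(a,v)+O(\|v\|^2),\qquad F(a,v)=\frac{\sum_{k=0}^Nv_{2k+1}a^{2k}}{\sum_{k=0}^Na^{2k}},$$ and $$\lambda_0^-(v)=\min_{a\in[0,2]}F(a,v)+O(\|v\|^2),\qquad \lambda_0^+(v)=\max_{a\in[0,2]}F(a,v)+O(\|v\|^2).$$ ii) Let $0=v_1\le v_3\le\dots\le v_p$ and $0<v_p$. Then $$\lambda_0^-(v)=O(v_p^2),\qquad \lambda_0^+(v)=\frac{3}{4^{N+1}-1}\sum_{k=1}^N4^kv_{2k+1}+O(v_p^2)\qquad\text{as } v\to0.$$ Moreover, if in addition $v_1<v_3\le v_p\le Cv_3$ for some constant $C>0$, then (in the regime $v\to 0$, i.e. for all such $v$ with $\|v\|$ sufficiently small depending on $C$ and $N$) the function $\lambda_0(\cdot,v)$ is strictly increasing on $[0,2]$ and the spectrum of $H$ on the spectral band $\sigma_0(v)$ has multiplicity $2$.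
   Context: Notation: $\mathbb{N}_p=\{1,\dots,p\}$, $p=2N+1$. The Hilbert space $\ell^2(\Gamma)$ consists of $f=(f_{n,k})_{(n,k)\in\mathbb{Z}\times\mathbb{N}_p}$ with $\sum|f_{n,k}|^2<\infty$. With $f_{n,0}=f_{n,p+1}=0$ for all $n\in\mathbb{Z}$, $H=\Delta+V$ is given by $$(\Delta f)_{n,2k+1}=f_{n,2k}+f_{n-1,2k+2}+f_{n,2k+2},\quad k=0,1,\dots,N,$$ $$(\Delta f)_{n,2k}=f_{n,2k-1}+f_{n+1,2k-1}+f_{n,2k+1},\quad k=1,\dots,N,$$ $$(Vf)_{n,k}=v_kf_{n,k},\quad (n,k)\in\mathbb{Z}\times\mathbb{N}_p,\qquad v=(v_k)_{k=1}^p\in\mathbb{R}^p.$$ For $a\in[0,2]$, $J_a$ is the symmetric tridiagonal $p\times p$ matrix with diagonal $(v_1,\dots,v_p)$ and off-diagonal entries $(a,1,a,1,\dots,a,1)$ (the $(n,n+1)$ entry is $a$ for odd $n$ and $1$ for even $n$); $\lambda_{-N}(a,v)\le\dots\le\lambda_N(a,v)$ are its eigenvalues. The spectrum of $H$ is $\bigcup_{k=-N}^N\sigma_k(v)$ with $\sigma_k(v)=\{\lambda_k(a,v):a\in[0,2]\}$, and $\sigma_0(v)=[\lambda_0^-(v),\lambda_0^+(v)]$, i.e. $\lambda_0^-(v)=\min_{a\in[0,2]}\lambda_0(a,v)$, $\lambda_0^+(v)=\max_{a\in[0,2]}\lambda_0(a,v)$. *)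

(* Defs.v *)
From HB Require Import structures.
From mathcomp Require Import all_boot all_order all_algebra.
From mathcomp Require Import all_classical all_reals all_analysis.
From mathcomp Require Import complex.

Set Implicit Arguments.
Unset Strict Implicit.
Unset Printing Implicit Defensive.
Import Order.TTheory GRing.Theory Num.Theory.
Import numFieldNormedType.Exports.

Local Open Scope classical_set_scope.
Local Open Scope ring_scope.
Local Open Scope complex_scope.

(** ** Square-summable families and spectral multiplicity *)

Section HilbertSpace.
Variables (R : realType) (I : choiceType).
Implicit Types f g : I -> R[i].

Definition ell2 f : Prop :=
  (\esum_(x in [set: I])
     ((complex.Re (f x)) ^+ 2 + (complex.Im (f x)) ^+ 2)%:E < +oo)%E.

(* The unconditional sum of an absolutely summable real family. *)
Definition rsum (a : I -> R) : R :=
  fine (\esum_(x in [set: I]) (Num.max (a x) 0)%:E) -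
  fine (\esum_(x in [set: I]) (Num.max (- a x) 0)%:E).

(* Meaningful for f and g in ell2; linear in f and conjugate-linear in g. *)
Definition ip f g : R[i] :=
  rsum (fun x => complex.Re (f x * (g x)^*)) +i*
  rsum (fun x => complex.Im (f x * (g x)^*)).

Variable T : (I -> R[i]) -> (I -> R[i]).

(* In the next three definitions T stands for a bounded self-adjoint operator
   on ell2. The spectral measure of f, i.e. A |-> <E(A) f, f> for the
   resolution of the identity E of T, is the unique compactly supported finite
   Borel measure mu such that <q(T) f, f> is the integral of q against mu for
   every polynomial q. *)
Definition spectral_measure f
    (mu : {finite_measure set (measurableTypeR R) -> \bar R}) : Prop :=
  (exists M : R, mu (~` `[- M, M]) = 0%E) /\
  forall j : nat, ip (iter j T f) f = (\int[mu]_t (t ^+ j))%:C.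

(* The range of the spectral projection E(S): for f in ell2, E(S) f = f iff
   <E(~` S) f, f> = 0. *)
Definition spectral_subspace (S : set R) : set (I -> R[i]) :=
  [set f | ell2 f /\
     exists2 mu : {finite_measure set (measurableTypeR R) -> \bar R},
       spectral_measure f mu & mu (~` S) = 0%E].

(* The spectrum of T on S has (uniform) multiplicity m: the range of E(S) is the
   orthogonal sum of m cyclic subspaces whose generators have mutually
   absolutely continuous spectral measures; equivalently, the part of T in that
   range is unitarily equivalent to multiplication by t on the sum of m copies
   of L^2(nu) for one measure nu carried by S. The third clause says that S is
   contained in the spectrum of T, so that the definition is not void when
   E(S) = 0. *)
Definition spectrum_has_multiplicity (S : set R) (m : nat) : Prop :=
  exists (g : 'I_m -> I -> R[i])
         (mu : 'I_m -> {finite_measure set (measurableTypeR R) -> \bar R}),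
  [/\ forall i, [/\ ell2 (g i), spectral_measure (g i) (mu i)
                  & mu i (~` S) = 0%E],
      forall i j (A : set (measurableTypeR R)),
        measurable A -> mu i A = 0%E -> mu j A = 0%E,
      forall i t e, S t -> 0 < e -> (0 < mu i [set s : R | (t - e < s < t + e)%R])%E,
      forall i j, i != j ->
        forall k l : nat, ip (iter k T (g i)) (iter l T (g j)) = 0
    & forall f, spectral_subspace S f ->
        (forall i (k : nat), ip f (iter k T (g i)) = 0) -> f = (fun=> 0)].

End HilbertSpace.

(** ** The nanoribbon operator and its fibre matrices *)

Section Ribbon.
Variables (R : realType) (N : nat).

(* The vertex set Z x {1,...,p}, p = 2N+1; the ordinal i stands for the second
   coordinate k = i + 1. *)
Definition Gam : choiceType := (int * 'I_(N.*2.+1))%type.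

(* f_{n,k} for any natural number k, with f_{n,0} = 0 and f_{n,k} = 0 when
   k > p. *)
Definition at_vertex (f : Gam -> R[i]) (n : int) (k : nat) : R[i] :=
  if k is k'.+1 then
    if insub k' is Some i then f (n, i) else 0
  else 0.

Definition Delta (f : Gam -> R[i]) (x : Gam) : R[i] :=
  let n := x.1 in
  let k := (x.2).+1 in
  if odd k then
    at_vertex f n k.-1 + at_vertex f (n - 1) k.+1 + at_vertex f n k.+1
  else
    at_vertex f n k.-1 + at_vertex f (n + 1) k.-1 + at_vertex f n k.+1.

Definition Hop (v : 'rV[R]_(N.*2.+1)) (f : Gam -> R[i]) (x : Gam) : R[i] :=
  Delta f x + (v ord0 x.2)%:C * f x.

(* The entry v_k in the numbering 1 <= k <= p. *)
Definition entry (v : 'rV[R]_(N.*2.+1)) (k : nat) : R := v ord0 (inord k.-1).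

Definition enorm (v : 'rV[R]_(N.*2.+1)) : R :=
  Num.sqrt (\sum_i (v ord0 i) ^+ 2).

(* Indices start at 0 here, so the off-diagonal entry in position (i, i+1) is a
   for even i and 1 for odd i. *)
Definition J (a : R) (v : 'rV[R]_(N.*2.+1)) : 'M[R]_(N.*2.+1) :=
  let off (i : nat) := if odd i then 1 else a in
  \matrix_(i, j)
    if i == j then v ord0 i
    else if j == i.+1 :> nat then off i
    else if i == j.+1 :> nat then off j
    else 0.

(* Eigenvalues repeated according to multiplicity, in nondecreasing order. The
   list is unique when it exists, and it exists for every real symmetric A. *)
Definition eigenvalues (n : nat) (A : 'M[R]_n) : seq R :=
  xget [::] [set s : seq R |
    sorted <=%R s /\ char_poly A = \prod_(x <- s) ('X - x%:P)].

(* The middle eigenvalue: the list is (lambda_{-N}, ..., lambda_N). *)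
Definition lambda0 (a : R) (v : 'rV[R]_(N.*2.+1)) : R :=
  (eigenvalues (J a v))`_N.

Definition sigma0 (v : 'rV[R]_(N.*2.+1)) : set R :=
  [set lambda0 a v | a in `[0, 2]].

(* The infima and suprema over a in [0,2], here and in the theorem, are attained
   because the functions of a are continuous. *)
Definition lambda0m (v : 'rV[R]_(N.*2.+1)) : R := inf (sigma0 v).
Definition lambda0p (v : 'rV[R]_(N.*2.+1)) : R := sup (sigma0 v).

Definition F (a : R) (v : 'rV[R]_(N.*2.+1)) : R :=
  (\sum_(0 <= k < N.+1) entry v k.*2.+1 * a ^+ k.*2) /
  (\sum_(0 <= k < N.+1) a ^+ k.*2).

(* 0 = v_1 <= v_3 <= ... <= v_p and 0 < v_p *)
Definition odd_entries_increasing (v : 'rV[R]_(N.*2.+1)) : Prop :=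
  [/\ entry v 1 = 0,
      forall k, (k < N)%N -> entry v k.*2.+1 <= entry v k.*2.+3
    & 0 < entry v N.*2.+1].

End Ribbon.

(* Main.v *)
Require Import Defs.
From HB Require Import structures.
From mathcomp Require Import all_boot all_order all_algebra.
From mathcomp Require Import all_classical all_reals all_analysis.
From mathcomp Require Import fingroup perm complex spectral.
From mathcomp Require Import measurable_realfun.
From mathcomp Require Import zify ring lra.

Set Implicit Arguments.
Unset Strict Implicit.
Unset Printing Implicit Defensive.
Import Order.TTheory GRing.Theory Num.Theory.
Import numFieldNormedType.Exports.

Local Open Scope ring_scope.

(** The theorem is about the matrices J_a, the fibres of H at a = 2 |cos t|; the
    proof has three parts.

    Band edges. For v = 0 the vector with entries (-a)^k at the odd vertices
    2k+1 is a kernel vector of J_a, and the other eigenvalues stay away from 0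
    by [gap], uniformly in a. F(a,v) is the Rayleigh quotient of this zero mode.
    The min-max principle on the span of the zero mode and the positive, or
    negative, eigenvectors of the unperturbed matrix bounds lambda_0 by F on
    both sides up to the square of the largest entry of v at an odd vertex
    ([trial_lower], [lambda0_approx]). Only odd vertices enter that error, which
    is why it is O(v_p^2) in the second part; there F increases with a, so
    that its extrema are F(0,v) = 0 and F(2,v).

    Monotonicity. Solving the eigenvalue equation of J_a from the first vertex
    on expresses the eigenvalues as the zeros of a continuant B_N, a polynomial
    in lambda and s = a^2. Near 0 it is the sum of (lambda - v_(2k+1)) s^k up
    to a function of s with Lipschitz constant O(v_p^2)
    ([continuants_estimate]). If lambda_0(a) = lambda_0(b) with a < b, then B_N
    vanishes at a^2 and at b^2 for one lambda, while a Chebyshev inequality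
    ([chebyshev_head_sum]) keeps the two main terms apart by v_3 (b^2 - a^2). As
    v_p <= C v_3, this is impossible for small v. So lambda_0 is injective on
    [0,2], hence strictly increasing ([lambda0_increasing]).

    Multiplicity. H maps real families to real families, so real square-summable
    families suffice. Polynomials of H applied to the point mass at the vertex
    (n,1) are Fourier integrals of polynomials of the fibres ([polop_delta]).
    As the middle eigenvalue is isolated, the component gamma_n of that point
    mass in the band is the limit of e(H) applied to it, for polynomials e that
    converge to a bump function on the spectrum ([band_part_exists]). With
    lambda(t) = lambda_0(2 cos t) and the weight omega(t) of lambda(t) at the
    first vertex, the inner product of q(H) gamma_n and gamma_m is the mean of
    cos(2(m-n)t) q(lambda(t)) omega(t) ([dot_band_part]). In other words,
    gamma_n is the function exp(2int) in the L^2 space of omega dt, and H is the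
    multiplication by lambda. The function lambda is even, and strictly
    monotone in cos(t)^2; so the even and the odd functions are two cyclic
    subspaces, generated by 1 and 2i sin(2t), that is by gamma_0 and
    gamma_1 - gamma_(-1), and their spectral measures have the same null sets.
    They exhaust the band: cos(2nt) and sin(2nt)/sin(2t) are polynomials in
    cos(2t), hence uniform limits of polynomials in lambda, so that a vector f
    of the band that is orthogonal to both subspaces is orthogonal to all
    gamma_n and vanishes at all (n,1). The same holds for H^k f, and the
    difference equation then makes f vanish row by row ([residual_zero]). *)

(** * Diagonalization and min-max bounds for real symmetric matrices *)

Definition qform (R : nzRingType) n (A : 'M[R]_n) (u : 'rV[R]_n) : R :=
  (u *m A *m u^T) 0 0.

Definition sqn (R : nzRingType) n (u : 'rV[R]_n) : R := \sum_i u 0 i ^+ 2.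

Section Symmetric.
Variable R : realType.
Local Notation C := R[i].
Local Notation toC := (@real_complex R).

Lemma sqn_ge0 n (u : 'rV[R]_n) : 0 <= sqn u.
Proof. by apply: sumr_ge0 => i _; exact: sqr_ge0. Qed.

Lemma sqn_eq0 n (u : 'rV[R]_n) : (sqn u == 0) = (u == 0).
Proof.
rewrite psumr_eq0; last by move=> i _; exact: sqr_ge0.
apply/allP/eqP => [h|-> i _]; last by rewrite mxE expr0n eqxx.
apply/rowP => i; rewrite mxE; apply/eqP.
by have := h i (mem_index_enum i); rewrite /= sqrf_eq0.
Qed.

Lemma sqnE n (u : 'rV[R]_n) : (u *m u^T) 0 0 = sqn u.
Proof. by rewrite mxE; apply: eq_bigr => i _; rewrite mxE expr2. Qed.

(** An eigenvalue exists because A is Hermitian over the complex numbers, where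
    it is unitarily diagonalizable with a real diagonal. *)
Lemma symmetric_eigenvalue n (A : 'M[R]_n.+1) : A^T = A -> exists a, eigenvalue A a.
Proof.
move=> symA; pose B := map_mx toC A.
have hB : B \is hermsymmx.
  apply: realsym_hermsym; last first.
    by apply/mxOverP => i j; rewrite mxE; apply/complex_realP; eexists.
  by apply/is_hermitianmxP; rewrite expr0 scale1r map_mx_id // /B map_trmx symA.
have /orthomx_spectralP BE := hermitian_normalmx hB.
have /mxOverP/(_ 0 0) dreal := hermitian_spectral_diag_real hB.
have Punit := spectral_unit B.
set P := spectralmx B in BE Punit *; set d := spectral_diag B in BE dreal *.
have dR : d 0 0 = toC (complex.Re (d 0 0)).
  by case/complex_realP: dreal => x ->.
exists (complex.Re (d 0 0)).
suff: eigenvalue B (d 0 0).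
  by rewrite !eigenvalue_root_char {1}dR -map_char_poly fmorph_root.
apply/eigenvalueP; exists (row 0 P).
  have := congr1 (fun M => row 0 (P *m M)) BE.
  rewrite /= !mulmxA mulmxV // mul1mx row_mul => ->.
  by rewrite row_mul row_diag_mx -scalemxAl -rowE.
apply/negP => /eqP P0; have := row_mul 0 P (invmx P).
by rewrite P0 mul0mx mulmxV // => /rowP/(_ 0); rewrite !mxE eqxx => /eqP; rewrite oner_eq0.
Qed.

(** Q is the Householder reflection that exchanges v and the first basis vector. *)
Lemma unit_row_completion n (v : 'rV[R]_n.+1) : sqn v = 1 ->
  exists Q : 'M[R]_n.+1, [/\ Q^T = Q, Q *m Q = 1%:M & row 0 Q = v].
Proof.
move=> v1; pose e : 'rV[R]_n.+1 := delta_mx 0 0; pose w := v - e.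
have [w0|wN0] := eqVneq w 0.
  exists 1%:M; split; rewrite ?trmx1 ?mulmx1 //.
  by rewrite row1; move/eqP: w0; rewrite subr_eq0 => /eqP ->.
(* The reflection 1 - (2 / |w|^2) w^T w along w = v - e. *)
pose k := sqn w; have kN0 : k != 0 by rewrite sqn_eq0.
have sE (a b : 'rV[R]_n.+1) : a *m b^T = ((a *m b^T) 0 0)%:M by rewrite -mx11_scalar.
have wk : w *m w^T = k%:M by rewrite sE sqnE.
have we : e *m w^T = (v 0 0 - 1)%:M.
  rewrite sE; congr (_%:M); rewrite -rowE !mxE eqxx //.
have kE : k = - 2 * (v 0 0 - 1).
  rewrite /k /sqn big_ord_recl /w !mxE eqxx /=.
  have -> : \sum_(i < n) (v - e) 0 (lift ord0 i) ^+ 2 = \sum_(i < n) v 0 (lift ord0 i) ^+ 2.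
    by apply: eq_bigr => i _; rewrite !mxE /= subr0.
  by move: v1; rewrite /sqn big_ord_recl => /(canRL (addKr _)) ->; ring.
exists (1%:M - (2 / k) *: (w^T *m w)); split.
- by rewrite linearB /= trmx1 linearZ /= trmx_mul trmxK.
- have TT : (w^T *m w) *m (w^T *m w) = k *: (w^T *m w).
    by rewrite mulmxA -[_ *m w *m _]mulmxA wk mul_mx_scalar -scalemxAl.
  set T := w^T *m w in TT *.
  rewrite mulmxBr mulmx1 mulmxBl mul1mx -scalemxAl -scalemxAr TT !scalerA.
  rewrite (_ : 2 / k * (2 / k) * k = 2 / k + 2 / k); last by field.
  by rewrite scalerDl opprB addrK subrK.
- rewrite linearB /= row1 rowE -/e -scalemxAr mulmxA we mul_scalar_mx scalerA.
  rewrite (_ : 2 / k * _ = -1).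
    by rewrite scaleN1r opprK addrC subrK.
  rewrite kE; field; rewrite ?mulf_neq0 //; apply: contra kN0; rewrite kE => /eqP ->.
  by rewrite mulr0.
Qed.

(** Deflation: a reflection that moves a unit eigenvector to the first basis
    vector turns A into a block matrix, whose lower block is symmetric again. *)
Lemma symmetric_diagonalization n (A : 'M[R]_n) : A^T = A ->
  exists (P : 'M[R]_n) (d : 'rV[R]_n), P *m P^T = 1%:M /\ A = P^T *m diag_mx d *m P.
Proof.
elim: n A => [|n IH] A symA.
  by exists 1%:M, 0; split; apply/matrixP => -[].
have [a /eigenvalueP [u uA uN0]] := symmetric_eigenvalue symA.
pose c := Num.sqrt (sqn u).
have u_gt0 : 0 < sqn u by rewrite lt_neqAle sqn_ge0 eq_sym sqn_eq0 uN0.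
have cN0 : c != 0 by rewrite gt_eqF // sqrtr_gt0.
have sq1 : sqn (c^-1 *: u) = 1.
  rewrite /sqn (eq_bigr (fun i => c^-1 ^+ 2 * u 0 i ^+ 2)); last first.
    by move=> i _; rewrite mxE exprMn.
  by rewrite -mulr_sumr -/(sqn u) -(sqr_sqrtr (ltW u_gt0)) -exprMn mulVf // expr1n.
have [Q [QT QQ Q0]] := unit_row_completion sq1.
have eQAQ : row 0 (Q *m A *m Q) = a *: delta_mx 0 0.
  rewrite !row_mul Q0 -scalemxAl uA scalerA mulrC -scalerA -scalemxAl.
  by rewrite -Q0 -row_mul QQ row1.
have symQAQ : (Q *m A *m Q)^T = Q *m A *m Q.
  by rewrite !trmx_mul symA QT mulmxA.
pose M : 'M[R]_(1 + n) := Q *m A *m Q.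
have AE : A = Q *m M *m Q by rewrite /M !mulmxA QQ mul1mx -mulmxA QQ mulmx1.
have M0 j : M 0 j = a * (j == 0)%:R.
  by transitivity (row 0 (Q *m A *m Q) 0 j); [rewrite [RHS]mxE | rewrite eQAQ !mxE eqxx].
have symM : M^T = M by [].
clearbody M; clear eQAQ symQAQ.
have Mb : M = block_mx a%:M 0 0 (drsubmx M).
  rewrite -[LHS](@submxK _ 1 n 1 n); congr block_mx.
  - apply/matrixP => i j; rewrite !ord1 !mxE eqxx mulr1n.
    by rewrite (_ : lshift n 0 = 0) ?M0 ?eqxx ?mulr1 //; apply: val_inj.
  - apply/matrixP => i j; rewrite !ord1 !mxE.
    by rewrite (_ : lshift n 0 = 0) ?M0 ?mulr0 //; apply: val_inj.
  - apply/matrixP => i j; rewrite !ord1 !mxE -symM mxE.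
    by rewrite (_ : lshift n 0 = 0) ?M0 ?mulr0 //; apply: val_inj.
have symD : (drsubmx M)^T = drsubmx M.
  by rewrite trmx_drsub symM.
have [P [d [PP dE]]] := IH _ symD.
pose S : 'M[R]_(1 + n) := block_mx 1%:M 0 0 P.
have SS : S *m S^T = 1%:M.
  rewrite /S tr_block_mx !trmx0 trmx1 mulmx_block !(mulmx0, mul0mx, addr0, add0r).
  by rewrite mul1mx PP -scalar_mx_block.
have SM : M = S^T *m diag_mx (row_mx a%:M d) *m S.
  rewrite Mb {1}dE /S tr_block_mx !trmx0 trmx1 diag_mx_row !mulmx_block.
  rewrite !(mulmx0, mul0mx, addr0, add0r, mulmx1, mul1mx).
  by congr block_mx; apply/matrixP => i j; rewrite !ord1 !mxE eqxx.
exists (S *m Q), (row_mx a%:M d); split.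
  rewrite trmx_mul QT mulmxA -[_ *m Q *m Q]mulmxA QQ mulmx1.
  exact: SS.
by rewrite {1}AE trmx_mul QT SM !mulmxA.
Qed.

Lemma char_poly_orthogonal_conj n (P A : 'M[R]_n) : P *m P^T = 1%:M ->
  char_poly (P^T *m A *m P) = char_poly A.
Proof.
move=> PP; have PP' : P^T *m P = 1%:M by apply: mulmx1C.
rewrite /char_poly /char_poly_mx.
have -> : 'X%:M - map_mx polyC (P^T *m A *m P) =
   map_mx polyC P^T *m ('X%:M - map_mx polyC A) *m map_mx polyC P.
  rewrite mulmxBr mulmxBl !map_mxM; congr (_ - _).
  by rewrite mul_mx_scalar -scalemxAl -map_mxM PP' map_mx1 scalemx1.
by rewrite !det_mulmx mulrAC -det_mulmx -map_mxM PP' map_mx1 det1 mul1r.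
Qed.

Lemma char_poly_diag n (d : 'rV[R]_n) : char_poly (diag_mx d) = \prod_i ('X - (d 0 i)%:P).
Proof.
have := @char_poly_trig _ _ (diag_mx d); rewrite diag_mx_is_trig => /(_ isT) ->.
by apply: eq_bigr => i _; rewrite mxE eqxx.
Qed.

(** The diagonal of an orthogonal diagonalization, once sorted, is a list with
    the property that defines [eigenvalues]; conversely every such list is a
    permutation of that diagonal, and P can be permuted accordingly. *)
Lemma eigenvalues_spectral n (A : 'M[R]_n) : A^T = A ->
  [/\ size (eigenvalues A) = n, sorted <=%R (eigenvalues A) &
   exists2 P : 'M[R]_n, P *m P^T = 1%:M &
     A = P^T *m diag_mx (\row_i (eigenvalues A)`_i) *m P].
Proof.
move=> symA; have [P [d [PP AE]]] := symmetric_diagonalization symA.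
have cA : char_poly A = \prod_(x <- [tuple d 0 i | i < n]) ('X - x%:P).
  by rewrite AE char_poly_orthogonal_conj // char_poly_diag big_tuple; apply: eq_bigr => i _; rewrite tnth_mktuple.
have [] : sorted <=%R (eigenvalues A) /\
          char_poly A = \prod_(x <- eigenvalues A) ('X - x%:P).
  apply: (@xgetPex _ [::] [set s : seq R | sorted <=%R s /\
    char_poly A = \prod_(x <- s) ('X - x%:P)]%classic).
  exists (sort <=%R [tuple d 0 i | i < n]); split; first by apply: sort_sorted; exact: le_total.
  by rewrite cA; apply: perm_big; rewrite perm_sym perm_sort.
move: (eigenvalues A) => s sorteds; rewrite {1}cA => /esym/prod_XsubC_eq sd.
have ss : size s = n by rewrite (perm_size sd) size_tuple.
split => //; move/tuple_permP: (sd) => [p sE].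
exists (row_perm p P).
  apply/matrixP => i j; have /matrixP/(_ (p i) (p j)) := PP.
  rewrite [in X in _ = X -> _]mxE (inj_eq (@perm_inj _ p)) mxE => PPij.
  by rewrite [RHS]mxE -PPij mxE; apply: eq_bigr => k _; rewrite !mxE.
rewrite AE; apply/matrixP => i j.
have E (M : 'M[R]_n) (c : 'rV[R]_n) : (M^T *m diag_mx c *m M) i j = \sum_k c 0 k * M k i * M k j.
  by rewrite mul_mx_diag mxE; apply: eq_bigr => k _; rewrite !mxE; ring.
rewrite !E (reindex_inj (@perm_inj _ p)) /=; apply: eq_bigr => k _.
by rewrite !mxE; congr (_ * _ * _); rewrite sE (nth_map k) ?size_enum_ord // nth_ord_enum tnth_mktuple.
Qed.


Lemma qform_conj n (P : 'M[R]_n) (d u : 'rV[R]_n) :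
  qform (P^T *m diag_mx d *m P) u = \sum_k d 0 k * (u *m P^T) 0 k ^+ 2.
Proof.
rewrite /qform; have -> : u *m (P^T *m diag_mx d *m P) *m u^T =
    (u *m P^T) *m diag_mx d *m (u *m P^T)^T by rewrite trmx_mul trmxK !mulmxA.
by rewrite mul_mx_diag mxE; apply: eq_bigr => k _; rewrite !mxE; ring.
Qed.

Lemma sqn_orthogonal n (P : 'M[R]_n) (u : 'rV[R]_n) : P *m P^T = 1%:M ->
  sqn (u *m P^T) = sqn u.
Proof.
move=> PP; have PP' : P^T *m P = 1%:M by apply: mulmx1C.
by rewrite -!sqnE trmx_mul trmxK mulmxA -[u *m _ *m _]mulmxA PP' mulmx1.
Qed.

(** Fewer conditions than unknowns. This is the dimension count of the min-max
    principle: Q indexes the eigenvectors to be avoided. *)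
Lemma exists_vanishing_on m n (M : 'M[R]_(m, n)) (Q : {set 'I_n}) : (#|Q| < m)%N ->
  exists2 c : 'rV[R]_m, c != 0 & forall j, j \in Q -> (c *m M) 0 j = 0.
Proof.
move=> Qm; pose X := colsub (@enum_val _ (mem Q)) M.
have /rowV0Pn [c cX cN0] : kermx X != 0.
  rewrite -mxrank_eq0 mxrank_ker subn_eq0 -ltnNge.
  exact: leq_ltn_trans (rank_leq_col _) Qm.
exists c => // j jQ; move/sub_kermxP/rowP/(_ (enum_rank_in jQ j)): cX.
by rewrite mxE [RHS]mxE => E; rewrite mxE -[RHS]E; apply: eq_bigr => i _; rewrite mxE enum_rankK_in.
Qed.

Lemma weighted_sum_le0_eq0 n (d y : 'rV[R]_n) : (forall i, y 0 i != 0 -> 0 < d 0 i) ->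
  \sum_i d 0 i * y 0 i ^+ 2 <= 0 -> y = 0.
Proof.
move=> dpos le0; have t_ge0 i : true -> 0 <= d 0 i * y 0 i ^+ 2.
  move=> _; have [->|yi] := eqVneq (y 0 i) 0; first by rewrite expr0n mulr0.
  by rewrite mulr_ge0 ?sqr_ge0 // ltW // dpos.
have /eqP := le_anti (introT andP (conj le0 (sumr_ge0 _ t_ge0))).
rewrite psumr_eq0 // => /allP h; apply/rowP => i; rewrite mxE; apply/eqP.
have := h i (mem_index_enum i); rewrite /= mulf_eq0 sqrf_eq0.
by case/orP => // d0; apply/negPn/negP => /dpos; rewrite (eqP d0) ltxx.
Qed.

Lemma linear_matrix m n (f : 'rV[R]_m -> 'rV[R]_n) : linear f ->
  exists W, forall c, f c = c *m W.
Proof.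
move=> flin; pose L := GRing.isLinear.Build _ _ _ _ f flin.
pose F : {linear 'rV[R]_m -> 'rV[R]_n} := HB.pack f L.
by exists (lin1_mx F) => c; rewrite mul_rV_lin1.
Qed.

Section MinMax.
Variables (n : nat) (A : 'M[R]_n) (symA : A^T = A) (k : 'I_n) (x : R).

Let card_below : (#|[set j : 'I_n | (j < k)%N]| < k.+1)%N.
Proof.
rewrite ltnS -[X in (_ <= X)%N]card_ord.
apply: leq_trans (leq_imset_card (widen_ord (ltnW (ltn_ord k))) 'I_k).
apply/subset_leq_card/fintype.subsetP => j; rewrite inE => jk.
by apply/imsetP; exists (Ordinal jk) => //; apply: val_inj.
Qed.

Let card_above : (#|[set j : 'I_n | (k < j)%N]| < n - k)%N.
Proof.
have nk : (0 < n - k)%N by rewrite subn_gt0.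
have lt_add (i : 'I_(n - k).-1) : (k.+1 + i < n)%N.
  by have := ltn_ord i; have := ltn_ord k; lia.
rewrite -(prednK nk) ltnS -[X in (_ <= X)%N]card_ord.
apply: leq_trans (leq_imset_card (fun i => Ordinal (lt_add i)) 'I_(n - k).-1).
apply/subset_leq_card/fintype.subsetP => j; rewrite inE => jk.
have jlt : (j - k.+1 < (n - k).-1)%N by have := ltn_ord j; lia.
by apply/imsetP; exists (Ordinal jlt) => //; apply: val_inj; rewrite /= subnKC.
Qed.

(** The two halves of the min-max principle. The test space is given as the
    image of an injective linear map f. A nonzero vector of it is orthogonal to
    the first (here) or last ([eigenvalue_ge]) eigenvectors, and its quadratic
    form would contradict the bound if the k-th eigenvalue violated it. *)
Lemma eigenvalue_le m (f : 'rV[R]_m -> 'rV[R]_n) : linear f -> (k < m)%N ->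
  (forall c, f c = 0 -> c = 0) ->
  (forall c, qform A (f c) <= x * sqn (f c)) -> (eigenvalues A)`_k <= x.
Proof.
move=> flin km finj fle; have [sz srt [P PP AE]] := eigenvalues_spectral symA.
rewrite leNgt; apply/negP => x_lt.
have [W fW] := linear_matrix flin.
have [c cN0 cQ] := exists_vanishing_on (W *m P^T) (leq_trans card_below km).
have [] := negP cN0; apply/eqP/finj; rewrite fW.
have y0 : c *m W *m P^T = 0.
  apply: (@weighted_sum_le0_eq0 _ (\row_i ((eigenvalues A)`_i - x))).
    move=> i; rewrite -mulmxA => yi; rewrite mxE subr_gt0.
    apply: (lt_le_trans x_lt); apply: (le_sorted_leq_nth 0 srt); rewrite ?inE ?sz //.
    by rewrite leqNgt; apply: contra yi => ik; rewrite cQ // inE.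
  under eq_bigr do rewrite mxE mulrBl.
  rewrite sumrB -mulr_sumr -/(sqn _) sqn_orthogonal // subr_le0 -fW.
  rewrite (le_trans _ (fle c)) // {2}AE qform_conj.
  by apply: ler_sum => i _; rewrite [X in _ <= X * _]mxE.
have PP' : P^T *m P = 1%:M by apply: mulmx1C.
by rewrite -[c *m W]mulmx1 -PP' mulmxA y0 mul0mx.
Qed.

Lemma eigenvalue_ge m (f : 'rV[R]_m -> 'rV[R]_n) : linear f -> (n - k <= m)%N ->
  (forall c, f c = 0 -> c = 0) ->
  (forall c, x * sqn (f c) <= qform A (f c)) -> x <= (eigenvalues A)`_k.
Proof.
move=> flin km finj fle; have [sz srt [P PP AE]] := eigenvalues_spectral symA.
rewrite leNgt; apply/negP => x_lt.
have [W fW] := linear_matrix flin.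
have [c cN0 cQ] := exists_vanishing_on (W *m P^T) (leq_trans card_above km).
have [] := negP cN0; apply/eqP/finj; rewrite fW.
have y0 : c *m W *m P^T = 0.
  apply: (@weighted_sum_le0_eq0 _ (\row_i (x - (eigenvalues A)`_i))).
    move=> i; rewrite -mulmxA => yi; rewrite mxE subr_gt0.
    apply: (le_lt_trans _ x_lt); apply: (le_sorted_leq_nth 0 srt); rewrite ?inE ?sz //.
    by rewrite leqNgt; apply: contra yi => ik; rewrite cQ // inE.
  under eq_bigr do rewrite mxE mulrBl.
  rewrite sumrB -mulr_sumr -/(sqn _) sqn_orthogonal // subr_le0 -fW.
  rewrite (le_trans (fle c)) // {1}AE qform_conj.
  by apply: ler_sum => i _; rewrite [X in X * _ <= _]mxE.
have PP' : P^T *m P = 1%:M by apply: mulmx1C.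
by rewrite -[c *m W]mulmx1 -PP' mulmxA y0 mul0mx.
Qed.

End MinMax.

(** Weyl's inequality: the span of the first k+1 eigenvectors of B is a test
    space for A. *)
Lemma eigenvalue_le_add n (A B : 'M[R]_n) (k : 'I_n) e : A^T = A -> B^T = B ->
  (forall u, qform A u <= qform B u + e * sqn u) ->
  (eigenvalues A)`_k <= (eigenvalues B)`_k + e.
Proof.
move=> symA symB AB; have [sz srt [P PP BE]] := eigenvalues_spectral symB.
(* Coordinates with respect to the first k+1 rows of P. *)
pose E : 'M[R]_(k.+1, n) := \matrix_(i, j) (i == j :> nat)%:R.
have cE (c : 'rV[R]_k.+1) j : (c *m E) 0 j = if (j < k.+1)%N then c 0 (inord j) else 0.
  rewrite mxE; case: ifP => [jk|jk].
    rewrite (bigD1 (inord j)) //= mxE inordK // eqxx mulr1 big1 ?addr0 // => i ij.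
    rewrite mxE; case: eqP => [iE|_]; last by rewrite mulr0.
    by case/eqP: ij; apply: val_inj; rewrite /= inordK.
  by apply: big1 => i _; rewrite mxE; case: eqP => [iE|_]; [rewrite -iE ltn_ord in jk | rewrite mulr0].
have cEP (c : 'rV[R]_k.+1) : c *m (E *m P) *m P^T = c *m E by rewrite mulmxA -mulmxA PP mulmx1.
apply: (eigenvalue_le symA (f := fun c => c *m (E *m P))) => //.
  by move=> t c c' /=; rewrite mulmxDl scalemxAl.
  move=> c /(congr1 (mulmx^~ P^T)); rewrite mul0mx cEP => /rowP c0.
  apply/rowP => i; have ik : (i < n)%N by apply: leq_trans (ltn_ord i) (ltn_ord k).
  by have := c0 (Ordinal ik); rewrite cE /= ltn_ord !mxE inord_val.
move=> c; apply: le_trans (AB _) _; rewrite mulrDl lerD2r {1}BE qform_conj.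
rewrite -(sqn_orthogonal _ PP) mulr_sumr; apply: ler_sum => i _.
rewrite cEP cE; case: ifP => ik; last by rewrite expr0n !mulr0.
rewrite ler_wpM2r ?sqr_ge0 // mxE.
by apply: (le_sorted_leq_nth 0 srt); rewrite ?inE ?sz.
Qed.

Lemma eigenvalue_lipschitz n (A B : 'M[R]_n) (k : 'I_n) e : A^T = A -> B^T = B ->
  (forall u, `|qform A u - qform B u| <= e * sqn u) ->
  `|(eigenvalues A)`_k - (eigenvalues B)`_k| <= e.
Proof.
move=> symA symB AB; rewrite ler_distlC lerBlDr !eigenvalue_le_add // => u.
  by have := AB u; rewrite ler_distlC => /andP[_].
by have := AB u; rewrite ler_distlC => /andP[]; rewrite lerBlDr.
Qed.

End Symmetric.

(** * The quadratic form of the fibre matrices *)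

Section Coordinates.
Variable R : nzRingType.

(** Vectors are read as sequences that vanish outside the index range, so that
    recurrences and parity splittings need no ordinals. *)
Definition coord n (u : 'rV[R]_n) (k : nat) : R :=
  if insub k is Some i then u 0 i else 0.

Lemma coordE n (u : 'rV[R]_n) (i : 'I_n) : coord u i = u 0 i.
Proof. by rewrite /coord valK. Qed.

Lemma coord_lt n (u : 'rV[R]_n) k (kn : (k < n)%N) : coord u k = u 0 (Ordinal kn).
Proof. by rewrite -coordE. Qed.

Lemma coord_ge n (u : 'rV[R]_n) k : (n <= k)%N -> coord u k = 0.
Proof. by move=> nk; rewrite /coord insubF // ltnNge nk. Qed.

Lemma coord_row n (f : nat -> R) k : (k < n)%N -> coord (\row_(i < n) f i) k = f k.
Proof. by move=> kn; rewrite coord_lt mxE. Qed.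

Lemma coord0 n k : coord (0 : 'rV[R]_n) k = 0.
Proof. by rewrite /coord; case: insub => // i; rewrite mxE. Qed.

Lemma coord_linear n a (u w : 'rV[R]_n) k :
  coord (a *: u + w) k = a * coord u k + coord w k.
Proof. by rewrite /coord; case: insub => [i|]; rewrite ?mxE ?mulr0 ?addr0. Qed.

Lemma sum_coord_eq n (u : 'rV[R]_n) m : \sum_j u 0 j * (j == m :> nat)%:R = coord u m.
Proof.
have [mn|nm] := ltnP m n; last first.
  rewrite coord_ge // big1 // => j _; case: eqP => [jm|_]; last by rewrite mulr0.
  by move: (ltn_ord j); rewrite jm ltnNge nm.
rewrite coord_lt (bigD1 (Ordinal mn)) //= eqxx mulr1 big1 ?addr0 // => j jm.
by case: eqP => [jE|]; rewrite ?mulr0 //; case/eqP: jm; apply: val_inj.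
Qed.

End Coordinates.

Lemma sum_parity (V : nmodType) (f : nat -> V) N :
  \sum_(i < N.*2.+1) f i = \sum_(k < N.+1) f k.*2 + \sum_(k < N) f k.*2.+1.
Proof.
elim: N => [|N IH]; first by rewrite !big_ord_recr !big_ord0 /= addr0.
rewrite doubleS 2!big_ord_recr /= IH [\sum_(k < N.+2) _]big_ord_recr.
rewrite [X in _ = _ + X]big_ord_recr /= doubleS -!addrA; congr (_ + _).
by rewrite [RHS]addrCA; congr (_ + _); rewrite addrC.
Qed.

Lemma sum_parity_even (V : nmodType) (f : nat -> V) N :
  \sum_(i < N.*2) f i = \sum_(k < N) f k.*2 + \sum_(k < N) f k.*2.+1.
Proof.
elim: N => [|N IH]; first by rewrite !big_ord0 addr0.
rewrite doubleS 2!big_ord_recr /= IH !big_ord_recr /=.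
by rewrite -!addrA; congr (_ + _); rewrite addrCA.
Qed.

Section Fibre.
Variables (R : realType) (N : nat).
Local Notation p := (N.*2.+1).
Implicit Types (a : R) (v u : 'rV[R]_p).

Lemma J_sym a v : (J a v)^T = J a v.
Proof.
apply/matrixP => i j; rewrite !mxE eq_sym.
have [->//|ij] := eqVneq i j.
by case: eqP => [->|_]; case: eqP => // ji; exfalso; lia.
Qed.

Lemma mul_J a v u (i : 'I_p) :
  (u *m J a v) 0 i = v 0 i * u 0 i + (if odd i then 1 else a) * coord u i.+1
    + (if i : nat is i'.+1 then (if odd i' then 1 else a) * coord u i' else 0).
Proof.
set off := fun i => if odd i then 1 else a.
have E j : J a v j i = v 0 i * (j == i :> nat)%:R + off i * (j == i.+1 :> nat)%:R
    + (if i : nat is i'.+1 then off i' * (j == i' :> nat)%:R else 0).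
  rewrite mxE -/(off _) -/(off _); have [->|] := eqVneq j i.
    rewrite eqxx mulr1 ltn_eqF // mulr0 addr0; case: (nat_of_ord i) => [|i']; rewrite ?addr0 //.
    by rewrite gtn_eqF // mulr0 addr0.
  rewrite -val_eqE /= => /negbTE ->; rewrite mulr0 add0r.
  case: (nat_of_ord i) => [|i'] /=.
    by case: (nat_of_ord j == 1)%N; rewrite ?mulr0 ?mulr1 addr0.
  rewrite eqSS [i' == _]eq_sym; case: (eqVneq (nat_of_ord j) i') => [->|ij].
    by rewrite ltn_eqF // mulr0 mulr1 add0r.
  by case: (nat_of_ord j == _)%N; rewrite ?mulr0 ?mulr1 ?addr0 ?add0r.
rewrite mxE (eq_bigr (fun j => v 0 i * (u 0 j * (j == i :> nat)%:R)
   + off i * (u 0 j * (j == i.+1 :> nat)%:R)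
   + if i : nat is i'.+1 then off i' * (u 0 j * (j == i' :> nat)%:R) else 0)); last first.
  by move=> j _; rewrite E; case: (nat_of_ord i) => [|i']; rewrite ?mulr0; ring.
rewrite !big_split /= -!mulr_sumr !sum_coord_eq coordE; congr (_ + _).
case: (nat_of_ord i) => [|i']; first by rewrite big1.
by rewrite -mulr_sumr sum_coord_eq.
Qed.

(** J_a couples only vertices of different parity. *)
Lemma qform_J a v u : qform (J a v) u =
  \sum_(k < N.+1) coord v k.*2 * coord u k.*2 ^+ 2
  + \sum_(k < N) coord v k.*2.+1 * coord u k.*2.+1 ^+ 2
  + 2 * \sum_(k < N) coord u k.*2.+1 * (a * coord u k.*2 + coord u k.*2.+2).
Proof.
pose off i := if odd i then 1 else a.
pose g i := off i * coord u i.+1 * coord u i.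
have -> : qform (J a v) u = \sum_(i < p) coord v i * coord u i ^+ 2
    + (\sum_(i < p) g i + \sum_(i < p) (if i : nat is i'.+1 then g i' else 0)).
  rewrite -!big_split /qform mxE; apply: eq_bigr => i _.
  rewrite mul_J [u^T _ _]mxE -!coordE /g /off /=; case: (nat_of_ord i) => [|i'] /=; ring.
have -> : \sum_(i < p) g i = \sum_(i < N.*2) g i.
  by rewrite big_ord_recr /= {2}/g coord_ge // mulr0 mul0r addr0.
have -> : \sum_(i < p) (if i : nat is i'.+1 then g i' else 0) = \sum_(i < N.*2) g i.
  by rewrite big_ord_recl add0r.
set G := \sum_(i < N.*2) g i; rewrite (_ : G + G = 2 * G); last by ring.
rewrite {}/G.
rewrite (sum_parity (fun i => coord v i * coord u i ^+ 2)) sum_parity_even -big_split /=.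
by congr (_ + _ * _); apply: eq_bigr => k _; rewrite /g /off /= odd_double /=; ring.
Qed.

Lemma sqn_parity u : sqn u =
  \sum_(k < N.+1) coord u k.*2 ^+ 2 + \sum_(k < N) coord u k.*2.+1 ^+ 2.
Proof.
rewrite -(sum_parity (fun i => coord u i ^+ 2)).
by apply: eq_bigr => i _; rewrite coordE.
Qed.

(** The coupling of the two sublattices of J_a: g is given at the vertices 2k+2
    and bond a g at the vertices 2k+1. *)
Definition bond a (g : nat -> R) (k : nat) : R :=
  a * g k + (if k is k'.+1 then g k' else 0).

(** The zero mode is orthogonal to the range of the coupling when g vanishes at
    the end. *)
Lemma bond_kernel a g M : \sum_(k < M.+1) (- a) ^+ k * bond a g k = (- a) ^+ M * (a * g M).
Proof.
rewrite /bond; elim: M => [|M IH].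
  by rewrite big_ord_recr big_ord0 /= add0r addr0.
by rewrite big_ord_recr /= IH exprS; ring.
Qed.

Lemma bond_square a g M : g M = 0 ->
  \sum_(k < M) g k * (a * bond a g k + bond a g k.+1) = \sum_(k < M.+1) bond a g k ^+ 2.
Proof.
move=> gM; have -> : \sum_(k < M.+1) bond a g k ^+ 2 =
    \sum_(k < M.+1) a * g k * bond a g k + \sum_(k < M.+1) (if k : nat is k'.+1 then g k' else 0) * bond a g k.
  by rewrite -big_split /=; apply: eq_bigr => k _; rewrite /bond /=; ring.
rewrite big_ord_recr /= gM mulr0 mul0r addr0 big_ord_recl mul0r add0r -big_split /=.
by apply: eq_bigr => k _; rewrite /bump /=; ring.
Qed.

(** The coupling is bounded below, because g can be recovered from bond a g by
    the backward recurrence g k = bond a g k.+1 - a * g k.+1 from g M = 0, whose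
    square costs a factor 2 (1 + 4) = 10 at each step. *)
Lemma bond_lower a g M : `|a| <= 2 -> g M = 0 ->
  \sum_(k < M) g k ^+ 2 <= M%:R * 10 ^+ M * \sum_(k < M.+1) bond a g k ^+ 2.
Proof.
move=> a2 gM; set Y := \sum_(k < M.+1) _.
have Y0 : 0 <= Y by apply: sumr_ge0 => k _; exact: sqr_ge0.
have leY k : (k <= M)%N -> bond a g k ^+ 2 <= Y.
  move=> kM; rewrite /Y (bigD1 (Ordinal (kM : k < M.+1)%N)) //= lerDl.
  by apply: sumr_ge0 => j _; exact: sqr_ge0.
have a4 : a ^+ 2 <= 4 by move: a2; rewrite ler_norml => /andP[]; nra.
have step j : (j <= M)%N -> g (M - j)%N ^+ 2 <= 10 ^+ j * Y.
  elim: j => [|j IH] jM; first by rewrite subn0 gM expr0n expr0 mul1r.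
  have := IH (ltnW jM); rewrite (_ : (M - j)%N = (M - j.+1).+1); last by rewrite subnS prednK ?subn_gt0.
  set k := (M - j.+1)%N => IHk; have yk : g k = bond a g k.+1 - a * g k.+1 by rewrite /bond addrC addKr.
  have lek : bond a g k.+1 ^+ 2 <= Y by apply: leY; rewrite /k; lia.
  rewrite yk [10 ^+ _]exprS -mulrA; set y := bond a g k.+1 in lek *; set h := g k.+1 in IHk *.
  have E1 : 1 <= (10 : R) ^+ j by rewrite exprn_ege1 // ler1n.
  have : (y - a * h) ^+ 2 <= 2 * y ^+ 2 + 2 * (a ^+ 2 * h ^+ 2).
    by have := sqr_ge0 (y + a * h); nra.
  have : a ^+ 2 * h ^+ 2 <= 4 * h ^+ 2 by rewrite ler_wpM2r ?sqr_ge0.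
  have : Y <= 10 ^+ j * Y by rewrite ler_peMl.
  by lra.
have -> : M%:R * 10 ^+ M * Y = \sum_(k < M) 10 ^+ M * Y.
  by rewrite sumr_const card_ord -mulrA mulr_natl.
apply: ler_sum => k _; have kM := ltn_ord k.
have := step (M - k)%N (leq_subr _ _); rewrite subKn ?(ltnW kM) // => /le_trans; apply.
by rewrite ler_wpM2r // ler_weXn2l ?ler1n // leq_subr.
Qed.

Section TestSpace.
Variables (a : R) (v : 'rV[R]_p) (sg : R) (eps del : R).
Hypotheses (a2 : `|a| <= 2) (sg1 : sg ^+ 2 = 1).
Hypothesis eps_ge : forall k, `|coord v k.*2| <= eps.
Hypothesis del_ge : forall k, `|coord v k.*2.+1| <= del.

Let gam : R := N%:R * 10 ^+ N.
Let Psi : R := \sum_(k < N.+1) (a ^+ 2) ^+ k.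
Let FP : R := \sum_(k < N.+1) coord v k.*2 * (a ^+ 2) ^+ k.

(** alpha times the zero mode of the unperturbed matrix, plus a vector of a space
    on which the unperturbed form has the sign of sg: there the entries at the
    vertices 2k+1 are sg times the coupling applied to those at the vertices 2k+2. *)
Definition trial (alpha : R) (g : nat -> R) : 'rV[R]_p :=
  \row_(i < p) if odd i then g i./2 else alpha * (- a) ^+ i./2 + sg * bond a g i./2.

Lemma trial_even alpha g k : (k <= N)%N ->
  coord (trial alpha g) k.*2 = alpha * (- a) ^+ k + sg * bond a g k.
Proof.
move=> kN; rewrite (coord_row (fun i => if odd i then g i./2 else alpha * (- a) ^+ i./2 + sg * bond a g i./2)).
  by rewrite odd_double doubleK.
by rewrite ltnS leq_double.
Qed.

Lemma trial_odd alpha g k : (k < N)%N -> coord (trial alpha g) k.*2.+1 = g k.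
Proof.
move=> kN; rewrite (coord_row (fun i => if odd i then g i./2 else alpha * (- a) ^+ i./2 + sg * bond a g i./2)).
  by rewrite /= odd_double /= uphalf_double.
by rewrite ltnS ltn_double.
Qed.

Variables (alpha : R) (g : nat -> R).
Hypothesis gN : g N = 0.
Let Y : R := \sum_(k < N.+1) bond a g k ^+ 2.
Let G : R := \sum_(k < N) g k ^+ 2.

Lemma sqn_trial : sqn (trial alpha g) = alpha ^+ 2 * Psi + Y + G.
Proof.
rewrite sqn_parity; congr (_ + _); last first.
  by apply: eq_bigr => k _; rewrite trial_odd.
rewrite (eq_bigr (fun k : 'I_N.+1 => alpha ^+ 2 * (a ^+ 2) ^+ k + bond a g k ^+ 2
   + 2 * alpha * sg * ((- a) ^+ k * bond a g k))); last first.
  move=> k _; rewrite trial_even -1?ltnS // -[in (a ^+ 2)]sqrrN -exprM mulnC exprM.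
  by rewrite sqrrD exprMn exprMn sg1 mul1r -mulr_natl; ring.
by rewrite !big_split /= -!mulr_sumr bond_kernel gN !mulr0 addr0.
Qed.

Lemma qform_trial : sg * qform (J a v) (trial alpha g) =
  \sum_(k < N.+1) sg * coord v k.*2 * (alpha * (- a) ^+ k + sg * bond a g k) ^+ 2
  + \sum_(k < N) sg * coord v k.*2.+1 * g k ^+ 2 + 2 * Y.
Proof.
rewrite qform_J !mulrDr !mulr_sumr; congr (_ + _ + _).
- by apply: eq_bigr => k _; rewrite trial_even -1?ltnS // mulrA.
- by apply: eq_bigr => k _; rewrite trial_odd // mulrA.
rewrite -[RHS]mulr_sumr -(bond_square a gN) mulr_sumr.
apply: eq_bigr => k _; rewrite trial_odd // trial_even ?(ltnW (ltn_ord k)) //.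
rewrite -doubleS trial_even // exprS.
have sgsg : sg * sg = 1 by rewrite -expr2.
transitivity (sg * sg * (2 * (g k * (a * bond a g k + bond a g k.+1)))); first by ring.
by rewrite sgsg mul1r.
Qed.

(** The cross terms between the zero mode and the rest are at most
    eps |alpha| |bond|, and completing the square turns them into
    eps^2 alpha^2 plus a part of the form on the second summand. *)
Lemma trial_lower : eps * (2 + gam) + del * gam <= 1 ->
  (sg * (FP / Psi) - eps ^+ 2) * sqn (trial alpha g) <= sg * qform (J a v) (trial alpha g).
Proof.
move=> small; have s_ge0 (k : nat) : 0 <= (a ^+ 2) ^+ k by exact: exprn_ge0 (sqr_ge0 _).
have Psi_ge1 : 1 <= Psi.
  rewrite /Psi big_ord_recl expr0 lerDl.
  by apply: sumr_ge0 => k _; exact: s_ge0.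
have Y0 : 0 <= Y by apply: sumr_ge0 => k _; exact: sqr_ge0.
have G0 : 0 <= G by apply: sumr_ge0 => k _; exact: sqr_ge0.
have GY : G <= gam * Y by apply: bond_lower.
have e0 : 0 <= eps by apply: le_trans (eps_ge 0).
have d0 : 0 <= del by apply: le_trans (del_ge 0).
have sgn1 : `|sg| = 1 by apply/eqP; rewrite -sqrp_eq1 ?normr_ge0 // -normrX sg1 normr1.
set f := FP / Psi; have fE : FP = f * Psi by rewrite /f mulfVK // gt_eqF // (lt_le_trans ltr01).
have fe : `|f| <= eps.
  rewrite /f normrM normfV [`|Psi|]ger0_norm ?(le_trans ler01) //.
  rewrite ler_pdivrMr ?(lt_le_trans ltr01) // /FP /Psi mulr_sumr.
  apply: le_trans (ler_norm_sum _ _ _) _; apply: ler_sum => k _.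
  rewrite normrM [`|(a ^+ 2) ^+ k|]ger0_norm //.
  by rewrite ler_wpM2r.
rewrite qform_trial sqn_trial.
have B1 : - (del * G) <= \sum_(k < N) sg * coord v k.*2.+1 * g k ^+ 2.
  rewrite /G mulr_sumr -sumrN; apply: ler_sum => k _.
  rewrite -mulNr ler_wpM2r ?sqr_ge0 //.
  by have := del_ge k; rewrite -[`|coord _ _|]mul1r -sgn1 -normrM ler_norml => /andP[].
have B2 : alpha ^+ 2 * (sg * FP) - (alpha ^+ 2 * eps ^+ 2 * Psi + Y) - eps * Y <=
    \sum_(k < N.+1) sg * coord v k.*2 * (alpha * (- a) ^+ k + sg * bond a g k) ^+ 2.
  rewrite /FP /Psi /Y !mulr_sumr -big_split /= -!sumrB; apply: ler_sum => k _.
  have := eps_ge k; rewrite -[`|coord _ _|]mul1r -sgn1 -normrM.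
  set w := sg * coord v _ => we; have -> : (a ^+ 2) ^+ k = ((- a) ^+ k) ^+ 2.
    by rewrite [RHS]exprAC sqrrN.
  set ps := (- a) ^+ k; set y := bond a g k.
  have -> : (alpha * ps + sg * y) ^+ 2 = (alpha * ps) ^+ 2 + 2 * alpha * ps * sg * y + y ^+ 2.
    by rewrite sqrrD exprMn exprMn sg1 mul1r -mulr_natl; ring.
  have w2 : w ^+ 2 <= eps ^+ 2 by rewrite -real_normK ?num_real // ler_sqr ?nnegrE.
  have wy : - (eps * y ^+ 2) <= w * y ^+ 2.
    rewrite -mulNr ler_wpM2r ?sqr_ge0 //; move: we; rewrite ler_norml => /andP[] //.
  have wa : w ^+ 2 * (alpha * ps) ^+ 2 <= eps ^+ 2 * (alpha * ps) ^+ 2 by rewrite ler_wpM2r ?sqr_ge0.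
  (* Completing the square bounds the cross term by the two squares. *)
  have : 0 <= (w * (alpha * ps) + sg * y) ^+ 2 by exact: sqr_ge0.
  have -> : (w * (alpha * ps) + sg * y) ^+ 2 =
     w ^+ 2 * (alpha * ps) ^+ 2 + 2 * (w * alpha * ps * sg * y) + y ^+ 2.
    transitivity (w ^+ 2 * (alpha * ps) ^+ 2 + 2 * (w * alpha * ps * sg * y) + sg ^+ 2 * y ^+ 2); first by ring.
    by rewrite sg1 mul1r.
  have -> : w * ((alpha * ps) ^+ 2 + 2 * alpha * ps * sg * y + y ^+ 2) =
    alpha ^+ 2 * (w * ps ^+ 2) + 2 * (w * alpha * ps * sg * y) + w * y ^+ 2 by ring.
  have -> : alpha ^+ 2 * (sg * (coord v k.*2 * ps ^+ 2)) = alpha ^+ 2 * (w * ps ^+ 2).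
    by rewrite /w; ring.
  rewrite exprMn in wa *; rewrite mulrCA mulrA in wa; lra.
have sf : `|sg * f| <= eps by rewrite normrM sgn1 mul1r.
have sfY : sg * f * (Y + G) <= eps * (Y + G).
  by rewrite ler_wpM2r ?addr_ge0 // (le_trans (ler_norm _)).
have e2 : 0 <= eps ^+ 2 * (Y + G) by rewrite mulr_ge0 ?sqr_ge0 // addr_ge0.
have eG : eps * G <= eps * (gam * Y) by rewrite ler_wpM2l.
have dG : del * G <= del * (gam * Y) by rewrite ler_wpM2l.
have sY : (eps * (2 + gam) + del * gam) * Y <= Y by rewrite ler_piMl.
rewrite fE in B2.
have : (sg * f - eps ^+ 2) * (alpha ^+ 2 * Psi + Y + G) = alpha ^+ 2 * (sg * (f * Psi))
  - alpha ^+ 2 * eps ^+ 2 * Psi + sg * f * (Y + G) - eps ^+ 2 * (Y + G) by ring.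
move=> ->; move: sY; rewrite (_ : (eps * (2 + gam) + del * gam) * Y =
  2 * (eps * Y) + eps * (gam * Y) + del * (gam * Y)); last by ring.
move: B1 B2 sfY e2 eG dG; rewrite !mulrDr; lra.
Qed.

End TestSpace.

End Fibre.

(** * Perturbation of the zero mode and the spectral gap *)

Section Perturbation.
Variables (R : realType) (N : nat).
Local Notation p := (N.*2.+1).
Implicit Types (a b : R) (v u : 'rV[R]_p).

Lemma coord_entry v k : (k <= N)%N -> entry v k.*2.+1 = coord v k.*2.
Proof.
move=> kN; have kp : (k.*2 < p)%N by rewrite ltnS leq_double.
by rewrite /entry /= (coord_lt _ kp); congr (v _ _); apply: val_inj; rewrite /= inordK.
Qed.

Lemma F_coord a v : F a v =
  (\sum_(k < N.+1) coord v k.*2 * (a ^+ 2) ^+ k) / (\sum_(k < N.+1) (a ^+ 2) ^+ k).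
Proof.
rewrite /F !big_mkord; congr (_ / _); apply: eq_bigr => k _; rewrite (_ : a ^+ k.*2 = (a ^+ 2) ^+ k) //.
- by rewrite coord_entry // -ltnS.
- by rewrite -mul2n exprM.
- by rewrite -mul2n exprM.
Qed.

Lemma trial_linear a sg alpha alpha' g g' t :
  trial N a sg (t * alpha + alpha') (fun k => t * g k + g' k) =
  t *: trial N a sg alpha g + trial N a sg alpha' g'.
Proof.
apply/rowP => i; rewrite !mxE; case: ifP => // _.
by rewrite /bond; case: i./2 => [|k]; ring.
Qed.

Lemma ord_N_subproof : (N < p)%N. Proof. by lia. Qed.
Definition ordN : 'I_p := Ordinal ord_N_subproof.

Section Small.
Variables (a : R) (v : 'rV[R]_p) (eps del : R).
Hypothesis a2 : `|a| <= 2.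
Hypothesis eps_ge : forall k, `|coord v k.*2| <= eps.
Hypothesis del_ge : forall k, `|coord v k.*2.+1| <= del.
Let gam : R := N%:R * 10 ^+ N.
Hypothesis small : eps * (2 + gam) + del * gam <= 1.

Let trim (c : 'rV[R]_N.+1) k := if (k < N)%N then coord c k else 0.

Let trim_linear sg : linear (fun c : 'rV[R]_N.+1 => trial N a sg (coord c N) (trim c)).
Proof.
move=> t c c'; rewrite -trial_linear coord_linear; congr trial; apply: funext => k.
by rewrite /trim; case: ifP => _; rewrite ?coord_linear // mulr0 addr0.
Qed.

Let trimN c : trim c N = 0. Proof. by rewrite /trim ltnn. Qed.

Let trim_inj sg (c : 'rV[R]_N.+1) : sg ^+ 2 = 1 ->
  trial N a sg (coord c N) (trim c) = 0 -> c = 0.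
Proof.
move=> sg1 t0; have := sqn_trial a sg1 (coord c N) (trimN c); rewrite t0.
rewrite {1}/sqn big1; last by move=> i _; rewrite mxE expr0n.
have h1 : 0 <= \sum_(k < N.+1) bond a (trim c) k ^+ 2 by apply: sumr_ge0 => k _; exact: sqr_ge0.
have h2 : 0 <= \sum_(k < N) trim c k ^+ 2 by apply: sumr_ge0 => k _; exact: sqr_ge0.
have h3 : coord c N ^+ 2 <= coord c N ^+ 2 * \sum_(k < N.+1) (a ^+ 2) ^+ k.
  rewrite ler_peMr ?sqr_ge0 // big_ord_recl expr0 lerDl.
  by apply: sumr_ge0 => k _; exact: exprn_ge0 (sqr_ge0 _).
have h4 := sqr_ge0 (coord c N) => /esym h.
have /eqP : coord c N ^+ 2 = 0 by lra.
have /eqP : \sum_(k < N) trim c k ^+ 2 = 0 by lra.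
rewrite sqrf_eq0 psumr_eq0; last by move=> k _; exact: sqr_ge0.
move=> /allP g0 /eqP cN; apply/rowP => i; rewrite mxE -coordE.
have [iN|] := ltnP i N.
  have := g0 (Ordinal iN) (mem_index_enum _).
  by rewrite /= sqrf_eq0 /trim iN => /eqP.
move=> Ni; have -> : nat_of_ord i = N; last exact: cN.
by apply/eqP; rewrite eqn_leq Ni -ltnS ltn_ord.
Qed.

(** The trial spaces with sg = 1 and sg = -1 have dimension N+1, which is what
    min-max needs for the middle eigenvalue from below and from above. *)
Lemma lambda0_approx : `|lambda0 a v - F a v| <= eps ^+ 2.
Proof.
rewrite ler_distl F_coord; apply/andP; split.
  apply: (@eigenvalue_ge _ _ (J a v) (J_sym a v) ordN _ _ _ (trim_linear 1)).
  - by rewrite /=; lia.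
  - by move=> c; apply: trim_inj; rewrite expr1n.
  move=> c; have := trial_lower a2 (expr1n _ 2) eps_ge del_ge (coord c N) (trimN c) small.
  by rewrite !mul1r.
have sg1 : (-1) ^+ 2 = 1 :> R by rewrite sqrrN expr1n.
apply: (@eigenvalue_le _ _ (J a v) (J_sym a v) ordN _ _ _ (trim_linear (-1))) => //.
  by move=> c; exact: trim_inj.
move=> c; have := trial_lower a2 sg1 eps_ge del_ge (coord c N) (trimN c) small.
by rewrite !mulN1r -opprD mulNr lerN2.
Qed.

(** Without the zero mode the trial space has dimension N and the form is
    definite on it, which separates the other eigenvalues from 0. *)
Lemma trial_gap sg g : sg ^+ 2 = 1 -> g N = 0 ->
  (1 + gam)^-1 * sqn (trial N a sg 0 g) <= sg * qform (J a v) (trial N a sg 0 g).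
Proof.
move=> sg1 gN; rewrite sqn_trial // qform_trial // expr0n mul0r add0r.
set Y := \sum_(k < N.+1) _; set G := \sum_(k < N) g k ^+ 2.
have gam0 : 0 <= gam by rewrite /gam mulr_ge0 ?ler0n // exprn_ge0 // ler0n.
have Y0 : 0 <= Y by apply: sumr_ge0 => k _; exact: sqr_ge0.
have GY : G <= gam * Y by apply: bond_lower.
have e0 : 0 <= eps by apply: le_trans (eps_ge 0).
have d0 : 0 <= del by apply: le_trans (del_ge 0).
have sgn1 : `|sg| = 1 by apply/eqP; rewrite -sqrp_eq1 ?normr_ge0 // -normrX sg1 normr1.
have B1 : - (del * G) <= \sum_(k < N) sg * coord v k.*2.+1 * g k ^+ 2.
  rewrite /G mulr_sumr -sumrN; apply: ler_sum => k _.
  rewrite -mulNr ler_wpM2r ?sqr_ge0 //.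
  by have := del_ge k; rewrite -[`|coord _ _|]mul1r -sgn1 -normrM ler_norml => /andP[].
have B2 : - (eps * Y) <= \sum_(k < N.+1) sg * coord v k.*2 * (0 * (- a) ^+ k + sg * bond a g k) ^+ 2.
  rewrite /Y mulr_sumr -sumrN; apply: ler_sum => k _.
  rewrite mul0r add0r [(sg * _) ^+ 2]exprMn sg1 mul1r -mulNr ler_wpM2r ?sqr_ge0 //.
  by have := eps_ge k; rewrite -[`|coord _ _|]mul1r -sgn1 -normrM ler_norml => /andP[].
have dG : del * G <= del * (gam * Y) by rewrite ler_wpM2l.
have eY : 0 <= eps * (1 + gam) * Y by rewrite !mulr_ge0 // addr_ge0.
have sY : (eps * (2 + gam) + del * gam) * Y <= Y by rewrite ler_piMl.
have : (1 + gam)^-1 * (Y + G) <= Y.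
  by rewrite mulrC ler_pdivrMr ?ltr_wpDr // mulrDr mulr1 lerD2l mulrC.
move: sY eY dG B1 B2; rewrite !(mulrDl, mulrDr) !mulr1 !mulrA; lra.
Qed.

Let coordN (c : 'rV[R]_N) : coord c N = 0. Proof. by rewrite coord_ge. Qed.

Let row_linear sg : linear (fun c : 'rV[R]_N => trial N a sg 0 (coord c)).
Proof.
move=> t c c'; rewrite -trial_linear mulr0 addr0; congr trial; apply: funext => k.
by rewrite coord_linear.
Qed.

Let row_inj sg (c : 'rV[R]_N) : sg ^+ 2 = 1 -> trial N a sg 0 (coord c) = 0 -> c = 0.
Proof.
move=> sg1 t0; apply/rowP => i; rewrite mxE -coordE.
have := trial_odd a sg 0 (coord c) (ltn_ord i).
by rewrite t0 coord0.
Qed.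

Lemma spectral_gap_above (i : 'I_p) : (N < i)%N -> (1 + gam)^-1 <= (eigenvalues (J a v))`_i.
Proof.
move=> Ni; apply: (eigenvalue_ge (J_sym a v) (row_linear 1)).
- by lia.
- by move=> c; apply: row_inj; rewrite expr1n.
by move=> c; have := trial_gap (expr1n _ 2) (coordN c); rewrite mul1r.
Qed.

Lemma spectral_gap_below (i : 'I_p) : (i < N)%N -> (eigenvalues (J a v))`_i <= - (1 + gam)^-1.
Proof.
move=> iN; have sg1 : (-1) ^+ 2 = 1 :> R by rewrite sqrrN expr1n.
apply: (eigenvalue_le (J_sym a v) (row_linear (-1))) => //.
- by move=> c; apply: row_inj.
by move=> c; have := trial_gap sg1 (coordN c); rewrite mulN1r mulNr lerNr.
Qed.

Lemma qform_J_bound u : `|qform (J a v) u| <= (3 + eps + del) * sqn u.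
Proof.
have e0 : 0 <= eps by apply: le_trans (eps_ge 0).
have d0 : 0 <= del by apply: le_trans (del_ge 0).
rewrite qform_J sqn_parity.
set E := \sum_(k < N.+1) coord u k.*2 ^+ 2; set G := \sum_(k < N) coord u k.*2.+1 ^+ 2.
have E0 : 0 <= E by apply: sumr_ge0 => k _; exact: sqr_ge0.
have G0 : 0 <= G by apply: sumr_ge0 => k _; exact: sqr_ge0.
have B1 : `|\sum_(k < N.+1) coord v k.*2 * coord u k.*2 ^+ 2| <= eps * E.
  apply: le_trans (ler_norm_sum _ _ _) _; rewrite mulr_sumr; apply: ler_sum => k _.
  by rewrite normrM [`|_ ^+ 2|]ger0_norm ?sqr_ge0 // ler_wpM2r ?sqr_ge0.
have B2 : `|\sum_(k < N) coord v k.*2.+1 * coord u k.*2.+1 ^+ 2| <= del * G.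
  apply: le_trans (ler_norm_sum _ _ _) _; rewrite mulr_sumr; apply: ler_sum => k _.
  by rewrite normrM [`|_ ^+ 2|]ger0_norm ?sqr_ge0 // ler_wpM2r ?sqr_ge0.
have B3 : `|2 * \sum_(k < N) coord u k.*2.+1 * (a * coord u k.*2 + coord u k.*2.+2)| <= 3 * (E + G).
  have E1 : \sum_(k < N) coord u k.*2 ^+ 2 <= E.
    by rewrite /E big_ord_recr /= lerDl sqr_ge0.
  have E2 : \sum_(k < N) coord u k.*2.+2 ^+ 2 <= E.
    rewrite /E big_ord_recl /= lerDr sqr_ge0 //.
  rewrite mulr_sumr; apply: le_trans (ler_norm_sum _ _ _) _.
  apply: (@le_trans _ _ (\sum_(k < N) (2 * coord u k.*2 ^+ 2 + coord u k.*2.+2 ^+ 2 + 3 * coord u k.*2.+1 ^+ 2))).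
    apply: ler_sum => k _; set x := coord u k.*2; set y := coord u k.*2.+1; set z := coord u _.
    have h1 : 0 <= (x - y) ^+ 2 by exact: sqr_ge0.
    have h2 : 0 <= (x + y) ^+ 2 by exact: sqr_ge0.
    have h3 : 0 <= (z - y) ^+ 2 by exact: sqr_ge0.
    have h4 : 0 <= (z + y) ^+ 2 by exact: sqr_ge0.
    move: a2; rewrite !ler_norml => /andP[a_ge a_le]; have a_ge2 : 0 <= 2 + a by lra.
    have h5 : 0 <= (2 - a) * (x + y) ^+ 2 by rewrite mulr_ge0 // subr_ge0.
    have h6 : 0 <= (2 - a) * (x - y) ^+ 2 by rewrite mulr_ge0 // subr_ge0.
    have h7 : 0 <= (2 + a) * (x + y) ^+ 2 by rewrite mulr_ge0.
    have h8 : 0 <= (2 + a) * (x - y) ^+ 2 by rewrite mulr_ge0.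
    by apply/andP; split; nra.
  by rewrite !big_split /= -!mulr_sumr -/G; lra.
apply: le_trans (ler_normD _ _) _; apply: le_trans (lerD (ler_normD _ _) (lexx _)) _.
have eG : 0 <= eps * G by rewrite mulr_ge0.
have dE : 0 <= del * E by rewrite mulr_ge0.
by move: B1 B2 B3 eG dE; rewrite !(mulrDl, mulrDr); lra.
Qed.

Lemma eigenvalue_J_bound (i : 'I_p) : `|(eigenvalues (J a v))`_i| <= 3 + eps + del.
Proof.
have idlin : linear (@id 'rV[R]_p) by [].
rewrite ler_norml; apply/andP; split.
  apply: (eigenvalue_ge (J_sym a v) idlin) => //; first exact: leq_subr.
  by move=> c; have := qform_J_bound c; rewrite ler_norml mulNr => /andP[].
apply: (eigenvalue_le (J_sym a v) idlin) => // c.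
by have := qform_J_bound c; rewrite ler_norml => /andP[].
Qed.

End Small.

Lemma lambda0_lipschitz a b v : `|lambda0 a v - lambda0 b v| <= `|a - b|.
Proof.
apply: (@eigenvalue_lipschitz _ _ _ _ ordN); rewrite ?J_sym // => u.
have -> : qform (J a v) u - qform (J b v) u =
    \sum_(k < N) (a - b) * (2 * coord u k.*2.+1 * coord u k.*2).
  rewrite !qform_J opprD addrACA subrr add0r -mulrBr -sumrB mulr_sumr.
  by apply: eq_bigr => k _; ring.
rewrite -mulr_sumr normrM ler_wpM2l // sqn_parity.
apply: le_trans (ler_norm_sum _ _ _) _.
apply: (@le_trans _ _ (\sum_(k < N) (coord u k.*2 ^+ 2 + coord u k.*2.+1 ^+ 2))).
  apply: ler_sum => k _; set x := coord u k.*2; set y := coord u _.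
  have h1 : 0 <= (x - y) ^+ 2 by exact: sqr_ge0.
  have h2 : 0 <= (x + y) ^+ 2 by exact: sqr_ge0.
  by rewrite ler_norml; apply/andP; split; nra.
by rewrite big_split /= lerD2r big_ord_recr /= lerDl sqr_ge0.
Qed.

(** Conjugation by a diagonal matrix of signs changes the sign of all entries a. *)
Lemma lambda0N a v : lambda0 (- a) v = lambda0 a v.
Proof.
rewrite /lambda0 /eigenvalues; suff -> : char_poly (J (- a) v) = char_poly (J a v) by [].
(* The sign changes across the bonds with entry a, and only there. *)
pose d : 'rV[R]_p := \row_i (if odd (uphalf i) then -1 else 1).
have dd : diag_mx d *m (diag_mx d)^T = 1%:M.
  rewrite tr_diag_mx mulmx_diag -diag_const_mx; congr diag_mx; apply/rowP => i.
  by rewrite !mxE; case: ifP => _; rewrite ?mulrNN mulr1.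
rewrite -(char_poly_orthogonal_conj (J a v) dd) tr_diag_mx; congr char_poly.
apply/matrixP => i j; rewrite mul_mx_diag mul_diag_mx !mxE.
have sE k : odd (uphalf k) = (odd k (+) odd k./2) by rewrite uphalf_half oddD; case: (odd k).
have sS k : odd (uphalf k.+1) = ~~ odd k./2 by [].
case: eqVneq => [->|_]; first by case: ifP => _; ring.
case: eqP => [->|_].
  by rewrite sS sE; case: (odd i) => //=; case: (odd i./2) => /=; ring.
case: eqP => [->|_]; last by rewrite mulr0 mul0r.
by rewrite sS sE; case: (odd j) => //=; case: (odd j./2) => /=; ring.
Qed.

Lemma lambda0_norm a v : lambda0 `|a| v = lambda0 a v.
Proof.
have [a0|a0] := leP 0 a; first by rewrite (ger0_norm a0).
by rewrite (ltr0_norm a0) lambda0N.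
Qed.

End Perturbation.

(** * Continuants of the eigenvalue equation *)

Section Continuants.
Variable R : realType.
Implicit Types (x : nat -> R) (s : R).

(** With x_i = lambda - v_(i+1) and s = a^2, the pair (A_k, B_k) solves the
    eigenvalue equation from the first vertex on: up to powers of -a, A_k and B_k
    are the entries 2k and 2k+1, counted from 0, of the solution with first
    entry 1. *)
Fixpoint continuants x s k : R * R :=
  if k is k'.+1 then
    let: (A, B) := continuants x s k' in
    let A' := s * A - x k'.*2.+1 * B in (A', B + x k.*2 * A')
  else (1, x 0%N).

Lemma eigenvector_row N a (v u : 'rV[R]_(N.*2.+1)) lam i : u *m J a v = lam *: u ->
  (i < N.*2.+1)%N -> (lam - coord v i) * coord u i =
    (if odd i then 1 else a) * coord u i.+1
    + (if i is i'.+1 then (if odd i' then 1 else a) * coord u i' else 0).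
Proof.
move=> uJ ip; have := mul_J a v u (Ordinal ip); rewrite uJ mxE -!coordE /= => E.
by rewrite mulrBl E; case: i ip {E} => [|i] ip; ring.
Qed.

Lemma continuants_eigenvector N a (v u : 'rV[R]_(N.*2.+1)) lam k : (k <= N)%N ->
  u *m J a v = lam *: u ->
  let: (A, B) := continuants (fun i => lam - coord v i) (a ^+ 2) k in
  A * coord u 0 = (- a) ^+ k * coord u k.*2 /\
  B * coord u 0 = - (- a) ^+ k.+1 * coord u k.*2.+1.
Proof.
move=> kN uJ.
have eqn i := @eigenvector_row N a v u lam i uJ.
elim: k kN => [|k IH] kN.
  by have := eqn 0%N isT; rewrite /= expr0 expr1 => ->; split; ring.
have := IH (ltnW kN); rewrite [continuants _ _ k.+1]/=.
case: (continuants _ _ k) => A B [IA IB].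
have := eqn k.*2.+1; rewrite /= odd_double /= => /(_ _)/[dup].
have k1 : (k.*2.+1 < N.*2.+1)%N by lia.
have k2 : (k.*2.+2 < N.*2.+1)%N by lia.
have := eqn _ k1; have := eqn _ k2; rewrite /= odd_double /= !mul1r => E2 E1 _.
have IA' : (a ^+ 2 * A - (lam - coord v k.*2.+1) * B) * coord u 0 = (- a) ^+ k.+1 * coord u k.*2.+2.
  rewrite mulrBl -!mulrA IA IB.
  transitivity ((- a) ^+ k.+1 * ((lam - coord v k.*2.+1) * coord u k.*2.+1 - a * coord u k.*2)).
    by rewrite exprS; ring.
  by rewrite E1; ring.
split; first exact: IA'.
rewrite mulrDl -mulrA IA' IB.
transitivity ((- a) ^+ k.+1 * ((lam - coord v k.*2.+2) * coord u k.*2.+2 - coord u k.*2.+1)); first by ring.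
by rewrite E2 [(- a) ^+ k.+2]exprS; ring.
Qed.

(** For a = 0 the matrix splits into the first vertex and blocks of size 2 with
    off-diagonal entry 1, and eigenvectors of those blocks are excluded because
    lambda is at distance less than 1 from both diagonal entries. *)
Lemma eigenvector_first_neq0 N a (v u : 'rV[R]_(N.*2.+1)) lam :
  u *m J a v = lam *: u -> u != 0 ->
  a != 0 \/ (forall k, `|lam - coord v k| < 1) -> coord u 0 != 0.
Proof.
move=> uJ uN0 H; apply: contra_neq uN0 => u0.
have eqn i := @eigenvector_row N a v u lam i uJ.
have step k : (k < N)%N -> coord u k.*2 = 0 -> coord u k.*2.-1 = 0 ->
    coord u k.*2.+1 = 0 /\ coord u k.*2.+2 = 0.
  move=> kN ue uo; have k0 : (k.*2 < N.*2.+1)%N by lia.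
  have k1 : (k.*2.+1 < N.*2.+1)%N by lia.
  have k2 : (k.*2.+2 < N.*2.+1)%N by lia.
  have := eqn _ k0; rewrite odd_double ue mulr0.
  have -> : (if k.*2 is i'.+1 then (if odd i' then 1 else a) * coord u i' else 0) = 0.
    by case: (k.*2) uo => //= i' ->; rewrite mulr0.
  rewrite addr0 => /esym/eqP; rewrite mulf_eq0 => E0.
  have := eqn _ k1; rewrite /= odd_double /= ue mulr0 addr0 mul1r => E1.
  have [a0|aN0] := eqVneq a 0; last first.
    by move: E0; rewrite (negbTE aN0) => /eqP o0; rewrite -E1 o0 mulr0.
  have small : forall k, `|lam - coord v k| < 1 by case: H => //; rewrite a0 eqxx.
  have := eqn _ k2; rewrite /= odd_double /= a0 mul0r add0r mul1r -E1 => E2.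
  have o0 : coord u k.*2.+1 = 0.
    apply/eqP/negPn/negP => oN0; have : `|lam - coord v k.*2.+2| * `|lam - coord v k.*2.+1| < 1.
      by rewrite -[X in _ < X]mulr1 ltr_pM.
    have E3 : (lam - coord v k.*2.+2) * (lam - coord v k.*2.+1) = 1.
      by apply: (mulIf oN0); rewrite mul1r -mulrA.
    by rewrite -normrM E3 normr1 ltxx.
  by rewrite o0 mulr0.
have H2 k : (k <= N)%N -> coord u k.*2 = 0 /\ coord u k.*2.-1 = 0.
  elim: k => [//|k IH] kN; have [e o] := IH (ltnW kN).
  by have [? ?] := step k kN e o; rewrite doubleS.
apply/rowP => i; rewrite mxE -coordE -(odd_double_half i).
have iN := ltn_ord i; case: (boolP (odd i)) => oi.
  have := odd_double_half i; rewrite oi !add1n => iE.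
  by have [_] := H2 i./2.+1 ltac:(lia); rewrite doubleS.
by rewrite add0n; have [] := H2 i./2 ltac:(lia).
Qed.

Lemma normrM_le (x y b c : R) : `|x| <= b -> `|y| <= c -> `|x * y| <= b * c.
Proof. by move=> xb yc; rewrite normrM ler_pM. Qed.

Lemma normrD_le (x y b c : R) : `|x| <= b -> `|y| <= c -> `|x + y| <= b + c.
Proof. by move=> xb yc; apply: le_trans (ler_normD _ _) (lerD _ _). Qed.

Lemma normrB_le (x y b c : R) : `|x| <= b -> `|y| <= c -> `|x - y| <= b + c.
Proof. by move=> xb yc; apply: le_trans (ler_normB _ _) (lerD _ _). Qed.

Lemma expr_lipschitz (s1 s2 : R) k : 0 <= s1 <= 4 -> 0 <= s2 <= 4 ->
  `|s1 ^+ k - s2 ^+ k| <= k%:R * 4 ^+ k * `|s1 - s2|.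
Proof.
move=> /andP[s10 s14] /andP[s20 s24]; elim: k => [|k IH].
  by rewrite subrr normr0 !mul0r.
have -> : s1 ^+ k.+1 - s2 ^+ k.+1 = s1 * (s1 ^+ k - s2 ^+ k) + (s1 - s2) * s2 ^+ k.
  by rewrite !exprS; ring.
have h2 : `|s2 ^+ k| <= 4 ^+ k by rewrite normrX ger0_norm // lerXn2r ?nnegrE.
have h1 : `|s1| <= 4 by rewrite ger0_norm.
apply: le_trans (normrD_le (normrM_le h1 IH) (normrM_le (lexx _) h2)) _.
have p4 : 0 <= (4 : R) ^+ k by rewrite exprn_ge0.
have D0 := normr_ge0 (s1 - s2).
have : 0 <= (4 : R) ^+ k * `|s1 - s2| by rewrite mulr_ge0.
rewrite -natr1 exprS; lra.
Qed.

(** The part of B_N of first order in the diagonal entries. *)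
Definition head_sum x s k := \sum_(j < k.+1) x j.*2 * s ^+ j.

(** h bounds the diagonal entries on the sublattice of the zero mode. The
    induction controls the errors of A and B together with their Lipschitz
    constants in s; the error of B is quadratic in h because the error of A,
    itself O(h), enters it with a factor x_(2k+2) = O(h). *)
Lemma continuants_estimate k : exists2 C : R, 0 <= C &
  forall x s1 s2 h, 0 <= s1 <= 4 -> 0 <= s2 <= 4 -> h <= 1 ->
    (forall j, `|x j.*2| <= h) -> (forall j, `|x j.*2.+1| <= 1) ->
  let: (A1, B1) := continuants x s1 k in let: (A2, B2) := continuants x s2 k in
  let d : R := `|s1 - s2| in
  let a1 : R := A1 - s1 ^+ k in let a2 : R := A2 - s2 ^+ k in
  let b1 : R := B1 - head_sum x s1 k in let b2 : R := B2 - head_sum x s2 k in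
  [/\ `|B2| <= C * h /\ `|B1 - B2| <= C * h * d,
      `|a2| <= C * h /\ `|a1 - a2| <= C * h * d &
      `|b2| <= C * h ^+ 2 /\ `|b1 - b2| <= C * h ^+ 2 * d].
Proof.
elim: k => [|k [C C0 IH]].
  exists 1 => // x s1 s2 h _ _ h1 xe xo /=.
  rewrite /head_sum !big_ord_recr !big_ord0 /= !expr0 !mulr1 !add0r !subrr normr0.
  have h0 : 0 <= h by apply: le_trans (xe 0%N).
  have := xe 0%N; rewrite double0 !mul1r => x0.
  by split; split; rewrite ?mulr_ge0 // ?exprn_ge0.
exists (7 * C + k.+1%:R * 4 ^+ k.+1).
  by rewrite addr_ge0 ?mulr_ge0 ?exprn_ge0.
move=> x s1 s2 h s1b s2b h1 xe xo; have := IH x s1 s2 h s1b s2b h1 xe xo.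
rewrite ![continuants _ _ k.+1]/=.
case: (continuants x s1 k) => A1 B1; case: (continuants x s2 k) => A2 B2 /=.
set d : R := `|s1 - s2|; move=> [[B2h dB] [a2h da] [b2h db]].
have h0 : 0 <= h by apply: le_trans (xe 0%N).
have d0 : 0 <= d by exact: normr_ge0.
have Ch0 : 0 <= C * h by rewrite mulr_ge0.
have Chh0 : 0 <= C * h ^+ 2 by rewrite mulr_ge0 // exprn_ge0.
have Chd0 : 0 <= C * h * d by rewrite mulr_ge0.
have Chhd0 : 0 <= C * h ^+ 2 * d by rewrite mulr_ge0.
have s1n : `|s1| <= 4 by case/andP: s1b => s10 s14; rewrite ger0_norm.
have s2n : `|s2| <= 4 by case/andP: s2b => s20 s24; rewrite ger0_norm.
set y := x k.*2.+1; set z := x (k.*2.+2).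
have yb : `|y| <= 1 by exact: xo.
have zb : `|z| <= h by have := xe k.+1; rewrite doubleS.
have hs s : head_sum x s k.+1 = head_sum x s k + z * s ^+ k.+1.
  by rewrite /head_sum big_ord_recr.
set P : R := k.+1%:R * 4 ^+ k.+1.
have P0 : 0 <= P by rewrite mulr_ge0 ?exprn_ge0.
have P4 : 4 ^+ k.+1 <= P by rewrite ler_peMl ?exprn_ge0 // ler1n.
have sk2 : `|s2 ^+ k.+1| <= 4 ^+ k.+1.
  by rewrite normrX; apply: lerXn2r => //; rewrite nnegrE.
have dsk : `|s1 ^+ k.+1 - s2 ^+ k.+1| <= P * d by apply: expr_lipschitz.
have a2' : `|s2 * A2 - y * B2 - s2 ^+ k.+1| <= 5 * (C * h).
  have -> : s2 * A2 - y * B2 - s2 ^+ k.+1 = s2 * (A2 - s2 ^+ k) - y * B2 by rewrite exprS; ring.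
  by apply: le_trans (normrB_le (normrM_le s2n a2h) (normrM_le yb B2h)) _; lra.
have da' : `|s1 * A1 - y * B1 - s1 ^+ k.+1 - (s2 * A2 - y * B2 - s2 ^+ k.+1)| <= 6 * (C * h * d).
  have -> : s1 * A1 - y * B1 - s1 ^+ k.+1 - (s2 * A2 - y * B2 - s2 ^+ k.+1) =
     s1 * (A1 - s1 ^+ k - (A2 - s2 ^+ k)) + (A2 - s2 ^+ k) * (s1 - s2) - y * (B1 - B2).
    by rewrite !exprS; ring.
  apply: le_trans (normrB_le (normrD_le (normrM_le s1n da) (normrM_le a2h (lexx _))) (normrM_le yb dB)) _.
  by rewrite -/d; lra.
have hh : h * h <= h by rewrite ler_piMl.
have hC : h * (C * h) = C * h ^+ 2 by ring.
have hCd : h * (C * h * d) = C * h ^+ 2 * d by ring.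
have hP : h ^+ 2 * P <= h * P by rewrite ler_wpM2r // expr2.
have hhC : C * h ^+ 2 <= C * h by rewrite ler_wpM2l // expr2.
have hhCd : C * h ^+ 2 * d <= C * h * d by rewrite ler_wpM2r.
have Ph0 : 0 <= P * h by rewrite mulr_ge0.
have Phd0 : 0 <= P * h * d by rewrite mulr_ge0.
have Phh0 : 0 <= P * h ^+ 2 by rewrite mulr_ge0 // exprn_ge0.
have Phhd0 : 0 <= P * h ^+ 2 * d by rewrite mulr_ge0.
set A2' := s2 * A2 - y * B2 in a2' da' *; set A1' := s1 * A1 - y * B1 in da' *.
split; split.
- have -> : B2 + z * A2' = B2 + z * (s2 ^+ k.+1 + (A2' - s2 ^+ k.+1)) by ring.
  apply: le_trans (normrD_le B2h (normrM_le zb (normrD_le sk2 a2'))) _.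
  have : h * 4 ^+ k.+1 <= h * P by rewrite ler_wpM2l.
  rewrite !(mulrDl, mulrDr); lra.
- have -> : B1 + z * A1' - (B2 + z * A2') = (B1 - B2) + z * ((s1 ^+ k.+1 - s2 ^+ k.+1)
     + (A1' - s1 ^+ k.+1 - (A2' - s2 ^+ k.+1))) by ring.
  apply: le_trans (normrD_le dB (normrM_le zb (normrD_le dsk da'))) _.
  rewrite !(mulrDl, mulrDr); lra.
- apply: le_trans a2' _; rewrite mulrDl; lra.
- apply: le_trans da' _; rewrite !mulrDl; lra.
- have -> : B2 + z * A2' - head_sum x s2 k.+1 = (B2 - head_sum x s2 k) + z * (A2' - s2 ^+ k.+1).
    by rewrite hs; ring.
  apply: le_trans (normrD_le b2h (normrM_le zb a2')) _.
  rewrite !(mulrDl, mulrDr); lra.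
- have -> : B1 + z * A1' - head_sum x s1 k.+1 - (B2 + z * A2' - head_sum x s2 k.+1) =
     (B1 - head_sum x s1 k - (B2 - head_sum x s2 k)) + z * (A1' - s1 ^+ k.+1 - (A2' - s2 ^+ k.+1)).
    by rewrite !hs; ring.
  apply: le_trans (normrD_le db (normrM_le zb da')) _.
  rewrite !(mulrDl, mulrDr); lra.
Qed.

(** The ratio of head_sum to the sum of the s^j is a mean of x, whose weights move
    to larger j, hence to smaller x, as s grows. The contribution of j = 0, 1
    alone gives the right-hand side. *)
Lemma chebyshev_head_sum x s1 s2 n : 0 <= s1 -> s1 <= s2 -> (0 < n)%N ->
  (forall i j, (i <= j <= n)%N -> x j.*2 <= x i.*2) ->
  head_sum x s2 n * (\sum_(j < n.+1) s1 ^+ j) - head_sum x s1 n * (\sum_(j < n.+1) s2 ^+ j)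
    <= - (x 0%N - x 2) * (s2 - s1).
Proof.
move=> s10 s12; case: n => // n _; elim: n => [|n IH] xdec.
  rewrite /head_sum !big_ord_recr !big_ord0 /= double0 !expr0 !expr1 -[1.*2]/2%N.
  by set x0 := x 0%N; set x2 := x 2; lra.
have := IH (fun i j ij => xdec i j ltac:(lia)).
rewrite /head_sum ![\sum_(j < n.+3) _]big_ord_recr /=.
rewrite -!/(head_sum _ _ _); set X := x n.+2.*2.
set T1 := \sum_(j < _) s1 ^+ j; set T2 := \sum_(j < _) s2 ^+ j.
move=> le1; have s20 := le_trans s10 s12.
suff : s1 ^+ n.+2 * head_sum x s2 n.+1 + X * s2 ^+ n.+2 * T1
   - s2 ^+ n.+2 * head_sum x s1 n.+1 - X * s1 ^+ n.+2 * T2 <= 0 by lra.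
rewrite /head_sum /T1 /T2 !mulr_sumr -big_split -!sumrB /=.
apply: sumr_le0 => j _.
have -> : s1 ^+ n.+2 * (x j.*2 * s2 ^+ j) + X * s2 ^+ n.+2 * s1 ^+ j
  - s2 ^+ n.+2 * (x j.*2 * s1 ^+ j) - X * s1 ^+ n.+2 * s2 ^+ j =
  - ((x j.*2 - X) * (s2 ^+ n.+2 * s1 ^+ j - s1 ^+ n.+2 * s2 ^+ j)) by ring.
rewrite oppr_le0 mulr_ge0 // subr_ge0; first by apply: xdec; have := ltn_ord j; lia.
have jn : (j <= n.+2)%N by have := ltn_ord j; lia.
move: (nat_of_ord j) jn => {}j jn; have -> : n.+2 = (n.+2 - j + j)%N by rewrite subnK.
rewrite !exprD -!mulrA [s2 ^+ j * _]mulrC ler_wpM2r ?mulr_ge0 ?exprn_ge0 //.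
by apply: lerXn2r; rewrite ?nnegrE.
Qed.

End Continuants.

(** * Asymptotics and strict monotonicity of the middle eigenvalue *)

Lemma inf_image_close (R : realType) T (A : set T) (f g : T -> R) (e M : R) :
  (A !=set0)%classic -> (forall x, A x -> `|g x| <= M) ->
  (forall x, A x -> `|f x - g x| <= e) ->
  `|inf [set f x | x in A] - inf [set g x | x in A]| <= e.
Proof.
move=> [x0 Ax0] gM fg.
have lf : has_lbound [set f x | x in A]%classic.
  exists (- M - e) => _ [x Ax <-]; have := gM x Ax; have := fg x Ax.
  by rewrite !ler_norml => /andP[+ _] /andP[+ _]; lra.
have lg : has_lbound [set g x | x in A]%classic.
  by exists (- M) => _ [x Ax <-]; have := gM x Ax; rewrite ler_norml => /andP[].
rewrite ler_norml; apply/andP; split.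
  rewrite lerBrDr addrC; apply: lb_le_inf; first by exists (f x0), x0.
  move=> _ [x Ax <-]; have := fg x Ax; rewrite ler_norml => /andP[h _].
  have : inf [set g x | x in A] <= g x by apply: ge_inf => //; exists x.
  by lra.
rewrite lerBlDr; rewrite -lerBlDl; apply: lb_le_inf; first by exists (g x0), x0.
move=> _ [x Ax <-]; have := fg x Ax; rewrite ler_norml => /andP[_ h].
have : inf [set f x | x in A] <= f x by apply: ge_inf => //; exists x.
by lra.
Qed.

Lemma sup_image_close (R : realType) T (A : set T) (f g : T -> R) (e M : R) :
  (A !=set0)%classic -> (forall x, A x -> `|g x| <= M) ->
  (forall x, A x -> `|f x - g x| <= e) ->
  `|sup [set f x | x in A] - sup [set g x | x in A]| <= e.
Proof.
move=> A0 gM fg.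
have E (h : T -> R) : sup [set h x | x in A] = - inf [set - h x | x in A].
  rewrite /inf opprK; congr (sup _); apply/seteqP; split=> [_ [x Ax <-]|_ [_ [x Ax <-] <-]].
    by exists (- h x); [exists x | rewrite opprK].
  by exists x => //; rewrite opprK.
rewrite !E -opprD normrN; apply: (@inf_image_close _ _ A _ _ e M) => // x Ax.
  by rewrite normrN gM.
by rewrite -opprD normrN fg.
Qed.

Section Asymptotics.
Variables (R : realType) (N : nat).
Local Notation p := (N.*2.+1).
Implicit Types (a b : R) (v u : 'rV[R]_p).

Lemma coord_le_enorm v k : `|coord v k| <= enorm v.
Proof.
have [kp|/coord_ge ->] := ltnP k p; last by rewrite normr0 sqrtr_ge0.
rewrite coord_lt -sqrtr_sqr ler_wsqrtr // (bigD1 (Ordinal kp)) //= lerDl.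
by apply: sumr_ge0 => i _; exact: sqr_ge0.
Qed.

Lemma Psi_ge1 a : 1 <= \sum_(k < N.+1) (a ^+ 2) ^+ k.
Proof.
rewrite big_ord_recl expr0 lerDl.
by apply: sumr_ge0 => k _; exact: exprn_ge0 (sqr_ge0 _).
Qed.

Lemma F_bound a v eps : (forall k, `|coord v k.*2| <= eps) -> `|F a v| <= eps.
Proof.
move=> eps_ge; have P1 := Psi_ge1 a; have P0 := lt_le_trans ltr01 P1.
rewrite F_coord normrM normfV (ger0_norm (ltW P0)) ler_pdivrMr // mulr_sumr.
apply: le_trans (ler_norm_sum _ _ _) _; apply: ler_sum => k _.
rewrite normrM (ger0_norm (exprn_ge0 _ (sqr_ge0 _))).
by rewrite ler_wpM2r // exprn_ge0 // sqr_ge0.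
Qed.

(** Bounds eps and del below this radius satisfy the smallness condition under
    which [lambda0_approx] holds. *)
Definition small_radius : R := (2 + 2 * (N%:R * 10 ^+ N))^-1.

Lemma small_radius_gt0 : 0 < small_radius.
Proof. by rewrite invr_gt0 ltr_wpDr // mulr_ge0 // mulr_ge0 // exprn_ge0. Qed.

Lemma small_radiusP eps del : 0 <= del -> eps <= small_radius -> del <= small_radius ->
  eps * (2 + N%:R * 10 ^+ N) + del * (N%:R * 10 ^+ N) <= 1.
Proof.
move=> d0; set g := N%:R * 10 ^+ N; have g0 : 0 <= g by rewrite mulr_ge0 // exprn_ge0.
have h0 : 0 < 2 + 2 * g by rewrite ltr_wpDr // mulr_ge0.
have eE : small_radius * (2 + 2 * g) = 1 by rewrite mulVf // gt_eqF.
move=> er dr.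
have : eps * (2 + g) <= small_radius * (2 + g) by rewrite ler_wpM2r // addr_ge0.
have : del * g <= small_radius * g by rewrite ler_wpM2r.
lra.
Qed.

Lemma band_nonempty : ((`[0, 2]%classic : set R) !=set0)%classic.
Proof. by exists 0; rewrite /= in_itv /= lexx ler0n. Qed.

Lemma lambda0_uniform v eps : (forall k, `|coord v k.*2| <= eps) ->
  eps <= small_radius -> enorm v <= small_radius ->
  [/\ forall a, 0 <= a <= 2 -> `|lambda0 a v - F a v| <= eps ^+ 2,
      `|lambda0m v - inf [set F a v | a in `[0, 2]%classic]| <= eps ^+ 2
    & `|lambda0p v - sup [set F a v | a in `[0, 2]%classic]| <= eps ^+ 2].
Proof.
move=> eps_ge er vr.
have H a : 0 <= a <= 2 -> `|lambda0 a v - F a v| <= eps ^+ 2.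
  move=> /andP[a0 a2]; apply: (@lambda0_approx _ _ a v eps (enorm v)) => //.
  - by rewrite ger0_norm.
  - by move=> k; exact: coord_le_enorm.
  - by apply: small_radiusP => //; exact: sqrtr_ge0.
have H' a : (`[0, 2]%classic : set R) a -> `|lambda0 a v - F a v| <= eps ^+ 2.
  by rewrite /= in_itv /= => /H.
split=> //.
- apply: (@inf_image_close _ _ _ _ _ _ eps) => //; first exact: band_nonempty.
  by move=> a _; exact: F_bound.
- apply: (@sup_image_close _ _ _ _ _ _ eps) => //; first exact: band_nonempty.
  by move=> a _; exact: F_bound.
Qed.

Hypothesis N1 : (1 <= N)%N.

Section Increasing.
Variable v : 'rV[R]_p.
Hypothesis vinc : odd_entries_increasing v.

Lemma odd_coord0 : coord v 0 = 0.
Proof. by case: vinc => v1 _ _; rewrite -double0 -coord_entry. Qed.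

Lemma odd_coord_mono i j : (i <= j <= N)%N -> coord v i.*2 <= coord v j.*2.
Proof.
case: vinc => _ vi _; elim: j => [|j IH] /andP[ij jN]; first by move: ij; rewrite leqn0 => /eqP ->.
move: ij; rewrite leq_eqVlt => /orP[/eqP -> //|ij].
apply: le_trans (IH _) _; first by rewrite -ltnS ij ltnW.
have := vi j jN; rewrite coord_entry ?(ltnW jN) //.
by rewrite -[j.*2.+3]/(j.+1.*2.+1) coord_entry.
Qed.

Lemma odd_coord_bound k : `|coord v k.*2| <= entry v p.
Proof.
have vp : entry v p = coord v N.*2 by rewrite coord_entry.
have [kN|Nk] := leqP k N; last first.
  rewrite coord_ge ?normr0; last by rewrite -leq_double in Nk; lia.
  by case: vinc => _ _ /ltW.
rewrite ger0_norm ?vp; first by apply: odd_coord_mono; rewrite kN leqnn.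
by rewrite -odd_coord0 -double0; apply: odd_coord_mono.
Qed.

Lemma entry_le_enorm : entry v p <= enorm v.
Proof. by rewrite coord_entry //; apply: le_trans (ler_norm _) (coord_le_enorm _ _). Qed.

(** F is a mean of the nondecreasing entries at the odd vertices, with weights
    that favour later vertices as a grows. *)
Lemma F_mono a b : 0 <= a -> a <= b -> F a v <= F b v.
Proof.
move=> a0 ab; have b0 := le_trans a0 ab; rewrite !F_coord.
have Pa := lt_le_trans ltr01 (Psi_ge1 a); have Pb := lt_le_trans ltr01 (Psi_ge1 b).
rewrite ler_pdivrMr // mulrAC ler_pdivlMr //.
pose x i := - coord v i.
have := @chebyshev_head_sum _ x (a ^+ 2) (b ^+ 2) N (sqr_ge0 _).
have ab2 : a ^+ 2 <= b ^+ 2 by apply: lerXn2r; rewrite ?nnegrE.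
have xdec i j : (i <= j <= N)%N -> x j.*2 <= x i.*2.
  by move=> ij; rewrite lerN2; exact: odd_coord_mono.
move=> /(_ ab2 N1 xdec).
have hx s : head_sum x s N = - \sum_(k < N.+1) coord v k.*2 * s ^+ k.
  by rewrite /head_sum -sumrN; apply: eq_bigr => k _; rewrite mulNr.
have : 0 <= (x 0%N - x 2) * (b ^+ 2 - a ^+ 2).
  by rewrite mulr_ge0 ?subr_ge0 //; apply: (xdec 0%N 1%N).
by rewrite !hx; lra.
Qed.

Lemma F0 : F 0 v = 0.
Proof.
rewrite F_coord big_ord_recl double0 odd_coord0 mul0r add0r big1 ?mul0r // => k _.
by rewrite expr0n /= exprS mul0r mulr0.
Qed.

Lemma F2 : F 2 v = 3 / (4 ^+ N.+1 - 1) * \sum_(1 <= k < N.+1) 4 ^+ k * entry v k.*2.+1.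
Proof.
have E4 : (2 : R) ^+ 2 = 4 by rewrite expr2; ring.
rewrite F_coord E4.
have P4 : 4 ^+ N.+1 - 1 = 3 * \sum_(k < N.+1) (4 : R) ^+ k.
  by rewrite subrX1; congr (_ * _); ring.
have P0 : 0 < \sum_(k < N.+1) (4 : R) ^+ k by have := Psi_ge1 2; rewrite E4; apply: lt_le_trans.
rewrite P4 invfM mulrA divff ?pnatr_eq0 // mul1r mulrC; congr (_ * _).
rewrite -(big_mkord xpredT (fun k => coord v k.*2 * 4 ^+ k)) big_ltn // double0 odd_coord0 mul0r add0r.
by apply: eq_big_nat => k /andP[_ kN]; rewrite coord_entry -1?ltnS // mulrC.
Qed.

Lemma F2_ge : entry v p / 2 <= F 2 v.
Proof.
have E4 : (2 : R) ^+ 2 = 4 by rewrite expr2; ring.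
rewrite F_coord E4 coord_entry //.
have P4 : 4 ^+ N.+1 - 1 = 3 * \sum_(k < N.+1) (4 : R) ^+ k.
  by rewrite subrX1; congr (_ * _); ring.
have P0 : 0 < \sum_(k < N.+1) (4 : R) ^+ k by have := Psi_ge1 2; rewrite E4; apply: lt_le_trans.
have w0 : 0 <= coord v N.*2 by rewrite -coord_entry //; case: vinc => _ _ /ltW.
rewrite ler_pdivlMr // big_ord_recr /=.
apply: (@le_trans _ _ (coord v N.*2 * 4 ^+ N)).
  rewrite -mulrA ler_wpM2l // mulrC ler_pdivrMr //.
  have p4 : 0 <= (4 : R) ^+ N by rewrite exprn_ge0.
  by rewrite exprS big_ord_recr /= in P4; lra.
rewrite [X in _ <= X]big_ord_recr /= lerDr; apply: sumr_ge0 => k _; rewrite mulr_ge0 ?exprn_ge0 //.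
by rewrite -odd_coord0 -double0; apply: odd_coord_mono; have := ltn_ord k; lia.
Qed.

Lemma inf_F : inf [set F a v | a in `[0, 2]%classic] = 0.
Proof.
apply/eqP; rewrite eq_le; apply/andP; split.
  apply: ge_inf; last by exists 0; rewrite ?F0 //= in_itv /= lexx ler0n.
  exists 0; move=> _ [a /= + <-]; rewrite in_itv /= => /andP[a0 _].
  by have := F_mono (lexx 0) a0; rewrite F0.
apply: lb_le_inf; first by exists (F 0 v), 0 => //; rewrite /= in_itv /= lexx ler0n.
move=> _ [a /= + <-]; rewrite in_itv /= => /andP[a0 _].
by have := F_mono (lexx 0) a0; rewrite F0.
Qed.

Lemma sup_F : sup [set F a v | a in `[0, 2]%classic] = F 2 v.
Proof.
apply/eqP; rewrite eq_le; apply/andP; split.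
  apply: sup_le_ub; first by exists (F 0 v), 0 => //; rewrite /= in_itv /= lexx ler0n.
  by move=> _ [a /= + <-]; rewrite in_itv /= => /andP[a0 a2]; apply: F_mono.
apply: ub_le_sup; last by exists 2; rewrite //= in_itv /= lexx ler0n.
by exists (F 2 v); move=> _ [a /= + <-]; rewrite in_itv /= => /andP[a0 a2]; apply: F_mono.
Qed.

End Increasing.

Lemma lambda0_eigenvector a v : exists2 u : 'rV[R]_p, u != 0 & u *m J a v = lambda0 a v *: u.
Proof.
have [sz srt [P PP JE]] := eigenvalues_spectral (J_sym a v).
exists (row (ordN N) P).
  apply/negP => /eqP r0; have := row_mul (ordN N) P P^T.
  rewrite r0 mul0mx PP => /rowP/(_ (ordN N)); rewrite !mxE eqxx => /eqP.
  by rewrite oner_eq0.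
by rewrite {1}JE !mulmxA -row_mul PP row1 -rowE row_diag_mx -scalemxAl -rowE mxE.
Qed.

(** An eigenvector with nonzero first entry is given by the continuants, and its
    continuation past the last vertex vanishes. *)
Lemma lambda0_root a v : (a != 0 \/ forall k, `|lambda0 a v - coord v k| < 1) ->
  (continuants (fun i => lambda0 a v - coord v i) (a ^+ 2) N).2 = 0.
Proof.
move=> H; have [u uN0 uJ] := lambda0_eigenvector a v.
have := continuants_eigenvector (leqnn N) uJ.
case: (continuants _ _ _) => A B [_ /=]; rewrite [coord u N.*2.+1]coord_ge // mulr0 => /eqP.
by rewrite mulf_eq0 (negbTE (eigenvector_first_neq0 uJ uN0 H)) orbF => /eqP.
Qed.

Lemma lambda0_continuous v : continuous (fun a : R => lambda0 a v).
Proof.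
move=> a; apply/cvgrPdist_le => e e0; near=> b.
apply: le_trans (lambda0_lipschitz _ _ _) _.
by near: b; apply: cvgr_dist_le.
Unshelve. all: by end_near. Qed.

Lemma sqr_in_band (c : R) : 0 <= c <= 2 -> 0 <= c ^+ 2 <= 4.
Proof. by move=> /andP[c0 c2]; apply/andP; split; nra. Qed.

Lemma segment_injective_increasing (f : R -> R) : ({within `[0, 2], continuous f})%classic ->
  f 0 <= f 2 -> (forall a b, 0 <= a -> a < b -> b <= 2 -> f a != f b) ->
  forall a b, 0 <= a -> a < b -> b <= 2 -> f a < f b.
Proof.
move=> cont f02 inj.
have injI : {in `[0, 2] &, injective f}.
  move=> a b; rewrite !in_itv /= => /andP[a0 a2] /andP[b0 b2] fab.
  case: (ltgtP a b) => // ab; first by have := inj a b a0 ab b2; rewrite fab eqxx.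
  by have := inj b a b0 ab a2; rewrite fab eqxx.
have mono := segment_continuous_inj_le f02 cont injI.
move=> a b a0 ab b2; rewrite lt_neqAle inj //= mono ?(ltW ab) // in_itv /= ?a0 ?b2.
  by rewrite (le_trans (ltW ab) b2).
by rewrite (le_trans a0 (ltW ab)).
Qed.

(** Equality of lambda_0 at a < b makes the main terms of the continuants differ
    by at least v_3 (b^2 - a^2), whereas the vanishing of both continuants leaves
    a difference of O(v_p^2) (b^2 - a^2). *)
Lemma lambda0_increasing (C : R) : 0 < C -> exists2 d : R, 0 < d & forall v,
  odd_entries_increasing v -> entry v 1 < entry v 3 -> entry v p <= C * entry v 3 ->
  enorm v < d -> forall a b, 0 <= a -> a < b -> b <= 2 -> lambda0 a v < lambda0 b v.
Proof.
move=> C0; have [K K0 HK] := @continuants_estimate R N.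
pose T0 : R := \sum_(k < N.+1) 4 ^+ k.
pose L : R := \sum_(k < N.+1) k%:R * 4 ^+ k.
have T00 : 0 <= T0 by apply: sumr_ge0 => k _; rewrite exprn_ge0.
have L0 : 0 <= L by apply: sumr_ge0 => k _; rewrite mulr_ge0 // exprn_ge0.
(* Q collects the constants of the error: the estimate becomes t <= Q t^2, which
   fails as soon as t (Q + 2) < 1. *)
pose Q := 9 * (T0 + L) * K * C ^+ 2; have Q0 : 0 <= Q by rewrite !mulr_ge0 ?addr_ge0 ?exprn_ge0 // ltW.
exists (Num.min (Num.min small_radius 4^-1) (Q + 2)^-1).
  by rewrite !lt_min small_radius_gt0 invr_gt0 ltr0n invr_gt0 ltr_wpDl.
move=> v vinc v13 vpC; rewrite !lt_min => /andP[/andP[vr v4] vQ].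
have v1 : entry v 1 = 0 by case: vinc.
have v3 : entry v 3 = coord v 2 by rewrite (@coord_entry _ _ v 1%N).
rewrite v1 in v13; set t := entry v 3 in v13 vpC v3 *.
set w := entry v p in vpC *; have w0 : 0 < w by case: vinc.
have wv := entry_le_enorm v; rewrite -/w in wv.
have wge k : `|coord v k.*2| <= w by exact: odd_coord_bound.
have w1 : w <= 4^-1 by lra.
have [lamF _ _] := lambda0_uniform wge (le_trans wv (ltW vr)) (ltW vr).
have w2w : w ^+ 2 <= 4^-1 * w by rewrite expr2 ler_wpM2r // ltW.
have lamb a : 0 <= a <= 2 -> `|lambda0 a v| <= 2 * w.
  move=> ab; have -> : lambda0 a v = (lambda0 a v - F a v) + F a v by ring.
  by apply: le_trans (normrD_le (lamF a ab) (F_bound a wge)) _; lra.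
have xe a k : 0 <= a <= 2 -> `|lambda0 a v - coord v k.*2| <= 3 * w.
  by move=> ab; apply: le_trans (normrB_le (lamb a ab) (wge k)) _; lra.
have xo a k : 0 <= a <= 2 -> `|lambda0 a v - coord v k| < 1.
  by move=> ab; apply: le_lt_trans (normrB_le (lamb a ab) (coord_le_enorm v k)) _; lra.
have inj a b : 0 <= a -> a < b -> b <= 2 -> lambda0 a v != lambda0 b v.
  move=> a0 ab b2; have aI : 0 <= a <= 2 by rewrite a0; lra.
  have bI : 0 <= b <= 2 by rewrite b2; lra.
  apply/eqP => lamab; pose x i := lambda0 a v - coord v i.
  have Ba := lambda0_root (or_intror (fun k => xo a k aI)).
  have Bb := lambda0_root (or_intror (fun k => xo b k bI)).
  rewrite -lamab in Bb; rewrite -/x in Ba Bb.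
  have := HK x (a ^+ 2) (b ^+ 2) (3 * w) (sqr_in_band aI) (sqr_in_band bI).
  have w31 : 3 * w <= 1 by lra.
  move=> /(_ w31 (fun k => xe a k aI) (fun k => ltW (xo a k.*2.+1 aI))).
  case: (continuants x (a ^+ 2) N) Ba => A1 B1 /= ->.
  case: (continuants x (b ^+ 2) N) Bb => A2 B2 /= -> [_ _ [b2h db]].
  clear HK lamF lamb xe xo.
  rewrite !sub0r !normrN in b2h db; rewrite opprK addrC in db.
  have s12 : a ^+ 2 < b ^+ 2 by rewrite ltrXn2r ?nnegrE // (le_trans a0 (ltW ab)).
  set s1 := a ^+ 2 in s12 b2h db *; set s2 := b ^+ 2 in s12 b2h db *.
  have s1b : 0 <= s1 <= 4 by exact: sqr_in_band.
  have s2b : 0 <= s2 <= 4 by exact: sqr_in_band.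
  have xdec i j : (i <= j <= N)%N -> x j.*2 <= x i.*2.
    by move=> ij; rewrite lerD2l lerN2; exact: odd_coord_mono.
  have := chebyshev_head_sum (proj1 (andP s1b)) (ltW s12) N1 xdec.
  have -> : x 0%N - x 2 = t by rewrite /x odd_coord0 // -v3; ring.
  set T1 := \sum_(j < N.+1) s1 ^+ j; set T2 := \sum_(j < N.+1) s2 ^+ j.
  set M1 := head_sum x s1 N in db *; set M2 := head_sum x s2 N in b2h db *.
  set dd : R := `|s1 - s2| in db; have ddE : dd = s2 - s1 by rewrite /dd distrC gtr0_norm ?subr_gt0.
  have T2b : `|T2| <= T0.
    apply: le_trans (ler_norm_sum _ _ _) _; apply: ler_sum => k _.
    by rewrite normrX; apply: lerXn2r; rewrite ?nnegrE // ger0_norm; case/andP: s2b.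
  have dT : `|T1 - T2| <= L * dd.
    rewrite /T1 /T2 -sumrB /L mulr_suml; apply: le_trans (ler_norm_sum _ _ _) _.
    by apply: ler_sum => k _; exact: expr_lipschitz.
  clear s1b s2b xdec aI bI lamab.
  have E : `|T1 * M2 - T2 * M1| <= (T0 + L) * K * (9 * w ^+ 2) * dd.
    have -> : T1 * M2 - T2 * M1 = T2 * (M2 - M1) + (T1 - T2) * M2 by ring.
    apply: le_trans (normrD_le (normrM_le T2b db) (normrM_le dT b2h)) _.
    by rewrite exprMn; lra.
  have QE : Q = 9 * (T0 + L) * K * C ^+ 2 by [].
  clearbody T0 L T1 T2 M1 M2 Q.
  have dd0 : 0 < dd by rewrite ddE subr_gt0.
  rewrite -ddE; move: E; rewrite ler_norml => /andP[E _] ch.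
  have tw : t * dd <= (T0 + L) * K * (9 * w ^+ 2) * dd by lra.
  rewrite ler_pM2r // in tw.
  have wt : w ^+ 2 <= C ^+ 2 * t ^+ 2.
    by rewrite -exprMn; apply: lerXn2r; rewrite ?nnegrE ?mulr_ge0 // ltW.
  have tQ : t <= Q * t * t.
    apply: le_trans tw _; have -> : Q * t * t = (T0 + L) * K * (9 * (C ^+ 2 * t ^+ 2)) by rewrite QE; ring.
    by rewrite ler_wpM2l ?mulr_ge0 ?addr_ge0 // ler_wpM2l.
  have tv : t <= enorm v by rewrite v3; apply: le_trans (ler_norm _) (coord_le_enorm _ _).
  have : t * (Q + 2) < 1.
    by rewrite -ltr_pdivlMr ?ltr_wpDl // mul1r; apply: le_lt_trans vQ.
  have : t * 1 <= t * (Q * t) by rewrite mulr1; lra.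
  by rewrite ler_pM2l //; lra.
clear HK; apply: segment_injective_increasing => //.
  by apply: continuous_subspaceT; exact: lambda0_continuous.
have h20 : (0 : R) <= 2 by rewrite ler0n.
have h2 := lamF 2 (introT andP (conj h20 (lexx _))).
have h0 := lamF 0 (introT andP (conj (lexx _) h20)).
rewrite (F0 vinc) subr0 ler_norml in h0; rewrite ler_norml in h2.
have := F2_ge vinc; rewrite -/w; case/andP: h0 => _; case/andP: h2 => + _.
move: (lambda0 0 v) (lambda0 2 v) (F 2 v) => l0 l2 f h2 h0 hf.
by clear -h0 h2 hf w2w w0; lra.
Qed.

Lemma band_asymptotics : exists K d : R, 0 < d /\ forall v, enorm v < d ->
  [/\ forall a : R, 0 <= a <= 2 -> `|lambda0 a v - F a v| <= K * enorm v ^+ 2,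
      `|lambda0m v - inf [set F a v | a in `[0, 2]%classic]| <= K * enorm v ^+ 2
    & `|lambda0p v - sup [set F a v | a in `[0, 2]%classic]| <= K * enorm v ^+ 2].
Proof.
exists 1, small_radius; split=> [|v vr]; first exact: small_radius_gt0.
rewrite mul1r; apply: lambda0_uniform; rewrite ?ltW // => k; exact: coord_le_enorm.
Qed.

Lemma band_asymptotics_increasing : exists K d : R, 0 < d /\
  forall v, odd_entries_increasing v -> enorm v < d ->
    `|lambda0m v| <= K * entry v p ^+ 2 /\
    `|lambda0p v - 3 / (4 ^+ N.+1 - 1) * \sum_(1 <= k < N.+1) 4 ^+ k * entry v k.*2.+1|
      <= K * entry v p ^+ 2.
Proof.
exists 1, small_radius; split=> [|v vinc vr]; first exact: small_radius_gt0.
have [_] := lambda0_uniform (odd_coord_bound vinc)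
  (le_trans (entry_le_enorm v) (ltW vr)) (ltW vr).
by rewrite inf_F // sup_F // F2 // subr0 mul1r.
Qed.

End Asymptotics.

(** * Unconditional sums of real families *)

Section Summation.
Variables (R : realType) (I : choiceType).
Implicit Types (a b : I -> R) (f g : I -> R).

Local Notation es a := (\esum_(x in [set: I]) (a x)%:E)%E.

Definition sumfin a : Prop := (es (fun x => `|a x|) < +oo)%E.

Lemma es_ge0 a : (forall x, 0 <= a x) -> (0 <= es a)%E.
Proof. by move=> a0; apply: esum_ge0 => x _; rewrite lee_fin. Qed.

Lemma es_le_sumfin a b : sumfin b -> (forall x, `|a x| <= `|b x|) -> sumfin a.
Proof. by move=> sb ab; apply: le_lt_trans sb; apply: le_esum => x _; rewrite lee_fin. Qed.

Lemma es_fin_num a : (forall x, 0 <= a x) -> sumfin a -> es a \is a fin_num.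
Proof.
move=> a0 sa; rewrite ge0_fin_numE ?es_ge0 //.
by apply: le_lt_trans sa; apply: le_esum => x _; rewrite lee_fin ler_norm.
Qed.

Lemma sumfinD a b : sumfin a -> sumfin b -> sumfin (fun x => a x + b x).
Proof.
move=> sa sb; apply: le_lt_trans (lte_add_pinfty sa sb).
rewrite -esumD; try by move=> x _; rewrite lee_fin.
by apply: le_esum => x _; rewrite -EFinD lee_fin ler_normD.
Qed.

Lemma esZ c a : 0 <= c -> (forall x, 0 <= a x) -> es (fun x => c * a x) = (c%:E * es a)%E.
Proof.
move=> c0 a0; have le (d : R) (h : I -> R) : 0 <= d -> (forall x, 0 <= h x) ->
    (es (fun x => d * h x) <= d%:E * es h)%E.
  move=> d0 h0; apply: ub_ereal_sup => _ [A [finA _] <-].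
  under eq_fsbigr do rewrite EFinM.
  rewrite -ge0_mule_fsumr; last by move=> x; rewrite lee_fin.
  rewrite lee_wpmul2l ?lee_fin //; apply: ereal_sup_ubound.
  by exists A.
apply/eqP; rewrite eq_le le //=; have [->|cN0] := eqVneq c 0.
  by rewrite mul0e es_ge0 // => x; rewrite mul0r.
have c_gt0 : 0 < c by rewrite lt_neqAle eq_sym cN0.
rewrite -[leRHS]mul1e -(divff cN0) EFinM -muleA lee_wpmul2l ?lee_fin //.
apply: le_trans (le c^-1 (fun x => c * a x) _ _).
- by apply: le_esum => x _; rewrite mulKf.
- by rewrite invr_ge0.
- by move=> x; rewrite mulr_ge0.
Qed.

Lemma sumfinZ c a : sumfin a -> sumfin (fun x => c * a x).
Proof.
rewrite /sumfin => sa; under eq_esum do rewrite normrM.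
rewrite (esZ (a := fun x => `|a x|)) //.
have /fineK <- : es (fun x => `|a x|) \is a fin_num by rewrite ge0_fin_numE // es_ge0.
by rewrite -EFinM ltry.
Qed.

Lemma sum_le_es a (s : seq I) : (forall x, 0 <= a x) -> uniq s ->
  ((\sum_(x <- s) a x)%:E <= es a)%E.
Proof.
move=> a0 us; apply: esum_ge; exists [set` s]%classic; first by split=> //; exact: finite_seq.
by rewrite -fsbig_seq // sumEFin.
Qed.

Lemma es_le a (M : R) : (forall s : seq I, uniq s -> \sum_(x <- s) a x <= M) ->
  (es a <= M%:E)%E.
Proof.
move=> H; apply: ub_ereal_sup => _ [A [finA _] <-].
by rewrite fsbig_finite //= sumEFin lee_fin; apply: H; exact: finmap.fset_uniq.
Qed.

Lemma fine_esD a b : (forall x, 0 <= a x) -> (forall x, 0 <= b x) -> sumfin a -> sumfin b ->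
  fine (es (fun x => a x + b x)) = fine (es a) + fine (es b).
Proof.
move=> a0 b0 sa sb; rewrite -fineD ?es_fin_num // -esumD //.
- by move=> x _; rewrite lee_fin.
- by move=> x _; rewrite lee_fin.
Qed.

(** Any decomposition into nonnegative summable families computes [rsum]; the
    linearity of [rsum] follows. *)
Lemma rsumE a b c : sumfin b -> sumfin c -> (forall x, 0 <= b x) -> (forall x, 0 <= c x) ->
  (forall x, a x = b x - c x) -> rsum a = fine (es b) - fine (es c).
Proof.
move=> sb sc b0 c0 abc.
have sa : sumfin a.
  apply: (@es_le_sumfin _ (fun x => b x + c x)); first exact: sumfinD.
  by move=> x; rewrite abc (ger0_norm (addr_ge0 (b0 x) (c0 x))) (le_trans (ler_normB _ _)) // !ger0_norm.
have sp : sumfin (fun x => Num.max (a x) 0).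
  apply: es_le_sumfin sa _ => x; rewrite ger0_norm ?le_max ?lexx ?orbT //.
  by rewrite ge_max ler_norm normr_ge0.
have sn : sumfin (fun x => Num.max (- a x) 0).
  apply: es_le_sumfin sa _ => x; rewrite ger0_norm ?le_max ?lexx ?orbT //.
  by rewrite ge_max -normrN ler_norm normr_ge0.
have mp x : 0 <= Num.max (a x) 0 by rewrite le_max lexx orbT.
have mn x : 0 <= Num.max (- a x) 0 by rewrite le_max lexx orbT.
rewrite /rsum.
have E : fine (es (fun x => Num.max (a x) 0)) + fine (es c) =
         fine (es b) + fine (es (fun x => Num.max (- a x) 0)).
  rewrite -!fine_esD //.
  congr fine; apply: eq_esum => x _; congr (_%:E); rewrite abc.
  have [h|h] := leP 0 (b x - c x); last first.
    by rewrite (max_idPl _) ?oppr_ge0 ?(ltW h) //; ring.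
  by rewrite (max_idPr _) ?oppr_le0 //; ring.
by move: E; set A := fine _; set B := fine _; set C := fine _; set D := fine _; lra.
Qed.

Lemma rsum_ge0E a : (forall x, 0 <= a x) -> rsum a = fine (es a).
Proof.
move=> a0; rewrite /rsum (_ : (fun x => (Num.max (- a x) 0)%:E) = fun=> 0%E); last first.
  by apply: funext => x; rewrite (max_idPr _) // oppr_le0.
rewrite [X in _ - fine X]esum1 // subr0; congr fine.
by apply: eq_esum => x _; rewrite (max_idPl _).
Qed.

Lemma rsum_ge0 a : (forall x, 0 <= a x) -> 0 <= rsum a.
Proof. by move=> a0; rewrite rsum_ge0E // fine_ge0 // es_ge0. Qed.

Let pos a x := Num.max (a x) 0.
Let neg a x := Num.max (- a x) 0.
Let pos_ge0 a x : 0 <= pos a x. Proof. by rewrite le_max lexx orbT. Qed.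
Let neg_ge0 a x : 0 <= neg a x. Proof. by rewrite le_max lexx orbT. Qed.
Let posneg a x : a x = pos a x - neg a x.
Proof.
rewrite /pos /neg; have [h|h] := leP 0 (a x).
  by rewrite (max_idPr _) ?oppr_le0 // subr0.
by rewrite (max_idPl _) ?oppr_ge0 ?(ltW h) //; ring.
Qed.
Let sumfin_pos a : sumfin a -> sumfin (pos a).
Proof.
move=> sa; apply: es_le_sumfin sa _ => x.
by rewrite (ger0_norm (pos_ge0 a x)) /pos ge_max ler_norm normr_ge0.
Qed.
Let sumfin_neg a : sumfin a -> sumfin (neg a).
Proof.
move=> sa; apply: es_le_sumfin sa _ => x.
by rewrite (ger0_norm (neg_ge0 a x)) /neg ge_max -normrN ler_norm normr_ge0.
Qed.

Lemma rsumD a b : sumfin a -> sumfin b -> rsum (fun x => a x + b x) = rsum a + rsum b.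
Proof.
move=> sa sb.
rewrite (@rsumE _ (fun x => pos a x + pos b x) (fun x => neg a x + neg b x)).
- rewrite (fine_esD (pos_ge0 a) (pos_ge0 b) (sumfin_pos sa) (sumfin_pos sb)).
  rewrite (fine_esD (neg_ge0 a) (neg_ge0 b) (sumfin_neg sa) (sumfin_neg sb)).
  by rewrite /rsum -!/(pos _) -!/(neg _); ring.
- by apply: sumfinD; exact: sumfin_pos.
- by apply: sumfinD; exact: sumfin_neg.
- by move=> x; rewrite addr_ge0.
- by move=> x; rewrite addr_ge0.
- by move=> x; rewrite {1}posneg {1}[b x]posneg; ring.
Qed.

Lemma rsumN a : rsum (fun x => - a x) = - rsum a.
Proof. by rewrite /rsum opprB; under [in X in _ - X]eq_esum do rewrite opprK. Qed.

Lemma rsumZ c a : sumfin a -> rsum (fun x => c * a x) = c * rsum a.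
Proof.
move=> sa; wlog c0 : c / 0 <= c => [H|].
  have [/H//|c0] := leP 0 c; have := H (- c) (ltac:(by rewrite oppr_ge0 ltW)).
  under eq_fun do rewrite mulNr; rewrite rsumN mulNr.
  by move/oppr_inj.
rewrite (@rsumE _ (fun x => c * pos a x) (fun x => c * neg a x)).
- rewrite !esZ // !fineM ?es_fin_num //; [by rewrite -mulrBr| exact: sumfin_neg | exact: sumfin_pos].
- by apply: sumfinZ; exact: sumfin_pos.
- by apply: sumfinZ; exact: sumfin_neg.
- by move=> x; rewrite mulr_ge0.
- by move=> x; rewrite mulr_ge0.
- by move=> x; rewrite {1}posneg; ring.
Qed.

Lemma rsum_bij a (s : I -> I) : bijective s -> rsum (fun x => a (s x)) = rsum a.
Proof.
move=> bs; have sb : set_bij [set: I] [set: I] s by rewrite setTT_bijective.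
rewrite /rsum (@reindex_esum _ _ _ _ _ s (fun x => (Num.max (a x) 0)%:E) sb).
by rewrite (@reindex_esum _ _ _ _ _ s (fun x => (Num.max (- a x) 0)%:E) sb).
Qed.

Lemma sumfin_bij a (s : I -> I) : bijective s -> sumfin a -> sumfin (fun x => a (s x)).
Proof.
move=> bs; have sb : set_bij [set: I] [set: I] s by rewrite setTT_bijective.
by rewrite /sumfin (@reindex_esum _ _ _ _ _ s (fun x => `|a x|%:E) sb).
Qed.

Lemma es_single y (c : R) : 0 <= c -> es (fun x => if x == y then c else 0) = c%:E.
Proof.
move=> c0; rewrite -[RHS](@esum_set1 _ _ y (fun=> c%:E)) // [RHS]esum_mkcond.
by apply: eq_esum => x _; rewrite in_set1; case: eqP.
Qed.

End Summation.

(** * The real Hilbert space of square-summable families *)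

Section SquareSummable.
Variables (R : realType) (I : choiceType).
Implicit Types (f g h : I -> R).

Definition l2 f : Prop := sumfin (fun x => f x ^+ 2).
Definition dot f g : R := rsum (fun x => f x * g x).
Definition nrm f : R := Num.sqrt (dot f f).
Definition delta (y : I) : I -> R := fun x => (x == y)%:R.

Lemma l2D f g : l2 f -> l2 g -> l2 (f + g).
Proof.
move=> lf lg; apply: es_le_sumfin (sumfinZ 2 (sumfinD lf lg)) _ => x.
rewrite addrfctE !ger0_norm ?sqr_ge0 ?mulr_ge0 ?addr_ge0 ?sqr_ge0 //.
by have := sqr_ge0 (f x - g x); nra.
Qed.

Lemma l2Z c f : l2 f -> l2 (c *: f).
Proof.
move=> lf; apply: es_le_sumfin (sumfinZ (c ^+ 2) lf) _ => x.
by rewrite scalrfctE exprMn.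
Qed.

Lemma l2N f : l2 f -> l2 (- f).
Proof. by move=> lf; rewrite -scaleN1r; exact: l2Z. Qed.

Lemma l2B f g : l2 f -> l2 g -> l2 (f - g).
Proof. by move=> lf lg; apply: l2D => //; exact: l2N. Qed.

Lemma sumfinM f g : l2 f -> l2 g -> sumfin (fun x => f x * g x).
Proof.
move=> lf lg; apply: es_le_sumfin (sumfinD lf lg) _ => x.
rewrite [leRHS]ger0_norm ?addr_ge0 ?sqr_ge0 //.
have h1 := sqr_ge0 (f x - g x); have h2 := sqr_ge0 (f x + g x).
by rewrite ler_norml; apply/andP; split; nra.
Qed.

Lemma dotC f g : dot f g = dot g f.
Proof. by congr rsum; apply: funext => x; rewrite mulrC. Qed.

Lemma dotDl f g h : l2 f -> l2 g -> l2 h -> dot (f + g) h = dot f h + dot g h.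
Proof.
move=> lf lg lh; rewrite -rsumD; try exact: sumfinM.
by congr rsum; apply: funext => x; rewrite addrfctE mulrDl.
Qed.

Lemma dotZl c f h : l2 f -> l2 h -> dot (c *: f) h = c * dot f h.
Proof.
move=> lf lh; rewrite -rsumZ; try exact: sumfinM.
by congr rsum; apply: funext => x; rewrite scalrfctE mulrA.
Qed.

Lemma dotNl f h : dot (- f) h = - dot f h.
Proof. by rewrite -rsumN; congr rsum; apply: funext => x; rewrite opprfctE mulNr. Qed.

Lemma dotBl f g h : l2 f -> l2 g -> l2 h -> dot (f - g) h = dot f h - dot g h.
Proof. by move=> lf lg lh; rewrite dotDl ?dotNl //; exact: l2N. Qed.

Lemma dotDr f g h : l2 f -> l2 g -> l2 h -> dot h (f + g) = dot h f + dot h g.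
Proof. by move=> *; rewrite !(dotC h) dotDl. Qed.

Lemma dotZr c f h : l2 f -> l2 h -> dot h (c *: f) = c * dot h f.
Proof. by move=> *; rewrite !(dotC h) dotZl. Qed.

Lemma dotBr f g h : l2 f -> l2 g -> l2 h -> dot h (f - g) = dot h f - dot h g.
Proof. by move=> *; rewrite !(dotC h) dotBl. Qed.

Lemma dot_ge0 f : 0 <= dot f f.
Proof. by apply: rsum_ge0 => x; rewrite -expr2 sqr_ge0. Qed.

Lemma nrm_ge0 f : 0 <= nrm f. Proof. exact: sqrtr_ge0. Qed.

Lemma nrm_sqr f : nrm f ^+ 2 = dot f f.
Proof. by rewrite sqr_sqrtr // dot_ge0. Qed.

Lemma dotE f : dot f f = fine (\esum_(x in [set: I]) (f x ^+ 2)%:E)%E.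
Proof. by rewrite /dot rsum_ge0E => [|x]; rewrite -?expr2 ?sqr_ge0. Qed.

Lemma sum_sqr_le f (s : seq I) : l2 f -> uniq s -> \sum_(x <- s) f x ^+ 2 <= nrm f ^+ 2.
Proof.
move=> lf us; rewrite nrm_sqr dotE -lee_fin fineK; last by apply: es_fin_num => // x; exact: sqr_ge0.
by apply: sum_le_es => // x; exact: sqr_ge0.
Qed.

Lemma normr_le_nrm f x : l2 f -> `|f x| <= nrm f.
Proof.
move=> lf; rewrite -(ler_pXn2r (n := 2)) ?nnegrE ?nrm_ge0 // real_normK ?num_real //.
by have := @sum_sqr_le f [:: x] lf isT; rewrite big_seq1.
Qed.

Lemma l2_bounded f M : (forall s : seq I, uniq s -> \sum_(x <- s) f x ^+ 2 <= M ^+ 2) ->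
  l2 f.
Proof.
move=> H; rewrite /l2 /sumfin (_ : (fun x => `|f x ^+ 2|%:E) = fun x => (f x ^+ 2)%:E).
  by apply: (@le_lt_trans _ _ (M ^+ 2)%:E); [exact: es_le | rewrite ltry].
by apply: funext => x; rewrite ger0_norm // sqr_ge0.
Qed.

Lemma nrm_bounded f M : 0 <= M ->
  (forall s : seq I, uniq s -> \sum_(x <- s) f x ^+ 2 <= M ^+ 2) -> nrm f <= M.
Proof.
move=> M0 H; rewrite -(ler_pXn2r (n := 2)) ?nnegrE ?nrm_ge0 // nrm_sqr dotE -lee_fin.
rewrite fineK; first exact: es_le.
by apply: es_fin_num; [move=> x; exact: sqr_ge0 | exact: l2_bounded H].
Qed.

Lemma cauchy_schwarz f g : l2 f -> l2 g -> `|dot f g| <= nrm f * nrm g.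
Proof.
move=> lf lg; have [g0|gN0] := eqVneq (dot g g) 0.
  suff -> : dot f g = 0 by rewrite normr0 mulr_ge0 ?nrm_ge0.
  have gx x : g x = 0.
    by apply/eqP; rewrite -normr_le0 (le_trans (normr_le_nrm x lg)) // /nrm g0 sqrtr0.
  rewrite /dot rsum_ge0E => [|x]; rewrite ?gx ?mulr0 // esum1 // => x _.
  by rewrite gx mulr0.
have g0 : 0 < dot g g by rewrite lt_neqAle eq_sym gN0 dot_ge0.
rewrite -(ler_pXn2r (n := 2)) ?nnegrE ?mulr_ge0 ?nrm_ge0 // real_normK ?num_real //.
rewrite exprMn !nrm_sqr; set t := dot f g / dot g g.
have := dot_ge0 (f - t *: g).
have lt := l2Z t lg; have lft := l2B lf lt.
rewrite dotBl // !dotBr // !dotZl // !dotZr // (dotC g f).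
have -> : t * (t * dot g g) = t * dot f g by rewrite /t; field.
rewrite subrr subr0 /t => h.
have : dot f g / dot g g * dot f g <= dot f f by lra.
by rewrite mulrAC ler_pdivrMr // -expr2.
Qed.

Lemma nrmD f g : l2 f -> l2 g -> nrm (f + g) <= nrm f + nrm g.
Proof.
move=> lf lg; have lfg := l2D lf lg.
rewrite -(ler_pXn2r (n := 2)) ?nnegrE ?addr_ge0 ?nrm_ge0 //.
rewrite nrm_sqr dotDl // !dotDr // (dotC g f) sqrrD !nrm_sqr.
by have := le_trans (ler_norm _) (cauchy_schwarz lf lg); rewrite -mulr_natl; lra.
Qed.

Lemma nrmZ c f : l2 f -> nrm (c *: f) = `|c| * nrm f.
Proof.
move=> lf; have lcf := l2Z c lf.
by rewrite /nrm dotZl // dotZr // mulrA -expr2 sqrtrM ?sqr_ge0 // sqrtr_sqr.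
Qed.

Lemma nrmN f : nrm (- f) = nrm f.
Proof. by rewrite /nrm dotNl dotC dotNl opprK. Qed.

Lemma nrm_sub_sym f g : nrm (f - g) = nrm (g - f).
Proof. by rewrite -nrmN opprB. Qed.

Lemma dot_close f f' g g' : l2 f -> l2 f' -> l2 g -> l2 g' ->
  `|dot f g - dot f' g'| <= nrm (f - f') * nrm g + nrm f' * nrm (g - g').
Proof.
move=> lf lf' lg lg'; have l1 := l2B lf lf'; have l3 := l2B lg lg'.
have -> : dot f g - dot f' g' = dot (f - f') g + dot f' (g - g').
  by rewrite dotBl // dotBr //; ring.
by apply: le_trans (ler_normD _ _) _; apply: lerD; exact: cauchy_schwarz.
Qed.

Lemma rsum_single (y : I) (c : R) : rsum (fun x => if x == y then c else 0) = c.
Proof.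
wlog c0 : c / 0 <= c => [H|].
  have [/H//|c0] := leP 0 c; apply: oppr_inj; rewrite -rsumN -[RHS](H (- c)) ?oppr_ge0 ?ltW //.
  by congr rsum; apply: funext => x; case: ifP => _; rewrite ?oppr0.
by rewrite rsum_ge0E ?es_single // => x; case: ifP.
Qed.

Lemma l2_delta y : l2 (delta y).
Proof.
rewrite /l2 /sumfin (_ : (fun x => _) = fun x => (if x == y then 1 else 0)%:E).
  by rewrite es_single // ltry.
by apply: funext => x; rewrite /delta; case: eqP; rewrite ?expr1n ?expr0n ?normr1 ?normr0.
Qed.

Lemma dot_delta f y : dot f (delta y) = f y.
Proof.
rewrite -[RHS](rsum_single y); congr rsum; apply: funext => x.
by rewrite /delta; case: eqP => [->|]; rewrite ?mulr1 ?mulr0.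
Qed.

(** Each member has its own error bound, and the limit inherits these bounds. *)
Lemma l2_complete (f_ : nat -> I -> R) (u_ : nat -> R) : (forall m, l2 (f_ m)) ->
  (forall m k, nrm (f_ m - f_ k) <= u_ m + u_ k) -> (u_ @ \oo --> 0)%classic ->
  exists2 f, l2 f & forall m, nrm (f_ m - f) <= u_ m.
Proof.
move=> lf cau u0.
have cvg_x x : cvgn (fun m => f_ m x).
  apply/cauchy_cvgP/cauchy_exP => e e0.
  have e2 : 0 < e / 2 by rewrite divr_gt0.
  have /cvgrPdist_lt/(_ _ e2) [m _ um] := u0.
  exists (f_ m x); exists m => // k /= mk.
  rewrite -ball_normE /=; have := normr_le_nrm x (l2B (lf m) (lf k)).
  rewrite addrfctE opprfctE => /le_lt_trans; apply.
  apply: le_lt_trans (cau m k) _.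
  have := um m (leqnn m); have := um k mk; rewrite !sub0r !normrN => h1 h2.
  have := ler_norm (u_ k); have := ler_norm (u_ m); lra.
pose f : I -> R := fun x => limn (fun m => f_ m x).
have um_ge0 m : 0 <= u_ m.
  by have := le_trans (nrm_ge0 _) (cau m m); lra.
have bound m (s : seq I) : uniq s -> \sum_(x <- s) (f_ m - f) x ^+ 2 <= u_ m ^+ 2.
  move=> us; have c1 : ((fun k => \sum_(x <- s) (f_ m - f_ k) x ^+ 2) @ \oo -->
      \sum_(x <- s) (f_ m - f) x ^+ 2)%classic.
    have sq_cvg x : ((fun k => (f_ m - f_ k) x ^+ 2) @ \oo --> (f_ m - f) x ^+ 2)%classic.
      have cx : ((fun k => f_ m x - f_ k x) @ \oo --> (f_ m - f) x)%classic.
        by apply: cvgB; [exact: cvg_cst | exact: cvg_x].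
      have -> : (fun k => (f_ m - f_ k) x ^+ 2) = (fun k => (f_ m x - f_ k x) * (f_ m x - f_ k x)).
        by apply: funext => k; rewrite expr2.
      by rewrite expr2; exact: cvgM.
    elim: (s) => [|x r IH].
      by rewrite big_nil; under eq_fun do rewrite big_nil; exact: cvg_cst.
    by rewrite big_cons; under eq_fun do rewrite big_cons; exact: cvgD.
  have c2 : ((fun k => (u_ m + u_ k) * (u_ m + u_ k)) @ \oo --> (u_ m + 0) * (u_ m + 0))%classic.
    by apply: cvgM; apply: cvgD => //; exact: cvg_cst.
  rewrite expr2 -[u_ m]addr0; apply: ler_cvg_to c1 c2 _.
  near=> k; rewrite -expr2; apply: le_trans (sum_sqr_le (l2B (lf m) (lf k)) us) _.
  by apply: lerXn2r; rewrite ?nnegrE ?addr_ge0 ?nrm_ge0.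
exists f; last by move=> m; exact: nrm_bounded (um_ge0 m) (bound m).
have -> : f = f_ 0%N - (f_ 0%N - f) by rewrite subKr.
by apply: l2B => //; exact: l2_bounded (bound 0%N).
Unshelve. all: by end_near. Qed.

End SquareSummable.

(** * Polynomials of operators and the real form of the Hamiltonian *)

Section PolynomialCalculus.
Variables (R : realType) (I : choiceType) (T : (I -> R) -> I -> R).
Hypothesis Tlin : linear T.
Implicit Types (f g : I -> R) (p q : {poly R}).

(** Defined on all families, so that the algebraic identities hold without side
    conditions; square-summability enters with the norm only. *)
Definition polop q f : I -> R := \sum_(i < size q) q`_i *: iter i T f.

Lemma op_add f g : T (f + g) = T f + T g.
Proof. by rewrite -[f]scale1r Tlin !scale1r. Qed.

Lemma op0 : T 0 = 0.
Proof. by apply: (addrI (T 0)); rewrite -op_add !addr0. Qed.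

Lemma op_scale c f : T (c *: f) = c *: T f.
Proof. by rewrite -[c *: f]addr0 Tlin op0 addr0. Qed.

Lemma op_sum (J : Type) (r : seq J) (P : pred J) (F : J -> I -> R) :
  T (\sum_(j <- r | P j) F j) = \sum_(j <- r | P j) T (F j).
Proof. exact: (big_morph T op_add op0). Qed.

Lemma polop_widen n q f : (size q <= n)%N -> polop q f = \sum_(i < n) q`_i *: iter i T f.
Proof.
move=> qn; rewrite /polop (big_ord_widen _ (fun i => q`_i *: iter i T f) qn) big_mkcond.
by apply: eq_bigr => i _; case: ltnP => // ni; rewrite nth_default // scale0r.
Qed.

Lemma polopD p q f : polop (p + q) f = polop p f + polop q f.
Proof.
rewrite !(@polop_widen (maxn (size p) (size q))) ?leq_maxl ?leq_maxr ?size_polyD //.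
by rewrite -big_split /=; apply: eq_bigr => i _; rewrite coefD scalerDl.
Qed.

Lemma polopZ c q f : polop (c *: q) f = c *: polop q f.
Proof.
rewrite !(@polop_widen (size q)) ?size_scale_leq // scaler_sumr.
by apply: eq_bigr => i _; rewrite coefZ scalerA.
Qed.

Lemma polopC c f : polop c%:P f = c *: f.
Proof. by rewrite (@polop_widen 1) ?size_polyC ?leq_b1 // big_ord1 coefC. Qed.

Lemma polopMX q f : polop (q * 'X) f = T (polop q f).
Proof.
rewrite (@polop_widen (size q).+1); last first.
  by rewrite (leq_trans (size_polyMleq _ _)) // size_polyX addn2.
rewrite big_ord_recl coefMX scale0r add0r /polop op_sum.
by apply: eq_bigr => i _; rewrite coefMX /= op_scale.
Qed.

Lemma polop_X_comm q f : T (polop q f) = polop q (T f).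
Proof. by rewrite /polop op_sum; apply: eq_bigr => i _; rewrite op_scale -iterS iterSr. Qed.

Lemma polopM p q f : polop (p * q) f = polop p (polop q f).
Proof.
elim/poly_ind: p => [|p c IH].
  by rewrite mul0r -[0]/(0%:P) !polopC !scale0r.
rewrite mulrDl !polopD -mulrA ['X * q]mulrC mulrA !polopMX IH; congr (_ + _).
by rewrite mul_polyC polopZ polopC.
Qed.

Lemma polop_linear q : linear (polop q).
Proof.
elim/poly_ind: q => [|q c IH] a f g; first by rewrite -[0]/(0%:P) !polopC !scale0r scaler0 addr0.
rewrite !polopD !polopMX IH Tlin !polopC !scalerDr !scalerA [c * a]mulrC !addrA.
by congr (_ + _); rewrite addrAC.
Qed.

Lemma polopXn n f : polop 'X^n f = iter n T f.
Proof.
elim: n => [|n IH]; first by rewrite expr0 -[1]/(1%:P) polopC scale1r.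
by rewrite exprSr polopMX IH.
Qed.

Variable M : R.
Hypothesis Tl2 : forall f, l2 f -> l2 (T f).
Hypothesis Tbound : forall f, l2 f -> nrm (T f) <= M * nrm f.
Hypothesis Tsym : forall f g, l2 f -> l2 g -> dot (T f) g = dot f (T g).

Lemma polop_l2 q f : l2 f -> l2 (polop q f).
Proof.
move=> lf; elim/poly_ind: q => [|q c IH].
  by rewrite -[0]/(0%:P) polopC; exact: l2Z.
by rewrite polopD polopMX polopC; apply: l2D; [exact: Tl2 | exact: l2Z].
Qed.

(** The existence of a bound suffices: it is only used to exchange q(T) with a
    limit. *)
Lemma polop_bound q : exists2 C : R, 0 <= C & forall f, l2 f -> nrm (polop q f) <= C * nrm f.
Proof.
elim/poly_ind: q => [|q c [C C0 IH]].
  by exists 0 => // f lf; rewrite -[0]/(0%:P) polopC nrmZ // normr0.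
exists (`|M| * C + `|c|) => [|f lf]; first by rewrite addr_ge0 ?mulr_ge0.
rewrite polopD polopMX polopC; have lq := polop_l2 q lf.
apply: le_trans (nrmD (Tl2 lq) (l2Z c lf)) _; rewrite mulrDl nrmZ // lerD2r.
apply: le_trans (Tbound lq) _; apply: (@le_trans _ _ (`|M| * nrm (polop q f))).
  by rewrite ler_wpM2r ?nrm_ge0 // ler_norm.
by rewrite -mulrA ler_wpM2l ?IH.
Qed.

Lemma polop_sym q f g : l2 f -> l2 g -> dot (polop q f) g = dot f (polop q g).
Proof.
move=> lf lg; elim/poly_ind: q => [|q c IH] in f lf g lg *.
  by rewrite -[0]/(0%:P) !polopC dotZl // dotZr // !mul0r.
rewrite !polopD !polopMX !polopC.
have lqf := polop_l2 q lf; have lqg := polop_l2 q lg.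
rewrite (dotDl (Tl2 lqf) (l2Z c lf) lg) (dotDr (Tl2 lqg) (l2Z c lg) lf).
rewrite (dotZl c lf lg) (dotZr c lg lf); congr (_ + _).
by rewrite (Tsym lqf lg) (IH _ lf _ (Tl2 lg)) polop_X_comm.
Qed.

End PolynomialCalculus.

Section WeightedShift.
Variables (R : realType) (I : choiceType) (s s' : I -> I) (c : I -> R).
Hypotheses (sK : cancel s s') (s'K : cancel s' s) (c1 : forall x, `|c x| <= 1).

(** The hopping terms of H are weighted permutations of the vertices and their
    adjoints, a form in which boundedness and symmetry are immediate. *)
Definition wshift (f : I -> R) : I -> R := fun x => c x * f (s x).
Definition wshift_adj (f : I -> R) : I -> R := fun x => c (s' x) * f (s' x).

Let bij_s : bijective s. Proof. by exists s'. Qed.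
Let bij_s' : bijective s'. Proof. by exists s. Qed.

Lemma c_sqr_le1 x : c x ^+ 2 <= 1.
Proof. by rewrite -real_normK ?num_real // exprn_ile1. Qed.

Lemma wshift_l2 f : l2 f -> l2 (wshift f).
Proof.
move=> lf; apply: es_le_sumfin (sumfin_bij bij_s lf) _ => x.
by rewrite exprMn normrM ler_piMl // ger0_norm ?sqr_ge0 ?c_sqr_le1.
Qed.

Lemma wshift_adj_l2 f : l2 f -> l2 (wshift_adj f).
Proof.
move=> lf; apply: es_le_sumfin (sumfin_bij bij_s' lf) _ => x.
by rewrite exprMn normrM ler_piMl // ger0_norm ?sqr_ge0 ?c_sqr_le1.
Qed.

Lemma dot_wshift f g : dot (wshift f) g = dot f (wshift_adj g).
Proof.
rewrite /dot -[RHS](rsum_bij _ bij_s); congr rsum; apply: funext => x.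
by rewrite /wshift /wshift_adj sK; ring.
Qed.

Lemma nrm_wshift f : l2 f -> nrm (wshift f) <= nrm f.
Proof.
move=> lf; apply: nrm_bounded => [|r ur]; first exact: nrm_ge0.
apply: (@le_trans _ _ (\sum_(x <- map s r) f x ^+ 2)).
  rewrite big_map; apply: ler_sum => x _.
  by rewrite exprMn ler_piMl ?sqr_ge0 ?c_sqr_le1.
by apply: sum_sqr_le => //; rewrite map_inj_uniq //; exact: can_inj sK.
Qed.

Lemma nrm_wshift_adj f : l2 f -> nrm (wshift_adj f) <= nrm f.
Proof.
move=> lf; apply: nrm_bounded => [|r ur]; first exact: nrm_ge0.
apply: (@le_trans _ _ (\sum_(x <- map s' r) f x ^+ 2)).
  rewrite big_map; apply: ler_sum => x _.
  by rewrite exprMn ler_piMl ?sqr_ge0 ?c_sqr_le1.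
by apply: sum_sqr_le => //; rewrite map_inj_uniq //; exact: can_inj s'K.
Qed.

End WeightedShift.

Section RealHamiltonian.
Variables (R : realType) (N : nat) (v : 'rV[R]_(N.*2.+1)).
Local Notation p := (N.*2.+1).
Local Notation V := (Gam N -> R).
Implicit Types (f g : V) (n : int) (i : 'I_p).

Definition site f n (k : nat) : R :=
  if k is k'.+1 then if insub k' is Some i then f (n, i) else 0 else 0.

Arguments site : simpl never.

(** The operator H has real coefficients, so it acts on the real and the
    imaginary part of a family separately by this operator ([Hop_Re], [Hop_Im]). *)
Definition Hreal f : V := fun x =>
  site f x.1 x.2 + site f x.1 x.2.+2
  + (if odd x.2 then site f (x.1 + 1) x.2 else site f (x.1 - 1) x.2.+2)
  + v ord0 x.2 * f x.

Lemma site_linear a f g n k : site (a *: f + g) n k = a * site f n k + site g n k.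
Proof. by rewrite /site; case: k => [|k]; [|case: insub => [i|]]; rewrite ?mulr0 ?addr0. Qed.

Lemma Hreal_linear : linear Hreal.
Proof.
move=> a f g; apply: funext => x; rewrite /Hreal !site_linear !addrfctE !scalrfctE.
by case: ifP => _; rewrite /GRing.scale /=; ring.
Qed.

Let shift (dn : int) (x : Gam N) : Gam N := (x.1 - dn, ordS x.2).
Let unshift (dn : int) (x : Gam N) : Gam N := (x.1 + dn, ord_pred x.2).

Let shiftK dn : cancel (shift dn) (unshift dn).
Proof. by case=> n i; rewrite /shift /unshift /= ordSK subrK. Qed.

Let unshiftK dn : cancel (unshift dn) (shift dn).
Proof. by case=> n i; rewrite /shift /unshift /= ord_predK addrK. Qed.

Let c1 (x : Gam N) : R := (x.2.+1 < p)%N%:R.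
Let c2 (x : Gam N) : R := (~~ odd x.2 && (x.2.+1 < p)%N)%:R.

Let c1_le x : `|c1 x| <= 1. Proof. by rewrite /c1 normr_nat lern1 leq_b1. Qed.
Let c2_le x : `|c2 x| <= 1. Proof. by rewrite /c2 normr_nat lern1 leq_b1. Qed.

Let pot f : V := fun x => v ord0 x.2 * f x.

Lemma site_ordS f n i : site f n i.+2 = (i.+1 < p)%N%:R * f (n, ordS i).
Proof.
rewrite /site; case: ltnP => ip; last by rewrite insubF ?mul0r // ltnNge ip.
by rewrite (insubT (fun k => (k < p)%N) ip) mul1r; congr (f (_, _)); apply: val_inj; rewrite /= modn_small.
Qed.

Lemma site_ord_pred f n i : site f n i = ((ord_pred i).+1 < p)%N%:R * f (n, ord_pred i).
Proof.
case: i => -[|i] ip /=.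
  by rewrite modn_small // ltnn mul0r.
have ip' : (i < p)%N by apply: ltnW.
have E : ((i + p) %% p = i)%N by rewrite modnDr modn_small.
rewrite E ip mul1r /site (insubT (fun k => (k < p)%N) ip').
by congr (f (_, _)); apply: val_inj; rewrite /= E.
Qed.

(** The first shift is the chain of vertices within one cell, closed up
    cyclically with weight 0 on the closing bond; the second carries the bonds
    between neighbouring cells. *)
Lemma Hreal_decomposition f : Hreal f =
  wshift (shift 0) c1 f + wshift_adj (unshift 0) c1 f
  + (wshift (shift 1) c2 f + wshift_adj (unshift 1) c2 f) + pot f.
Proof.
apply: funext => -[n i]; rewrite /Hreal !addrfctE /wshift /wshift_adj /pot /=.
rewrite /c1 /c2 /shift /unshift /= ?subr0 ?addr0 -site_ordS -site_ord_pred.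
rewrite [site f n i + _]addrC; congr (_ + _ + _).
have -> : ~~ odd (ord_pred i) && ((ord_pred i).+1 < p)%N = odd i && ((ord_pred i).+1 < p)%N.
  case: i => -[|i] ip /=; first by rewrite modn_small // ltnn !andbF.
  by rewrite modnDr modn_small ?(ltnW ip).
case: (odd i) => /=; rewrite mul0r ?addr0 ?add0r.
  by rewrite -site_ord_pred.
by rewrite -site_ordS.
Qed.

Let pot_sqr_le f x : pot f x ^+ 2 <= enorm v ^+ 2 * f x ^+ 2.
Proof.
rewrite /pot exprMn ler_wpM2r ?sqr_ge0 //.
rewrite sqr_sqrtr; last by apply: sumr_ge0 => i _; exact: sqr_ge0.
by rewrite (bigD1 x.2) //= lerDl; apply: sumr_ge0 => i _; exact: sqr_ge0.
Qed.

Let pot_l2 f : l2 f -> l2 (pot f).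
Proof.
move=> lf; apply: es_le_sumfin (sumfinZ (enorm v ^+ 2) lf) _ => x.
rewrite [leLHS]ger0_norm ?sqr_ge0 //.
exact: le_trans (pot_sqr_le f x) (ler_norm _).
Qed.

Let nrm_pot f : l2 f -> nrm (pot f) <= enorm v * nrm f.
Proof.
move=> lf; apply: nrm_bounded => [|r ur]; first by rewrite mulr_ge0 ?nrm_ge0 ?sqrtr_ge0.
apply: (@le_trans _ _ (\sum_(x <- r) enorm v ^+ 2 * f x ^+ 2)).
  by apply: ler_sum => x _; exact: pot_sqr_le.
by rewrite -mulr_sumr [leRHS]exprMn ler_wpM2l ?sqr_ge0 // sum_sqr_le.
Qed.

Let dot_pot f g : dot (pot f) g = dot f (pot g).
Proof. by congr rsum; apply: funext => x; rewrite /pot; ring. Qed.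

Let s0 := shiftK 0. Let u0 := unshiftK 0. Let s1 := shiftK 1. Let u1 := unshiftK 1.

Let l2_parts f : l2 f ->
  [/\ l2 (wshift (shift 0) c1 f), l2 (wshift_adj (unshift 0) c1 f),
      l2 (wshift (shift 1) c2 f), l2 (wshift_adj (unshift 1) c2 f) & l2 (pot f)].
Proof.
move=> lf; split.
- exact: wshift_l2 s0 u0 c1_le _ lf.
- exact: wshift_adj_l2 s0 u0 c1_le _ lf.
- exact: wshift_l2 s1 u1 c2_le _ lf.
- exact: wshift_adj_l2 s1 u1 c2_le _ lf.
- exact: pot_l2.
Qed.

Lemma Hreal_l2 f : l2 f -> l2 (Hreal f).
Proof.
move=> /l2_parts[a1 a2 b1 b2 lp]; rewrite Hreal_decomposition.
exact: l2D (l2D (l2D a1 a2) (l2D b1 b2)) lp.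
Qed.

Lemma nrm_Hreal f : l2 f -> nrm (Hreal f) <= (4 + enorm v) * nrm f.
Proof.
move=> lf; have [a1 a2 b1 b2 lp] := l2_parts lf; rewrite Hreal_decomposition.
apply: le_trans (nrmD (l2D (l2D a1 a2) (l2D b1 b2)) lp) _.
rewrite mulrDl; apply: lerD; last exact: nrm_pot.
apply: le_trans (nrmD (l2D a1 a2) (l2D b1 b2)) _.
have h1 := nrmD a1 a2; have h2 := nrmD b1 b2.
have := nrm_wshift s0 c1_le lf; have := nrm_wshift_adj u0 c1_le lf.
have := nrm_wshift s1 c2_le lf; have := nrm_wshift_adj u1 c2_le lf.
lra.
Qed.

Lemma Hreal_sym f g : l2 f -> l2 g -> dot (Hreal f) g = dot f (Hreal g).
Proof.
move=> lf lg; have [a1 a2 b1 b2 lp] := l2_parts lf.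
have [a1' a2' b1' b2' lp'] := l2_parts lg; rewrite !Hreal_decomposition.
rewrite (dotDl (l2D (l2D a1 a2) (l2D b1 b2)) lp lg) (dotDl (l2D a1 a2) (l2D b1 b2) lg).
rewrite (dotDl a1 a2 lg) (dotDl b1 b2 lg).
rewrite (dotDr (l2D (l2D a1' a2') (l2D b1' b2')) lp' lf) (dotDr (l2D a1' a2') (l2D b1' b2') lf).
rewrite (dotDr a1' a2' lf) (dotDr b1' b2' lf) dot_pot.
rewrite (dot_wshift c1 s0 u0 f g) (dot_wshift c2 s1 u1 f g).
rewrite (dotC (wshift_adj (unshift 0) c1 f)) (dotC (wshift_adj (unshift 1) c2 f)).
rewrite -(dot_wshift c1 s0 u0 g f) -(dot_wshift c2 s1 u1 g f).
rewrite (dotC (wshift (shift 0) c1 g)) (dotC (wshift (shift 1) c2 g)).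
by congr (_ + _ + _); rewrite addrC.
Qed.

Arguments at_vertex : simpl never.

Lemma ReD (x y : R[i]) : complex.Re (x + y) = complex.Re x + complex.Re y.
Proof. by case: x y => [a b] [c d]. Qed.

Lemma ImD (x y : R[i]) : complex.Im (x + y) = complex.Im x + complex.Im y.
Proof. by case: x y => [a b] [c d]. Qed.

Lemma Hop_Re (f : Gam N -> R[i]) x :
  complex.Re (Hop v f x) = Hreal (fun y => complex.Re (f y)) x.
Proof.
have sE n k : complex.Re (at_vertex f n k) = site (fun y => complex.Re (f y)) n k.
  by case: k => [|k] //; rewrite /site /at_vertex; case: insub.
case: x => n i; rewrite /Hop ReD /Hreal; congr (_ + _); last first.
  by case: (f (n, i)) => a b /=; rewrite mul0r subr0.
by rewrite /Delta /=; case: (odd i) => /=; rewrite !ReD !sE; ring.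
Qed.

Lemma Hop_Im (f : Gam N -> R[i]) x :
  complex.Im (Hop v f x) = Hreal (fun y => complex.Im (f y)) x.
Proof.
have sE n k : complex.Im (at_vertex f n k) = site (fun y => complex.Im (f y)) n k.
  by case: k => [|k] //; rewrite /site /at_vertex; case: insub.
case: x => n i; rewrite /Hop ImD /Hreal; congr (_ + _); last first.
  by case: (f (n, i)) => a b /=; rewrite mul0r addr0.
by rewrite /Delta /=; case: (odd i) => /=; rewrite !ImD !sE; ring.
Qed.

Lemma iter_Hop_Re k (f : Gam N -> R[i]) :
  (fun x => complex.Re (iter k (Hop v) f x)) = iter k Hreal (fun x => complex.Re (f x)).
Proof.
by elim: k => //= k <-; apply: funext => x; rewrite Hop_Re.
Qed.

Lemma iter_Hop_Im k (f : Gam N -> R[i]) :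
  (fun x => complex.Im (iter k (Hop v) f x)) = iter k Hreal (fun x => complex.Im (f x)).
Proof.
by elim: k => //= k <-; apply: funext => x; rewrite Hop_Im.
Qed.

End RealHamiltonian.

Arguments site : simpl never.

(** * Fourier representation along the ribbon *)

Section Average.
Variable R : realType.
Implicit Types (f g : R -> R) (c : R).
Local Notation mu := (@lebesgue_measure R).

(** Functions of the quasimomentum that occur below are even, or enter through
    products that are, so half a period suffices. *)
Definition avg f : R := (\int[mu]_(t in `[0, pi]) f t) / pi.

Lemma continuous_integrable f : continuous f -> mu.-integrable `[0, pi]%classic (EFin \o f).
Proof.
move=> cf; apply: continuous_compact_integrable; first exact: segment_compact.
exact: continuous_subspaceT.
Qed.

Lemma avgD f g : continuous f -> continuous g -> avg (fun t => f t + g t) = avg f + avg g.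
Proof.
move=> cf cg; rewrite /avg RintegralD ?mulrDl //; exact: continuous_integrable.
Qed.

Lemma avgZ c f : continuous f -> avg (fun t => c * f t) = c * avg f.
Proof.
move=> cf; rewrite /avg RintegralZl ?mulrA //; exact: continuous_integrable.
Qed.

Lemma le_avg f g : continuous f -> continuous g -> (forall t, f t <= g t) -> avg f <= avg g.
Proof.
move=> cf cg fg; rewrite /avg ler_pM2r ?invr_gt0 ?pi_gt0 //.
by apply: le_Rintegral => // *; try exact: continuous_integrable.
Qed.

Lemma avg_cst c : avg (fun=> c) = c.
Proof.
rewrite /avg Rintegral_cst //= lebesgue_measure_itv /= lte_fin pi_gt0 oppr0 adde0 /=.
by rewrite mulfK // gt_eqF // pi_gt0.
Qed.

Lemma avgB f g : continuous f -> continuous g -> avg (fun t => f t - g t) = avg f - avg g.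
Proof.
move=> cf cg; rewrite /avg RintegralB ?mulrBl //; exact: continuous_integrable.
Qed.

(** The shape of one row of the equation H f = g. *)
Lemma avg_comb5 a1 a5 f1 f2 f3 f4 f5 : continuous f1 -> continuous f2 -> continuous f3 ->
  continuous f4 -> continuous f5 ->
  avg (fun t => a1 * f1 t + f2 t + f3 t + f4 t + a5 * f5 t) =
  a1 * avg f1 + avg f2 + avg f3 + avg f4 + a5 * avg f5.
Proof.
move=> c1 c2 c3 c4 c5.
have d1 : continuous (fun t => a1 * f1 t) by move=> t; apply: cvgM; [exact: cvg_cst | exact: c1].
have d5 : continuous (fun t => a5 * f5 t) by move=> t; apply: cvgM; [exact: cvg_cst | exact: c5].
have d2 : continuous (fun t => a1 * f1 t + f2 t) by move=> t; apply: cvgD; [exact: d1 | exact: c2].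
have d3 : continuous (fun t => a1 * f1 t + f2 t + f3 t) by move=> t; apply: cvgD; [exact: d2 | exact: c3].
have d4 : continuous (fun t => a1 * f1 t + f2 t + f3 t + f4 t) by move=> t; apply: cvgD; [exact: d3 | exact: c4].
by rewrite (avgD d4 d5) (avgD d3 c4) (avgD d2 c3) (avgD d1 c2) !avgZ.
Qed.

Lemma avg_close f g e : continuous f -> continuous g -> (forall t, `|f t - g t| <= e) ->
  `|avg f - avg g| <= e.
Proof.
move=> cf cg fg; have cfg : continuous (fun t => f t - g t).
  by move=> t; apply: cvgB; [exact: cf | exact: cg].
rewrite -avgB // -(avg_cst e) ler_norml; apply/andP; split.
  rewrite -[- avg _]mulN1r -avgZ; last exact: cst_continuous.
  apply: le_avg => // [|t]; first exact: cst_continuous.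
  by have := fg t; rewrite mulN1r ler_norml => /andP[].
apply: le_avg => // [|t]; first exact: cst_continuous.
by have := fg t; rewrite ler_norml => /andP[].
Qed.

Lemma continuous_cosZ c : continuous (fun t : R => cos (c * t)).
Proof.
move=> t; apply: continuous_comp; last exact: continuous_cos.
exact: mulrl_continuous.
Qed.

Lemma sin_int_pi (z : int) : sin (z%:~R * pi) = 0 :> R.
Proof.
have H (n : nat) : sin (n%:R * pi) = 0 :> R.
  elim: n => [|n IH]; first by rewrite mul0r sin0.
  by rewrite -natr1 mulrDl mul1r sinD IH sinpi mul0r mulr0 addr0.
by case: z => n; [exact: H | rewrite NegzE mulrNz mulNr sinN H oppr0].
Qed.

Lemma avg_cos (z : int) : avg (fun t => cos (z%:~R * t)) = (z == 0)%:R.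
Proof.
have [->|z0] := eqVneq z 0.
  by under eq_fun do rewrite mul0r cos0; rewrite avg_cst.
have zR : z%:~R != 0 :> R by rewrite intr_eq0.
pose G : R -> R := z%:~R^-1 \*: (@sin R \o (z%:~R \*: id)).
have D (t : R) : is_derive t 1 G (cos (z%:~R * t)).
  apply: is_derive_eq; rewrite /GRing.scale /= mulr1 [_ * z%:~R]mulrC mulrA mulVf ?mul1r //.
have cG : continuous G.
  by move=> t; apply/differentiable_continuous/derivable1_diffP; apply: ex_derive.
rewrite /avg /Rintegral (@continuous_FTC2 _ _ G) /=.
- by rewrite /G /= /GRing.scale /= sin_int_pi !mulr0 sin0 mulr0 subrr mul0r.
- exact: pi_gt0.
- by apply: continuous_subspaceT; exact: continuous_cosZ.
- by split=> [t _||]; [apply: ex_derive | apply: cvg_at_right_filter; exact: cG | apply: cvg_at_left_filter; exact: cG].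
- by move=> t _; rewrite derive1E derive_val.
Qed.

End Average.


Section FibreFormula.
Variables (R : realType) (N : nat) (v : 'rV[R]_(N.*2.+1)).
Local Notation p := (N.*2.+1).
Implicit Types (q : {poly R}) (z m n : int).

(** The first row of q(J_a) for a = 2 cos t. *)
Definition fib q (t : R) : 'rV[R]_p := row 0 (horner_mx (J (2 * cos t) v) q).

Lemma fib_MXaddC q c t : fib (q * 'X + c%:P) t = fib q t *m J (2 * cos t) v + c *: delta_mx 0 0.
Proof.
rewrite /fib rmorphD rmorphM /= horner_mx_X horner_mx_C linearD /= -row_mul; congr (_ + _).
by rewrite -scalemx1 linearZ /= row1.
Qed.

Lemma fib0 t : fib 0 t = 0. Proof. by rewrite /fib rmorph0 linear0. Qed.

Lemma coord_fib_MXaddC q c t k : (k < p)%N -> coord (fib (q * 'X + c%:P) t) k =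
  coord v k * coord (fib q t) k + (if odd k then 1 else 2 * cos t) * coord (fib q t) k.+1
  + (if k is k'.+1 then (if odd k' then 1 else 2 * cos t) * coord (fib q t) k' else 0)
  + c * (k == 0)%:R.
Proof.
move=> kp; rewrite fib_MXaddC coord_lt mxE mul_J -!coordE /=; congr (_ + _).
by rewrite coord_lt !mxE eqxx /= -val_eqE.
Qed.

Lemma continuous_coord_fib q k : continuous (fun t => coord (fib q t) k).
Proof.
have c2cos : continuous (fun t : R => 2 * cos t).
  by move=> t; apply: cvgM; [exact: cvg_cst | exact: continuous_cos].
elim/poly_ind: q k => [|q c IH] k.
  by under eq_fun do rewrite fib0 coord0; exact: cst_continuous.
have [kp|pk] := ltnP k p; last first.
  by under eq_fun do rewrite coord_ge //; exact: cst_continuous.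
under eq_fun do rewrite coord_fib_MXaddC //.
move=> t; apply: cvgD; last exact: cvg_cst.
apply: cvgD; first apply: cvgD.
- by apply: cvgM; [exact: cvg_cst | exact: IH].
- by apply: cvgM; [case: (odd k); [exact: cvg_cst | exact: c2cos] | exact: IH].
- case: k {kp} => [|k]; first exact: cvg_cst.
  by apply: cvgM; [case: (odd k); [exact: cvg_cst | exact: c2cos] | exact: IH].
Qed.

Definition wave z q k (t : R) : R := cos (z%:~R * t) * coord (fib q t) k.

Lemma continuous_wave z q k : continuous (wave z q k).
Proof.
by move=> t; apply: cvgM; [exact: continuous_cosZ | exact: continuous_coord_fib].
Qed.

Lemma wave0 z k : wave z 0 k = fun=> 0.
Proof. by apply: funext => t; rewrite /wave fib0 coord0 mulr0. Qed.

Lemma wave_ge z q k : (p <= k)%N -> wave z q k = fun=> 0.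
Proof. by move=> pk; apply: funext => t; rewrite /wave coord_ge // mulr0. Qed.

Let H := Hreal v.

Lemma wave_sum z q k t : wave (z + 1) q k t + wave (z - 1) q k t = 2 * cos t * wave z q k t.
Proof.
rewrite /wave !intrD mulrDl mul1r mulrBl mul1r cosD cosB; ring.
Qed.

(** With i counted from 0, the vertex (n,i) has the horizontal position
    2n + uphalf i, and J_a is
    obtained from H by the phases of these positions; the identity
    2 cos t cos(zt) = cos((z+1)t) + cos((z-1)t) is the pair of
    bonds that becomes the entry a. Both sides obey the same recurrence in q. *)
Lemma polop_delta q m n (i : 'I_p) :
  polop H q (delta R (m, ord0)) (n, i) = avg (wave (2 * (n - m) + (uphalf i)%:Z) q i).
Proof.
elim/poly_ind: q n i => [|q c IH] n i.
  rewrite -[0]/(0%:P) polopC scale0r wave0 avg_cst.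
  by [].
have Hlin : linear H by exact: Hreal_linear.
set f := polop H q (delta R (m, ord0)) in IH *.
have siteE n' k : site f n' k.+1 = avg (wave (2 * (n' - m) + (uphalf k)%:Z) q k).
  have [kp|pk] := ltnP k p; last first.
    rewrite /site insubF; last by rewrite ltnNge pk.
    by rewrite wave_ge // avg_cst.
  by rewrite /site (insubT (fun k => (k < p)%N) kp) IH.
rewrite polopD polopMX // polopC -/f addrfctE scalrfctE.
rewrite /H /Hreal /= -/H.
set Z := 2 * (n - m) + (uphalf i)%:Z.
have wE t : wave Z (q * 'X + c%:P) i t = coord v i * wave Z q i t
    + (if odd i then 1 else 2 * cos t) * wave Z q i.+1 t
    + (if i : nat is k'.+1 then (if odd k' then 1 else 2 * cos t) * wave Z q k' t else 0)
    + c * (i == 0 :> nat)%:R * cos (Z%:~R * t).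
  rewrite /wave coord_fib_MXaddC //.
  by case: (nat_of_ord i) => [|k]; ring.
have -> : f (n, i) = avg (wave Z q i) by rewrite IH.
have -> : c *: delta R (m, ord0) (n, i) = c * (i == 0 :> nat)%:R * avg (fun t => cos (Z%:~R * t)).
  rewrite avg_cos /delta /GRing.scale /= /Z -mulrA -natrM mulnb xpair_eqE andbC -val_eqE /=.
  congr (c * (_ : bool)%:R); case: eqP => //= ->; rewrite addr0 mulf_eq0 /= subr_eq0 //.
rewrite -coordE.
have cw z k := @continuous_wave z q k.
have ccos := @continuous_cosZ R Z%:~R.
have c0 : continuous (fun _ : R => 0 : R) by move=> t; exact: cvg_cst.
case: (boolP (odd i)) => oi.
  case iE : (nat_of_ord i) oi => [//|k] /= ek.
  have uk : uphalf k = k./2 by rewrite uphalf_half (negbTE ek).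
  have Zk : Z = 2 * (n - m) + (k./2)%:Z + 1 by rewrite /Z iE /=; lia.
  have -> : wave Z (q * 'X + c%:P) k.+1 = fun t => coord v k.+1 * wave Z q k.+1 t
     + wave (Z + 1) q k t + wave (Z - 1) q k t + wave Z q k.+2 t + 0 * cos (Z%:~R * t).
    apply: funext => t; have := wE t; rewrite iE /= (negbTE ek) /= => ->.
    by rewrite -wave_sum mulr0 !mul0r; ring.
  rewrite avg_comb5 // !siteE /= uk mulr0 mul0r.
  have -> : 2 * (n - m) + (k./2)%:Z = Z - 1 by lia.
  have -> : 2 * (n + 1 - m) + (k./2)%:Z = Z + 1 by lia.
  have -> : 2 * (n - m) + (k./2).+1%:Z = Z by lia.
  by ring.
case iE : (nat_of_ord i) oi => [|k] /= ek.
  have Zk : Z = 2 * (n - m) by rewrite /Z iE addr0.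
  have -> : wave Z (q * 'X + c%:P) 0 = fun t => coord v 0 * wave Z q 0 t
     + wave (Z + 1) q 1 t + wave (Z - 1) q 1 t + 0 + c * cos (Z%:~R * t).
    apply: funext => t; have := wE t; rewrite iE /= => ->.
    by rewrite -wave_sum; ring.
  have s0 : site f n 0 = 0 by [].
  rewrite avg_comb5 // s0 !siteE /= avg_cst mulr1.
  have -> : 2 * (n - m) + 1%:Z = Z + 1 by lia.
  have -> : 2 * (n - 1 - m) + 1%:Z = Z - 1 by lia.
  by ring.
rewrite negbK in ek; have uk : uphalf k = k./2.+1 by rewrite uphalf_half ek.
have Zk : Z = 2 * (n - m) + (k./2)%:Z + 1 by rewrite /Z iE /=; lia.
have -> : wave Z (q * 'X + c%:P) k.+1 = fun t => coord v k.+1 * wave Z q k.+1 t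
   + wave (Z + 1) q k.+2 t + wave (Z - 1) q k.+2 t + wave Z q k t + 0 * cos (Z%:~R * t).
  apply: funext => t; have := wE t; rewrite iE /= ek /= => ->.
  by rewrite -wave_sum mulr0 !mul0r; ring.
rewrite avg_comb5 // !siteE /= uk mulr0 mul0r.
have -> : 2 * (n - m) + (k./2).+1%:Z = Z by lia.
have -> : 2 * (n - m) + (k./2).+2%:Z = Z + 1 by lia.
have -> : 2 * (n - 1 - m) + (k./2).+2%:Z = Z - 1 by lia.
by ring.
Qed.

End FibreFormula.

(** * Weierstrass approximation *)

Section Weierstrass.
Variable R : realType.
Implicit Types (f : R -> R) (x y : R).

(** The value of the Bernstein polynomial of degree n with nodal values phi k, in
    the recursive form that conditions on the first of n coin tosses: moments and
    monotonicity are one-line inductions. *)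
Fixpoint bern (n : nat) (phi : nat -> R) : {poly R} :=
  if n is m.+1 then 'X * bern m (phi \o S) + (1 - 'X) * bern m phi
  else (phi 0%N)%:P.

Lemma bern_le n (phi psi : nat -> R) x : 0 <= x <= 1 ->
  (forall k, (k <= n)%N -> phi k <= psi k) ->
  (bern n phi).[x] <= (bern n psi).[x].
Proof.
move=> x01; elim: n phi psi => [|n IH] phi psi le_phi /=.
  by rewrite !hornerC le_phi.
rewrite !hornerE; apply: lerD; apply: ler_wpM2l; try lra.
  by apply: IH => k kn; apply: le_phi.
by apply: IH => k kn; apply: le_phi; apply: leqW.
Qed.

Lemma eq_bern n (phi psi : nat -> R) : phi =1 psi -> bern n phi = bern n psi.
Proof. by move=> e; congr bern; apply: funext. Qed.

(** Mean and second moment of the binomial distribution. *)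
Lemma bern_quadratic n (al be ga x : R) :
  (bern n (fun k => al * k%:R ^+ 2 + be * k%:R + ga)).[x] =
  al * (n%:R * x * (1 - x) + (n%:R * x) ^+ 2) + be * (n%:R * x) + ga.
Proof.
elim: n be ga => [|n IH] be ga /=; first by rewrite hornerC; ring.
rewrite !(hornerD, hornerN, hornerM, hornerX, hornerC) IH.
rewrite (@eq_bern _ _ (fun k => al * k%:R ^+ 2 + (2 * al + be) * k%:R + (al + be + ga))).
  by rewrite IH -(natr1 n); ring.
by move=> k /=; rewrite -(natr1 k); ring.
Qed.

(** The quadratic modulus of continuity turns the error into the variance
    y (1 - y) / n of the Bernstein mean. *)
Lemma bernstein_approx f (K eps : R) : 0 <= K -> 0 < eps ->
  (forall x y, 0 <= x <= 1 -> 0 <= y <= 1 ->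
     `|f x - f y| <= eps + K * (x - y) ^+ 2) ->
  exists q : {poly R}, forall x, 0 <= x <= 1 -> `|f x - q.[x]| <= eps + eps.
Proof.
move=> K0 e0 fP.
(* K / n, a bound for K times the variance, is at most eps. *)
pose n := (Num.truncn (K / eps)).+1.
have n0 : 0 < n%:R :> R by rewrite ltr0n.
have Kn : K / n%:R <= eps.
  rewrite ler_pdivrMr // mulrC -ler_pdivrMr //.
  by apply/ltW; rewrite /n truncnS_gt.
exists (bern n (fun k => f (k%:R / n%:R))) => y y01.
have kn k : (k <= n)%N -> 0 <= (k%:R / n%:R : R) <= 1.
  by move=> kn; rewrite divr_ge0 ?ler0n //= ler_pdivrMr // mul1r ler_nat.
have n0' : n%:R != 0 :> R by rewrite gt_eqF.
have Ky : K * (y * (1 - y)) / n%:R <= eps.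
  apply: le_trans Kn; rewrite ler_pM2r ?invr_gt0 //.
  by rewrite ler_piMr //; nra.
have up : (bern n (fun k => f (k%:R / n%:R))).[y] <=
    f y + eps + K * (y * (1 - y)) / n%:R.
  have -> : f y + eps + K * (y * (1 - y)) / n%:R =
      (bern n (fun k => (K / n%:R ^+ 2) * k%:R ^+ 2 + (- 2 * K * y / n%:R) * k%:R
        + (K * y ^+ 2 + f y + eps))).[y].
    by rewrite bern_quadratic; field.
  apply: bern_le => // k /kn k01; have := fP _ _ k01 y01.
  rewrite ler_norml => /andP[_].
  have -> : (k%:R / n%:R - y) ^+ 2 = k%:R ^+ 2 / n%:R ^+ 2 - 2 * y / n%:R * k%:R + y ^+ 2.
    by field.
  rewrite lerBlDl => /le_trans-> //; rewrite le_eqVlt; apply/orP; left; apply/eqP; field.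
  by [].
have dn : f y - eps - K * (y * (1 - y)) / n%:R <=
    (bern n (fun k => f (k%:R / n%:R))).[y].
  have -> : f y - eps - K * (y * (1 - y)) / n%:R =
      (bern n (fun k => (- K / n%:R ^+ 2) * k%:R ^+ 2 + (2 * K * y / n%:R) * k%:R
        + (- K * y ^+ 2 + f y - eps))).[y].
    by rewrite bern_quadratic; field.
  apply: bern_le => // k /kn k01; have := fP _ _ k01 y01.
  rewrite ler_norml => /andP[+ _].
  have -> : (k%:R / n%:R - y) ^+ 2 = k%:R ^+ 2 / n%:R ^+ 2 - 2 * y / n%:R * k%:R + y ^+ 2.
    by field.
  rewrite lerBrDl => /(le_trans _)-> //; rewrite le_eqVlt; apply/orP; left; apply/eqP; field.
  by [].
by rewrite ler_norml; apply/andP; split; lra.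
Qed.

Lemma segment_uniform_continuity f (a b eps : R) :
  ({within `[a, b], continuous f})%classic -> 0 < eps ->
  exists2 d : R, 0 < d & forall x y, a <= x <= b -> a <= y <= b ->
    `|x - y| < d -> `|f x - f y| < eps.
Proof.
move=> cf e0.
pose P (d x : R) := a <= x <= b -> forall y, a <= y <= b -> `|x - y| < d -> `|f x - f y| < eps.
have := @segment_compact R a b => /compact_near_coveringP /(_ R ((0 : R)^'+)%classic P).
have F0 : Filter ((0:R)^'+)%classic by apply: at_right_proper_filter.
move=> /(_ F0) h.
have {h} : \forall d \near ((0:R)^'+)%classic, (`[a, b]%classic `<=` P d)%classic.
  apply: h => x xab.
  have xab' : a <= x <= b by move: xab; rewrite /= in_itv.
  have /subspace_continuousP /(_ x xab) /cvgrPdist_lt /(_ (eps / 2)) := cf.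
  move=> /(_ ltac:(lra)); rewrite /= near_withinE => /nbhs_ballP[d /= d0 dP].
  have dP' y : a <= y <= b -> `|x - y| < d -> `|f x - f y| < eps / 2.
    by move=> yab xy; apply: dP => //=; rewrite in_itv.
  exists (ball x (d / 2), [set t : R | t < d / 2])%classic => /=.
    have d2 : 0 < d / 2 by lra.
    by split; [exact: nbhsx_ballx | exact: nbhs_right_lt].
  move=> [x' t] /= [xx' td] x'ab y yab x'y.
  rewrite /ball /= in xx'.
  have h1 : `|x - x'| < d by apply: lt_trans xx' _; lra.
  have h2 : `|x - y| < d.
    have -> : x - y = (x - x') + (x' - y) by ring.
    by apply: le_lt_trans (ler_normD _ _) _; lra.
  have := dP' _ x'ab h1; have := dP' _ yab h2.
  have -> : f x' - f y = (f x - f y) - (f x - f x') by ring.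
  by move=> h3 h4; apply: le_lt_trans (ler_normB _ _) _; lra.
move=> near0.
have near1 : \forall d \near ((0:R)^'+)%classic, 0 < d by exact: nbhs_right_gt.
have [d [d0 dP]] : exists d : R, 0 < d /\ (`[a, b]%classic `<=` P d)%classic.
  apply: (@filter_ex _ ((0:R)^'+)%classic).
  by near=> d; split; near: d.
exists d => // x y xab yab xy; apply: dP => //=; by rewrite in_itv.
Unshelve. all: by end_near.
Qed.

(** Points at distance at least d are handled by the quadratic term, since f is
    bounded. *)
Lemma quadratic_modulus f (a b eps : R) : a <= b ->
  ({within `[a, b], continuous f})%classic -> 0 < eps ->
  exists2 K : R, 0 <= K & forall x y, a <= x <= b -> a <= y <= b ->
    `|f x - f y| <= eps + K * (x - y) ^+ 2.
Proof.
move=> ab cf e0.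
have [d d0 dP] := segment_uniform_continuity cf e0.
have [c _ cM] := EVT_max ab cf.
have [c' _ cm] := EVT_min ab cf.
have fcc : f c' <= f c by apply: (le_trans (cm a _)); rewrite ?cM // in_itv /= lexx.
exists ((f c - f c') / d ^+ 2) => [|x y xab yab].
  by rewrite divr_ge0 ?sqr_ge0 // subr_ge0.
have [xy|xy] := ltrP `|x - y| d.
  apply: le_trans (ltW (dP _ _ xab yab xy)) _.
  by rewrite lerDl mulr_ge0 ?sqr_ge0 // divr_ge0 ?sqr_ge0 // subr_ge0.
apply: (@le_trans _ _ (f c - f c')).
  have [h1 h2] : f x <= f c /\ f y <= f c by split; apply: cM; rewrite in_itv.
  have [h3 h4] : f c' <= f x /\ f c' <= f y by split; apply: cm; rewrite in_itv.
  by rewrite ler_norml; apply/andP; split; lra.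
apply: ler_wpDl; first exact: ltW.
rewrite mulrAC -mulrA ler_peMr ?subr_ge0 //.
rewrite ler_pdivlMr ?exprn_gt0 // mul1r -(real_normK (num_real (x - y))).
by rewrite lerXn2r // nnegrE ltW.
Qed.

Lemma weierstrass f (a b eps : R) : a < b ->
  ({within `[a, b], continuous f})%classic -> 0 < eps ->
  exists q : {poly R}, forall x, a <= x <= b -> `|f x - q.[x]| <= eps.
Proof.
move=> ab cf e0.
have e2 : 0 < eps / 2 by lra.
have [K K0 KP] := quadratic_modulus (ltW ab) cf e2.
have ba : 0 < b - a by lra.
have aff x : 0 <= x <= 1 -> a <= a + (b - a) * x <= b by move=> ?; nra.
have [] := @bernstein_approx (fun x => f (a + (b - a) * x)) (K * (b - a) ^+ 2) (eps / 2).
- by rewrite mulr_ge0 ?sqr_ge0.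
- by [].
- move=> x y x01 y01; apply: le_trans (KP _ _ (aff _ x01) (aff _ y01)) _.
  by rewrite le_eqVlt; apply/orP; left; apply/eqP; ring.
move=> q qP; exists (q \Po ((b - a)^-1 *: ('X - a%:P))) => x xab.
have h : 0 <= (x - a) / (b - a) <= 1.
  rewrite divr_ge0 ?ler_pdivrMr //=; lra.
have := qP _ h; rewrite horner_comp !(hornerZ, hornerD, hornerN, hornerX, hornerC).
have -> : a + (b - a) * ((x - a) / (b - a)) = x by field; lra.
by rewrite [(b - a)^-1 * _]mulrC => h1; apply: le_trans h1 _; lra.
Qed.

End Weierstrass.

(** * Weighted push-forward measures *)

Section Density.
Variable R : realType.
Local Notation leb := (@lebesgue_measure R).

Lemma horner_bounded (q : {poly R}) (B : R) :
  exists2 C, 0 <= C & forall x, `|x| <= B -> `|q.[x]| <= C.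
Proof.
elim/poly_ind: q => [|q c [C C0 IH]]; first by exists 0 => // x _; rewrite horner0 normr0.
exists (C * `|B| + `|c|) => [|x xB]; first by rewrite addr_ge0 ?mulr_ge0.
rewrite hornerMXaddC; apply: normrD_le => //; apply: normrM_le; first exact: IH.
exact: le_trans xB (ler_norm _).
Qed.

Lemma continuous_horner (q : {poly R}) : continuous (fun x : R => q.[x]).
Proof.
elim/poly_ind: q => [|q c IH] x.
  by under eq_fun do rewrite horner0; exact: cvg_cst.
under eq_fun do rewrite hornerMXaddC.
by apply: cvgD; [apply: cvgM; [exact: IH | exact: cvg_id] | exact: cvg_cst].
Qed.

(** A measure with density f has Radon-Nikodym derivative f, up to a null set. *)
Lemma density_integral (nu : {finite_measure set (measurableTypeR R) -> \bar R})
    (f g : R -> \bar R) : leb.-integrable setT f ->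
  (forall A, measurable A -> nu A = (\int[leb]_(x in A) f x)%E) ->
  nu.-integrable setT g ->
  (\int[nu]_x g x = \int[leb]_x (g x * f x))%E.
Proof.
move=> intf nuE intg.
have dom : nu `<< leb.
  apply/null_content_dominatesP => A mA A0; rewrite nuE //.
  apply: null_set_integral => //; apply: (measurable_int leb).
  exact: integrableS intf.
rewrite -(Radon_Nikodym_change_of_variables dom) //.
have mg := measurable_int _ intg; have mf := measurable_int _ intf.
apply: ae_eq_integral => //.
- by apply: emeasurable_funM => //; apply: (measurable_int leb); exact: Radon_Nikodym_integrable.
- exact: emeasurable_funM.
apply: ae_eqe_mul2l; apply: integral_ae_eq => //; first exact: Radon_Nikodym_integrable.
by move=> E _ mE; rewrite -Radon_Nikodym_integral // -nuE.
Qed.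

Lemma finite_measure_exists (m : set (measurableTypeR R) -> \bar R) :
  m set0 = 0%E -> (forall A, (0 <= m A)%E) -> semi_sigma_additive m -> fin_num_fun m ->
  exists mu : {finite_measure set (measurableTypeR R) -> \bar R}, forall A, mu A = m A.
Proof.
move=> m0 mge0 msig mfin.
pose m1 : {measure set (measurableTypeR R) -> \bar R} :=
  HB.pack m (isMeasure.Build _ _ _ m m0 mge0 msig).
pose m2 : {finite_measure set (measurableTypeR R) -> \bar R} :=
  HB.pack m (isMeasure.Build _ _ _ m m0 mge0 msig)
    (@Measure_isFinite.Build _ _ _ m1 mfin).
by exists m2.
Qed.

(** The image under phi of the measure with density rho / pi on [0,pi]. For
    phi = lambda(t) it is the spectral measure of a vector of the band. *)
Lemma weighted_pushforward (phi rho : R -> R) (B : R) :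
  continuous phi -> (forall t, `|phi t| <= B) ->
  continuous rho -> (forall t, 0 <= rho t) ->
  exists mu : {finite_measure set (measurableTypeR R) -> \bar R},
    (forall A, measurable A ->
       mu A = \int[leb]_(t in (`[0%R, pi] `&` phi @^-1` A)%classic) (rho t / pi)%:E)%E /\
    forall q : {poly R}, \int[mu]_x q.[x] = avg (fun t => q.[phi t] * rho t).
Proof.
move=> cphi phiB crho rho0.
pose D : set R := (`[0, pi])%classic.
pose f : R -> \bar R := ((fun t => (rho t / pi)%:E) \_ D)%E.
have f0 t : (0 <= f t)%E.
  by rewrite /f patchE; case: ifP => // _; rewrite lee_fin divr_ge0 // pi_ge0.
have mD : measurable (D : set (measurableTypeR R)) by exact: measurable_itv.
have intf : leb.-integrable setT f.
  have : leb.-integrable D (EFin \o (fun t => rho t / pi)).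
    by apply: continuous_integrable => t; apply: cvgM; [exact: crho | exact: cvg_cst].
  by move/(integrable_mkcond _ mD).
have mf := measurable_int _ intf.
have [nu nuE] : exists nu : {finite_measure set (measurableTypeR R) -> \bar R},
    forall A, nu A = (\int[leb]_(t in A) f t)%E.
  apply: finite_measure_exists.
  - by rewrite integral_set0.
  - by move=> A; apply: integral_ge0 => t _.
  - exact: semi_sigma_additive_nng_induced.
  - by move=> A mA; apply: integrable_fin_num => //; exact: integrableS intf.
have mphi : @measurable_fun _ _ (measurableTypeR R) (measurableTypeR R) setT phi.
  exact: continuous_measurable_fun.
have mpre (A : set (measurableTypeR R)) : measurable A -> measurable (phi @^-1` A : set (measurableTypeR R))%classic.
  by move=> mA; rewrite -[X in measurable X]setTI; exact: mphi.
have [mu muE] : exists mu : {finite_measure set (measurableTypeR R) -> \bar R},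
    forall A, mu A = pushforward nu phi A.
  apply: finite_measure_exists.
  - by rewrite /pushforward preimage_set0.
  - by move=> A; exact: measure_ge0.
  - move=> F mF tF mUF; rewrite /pushforward preimage_bigcup.
    apply: measure_semi_sigma_additive.
    + by move=> n; apply: mpre; exact: mF.
    + apply/trivIsetP => /= i j _ _ ij; rewrite -preimage_setI.
      by move/trivIsetP : tF => /(_ _ _ _ _ ij) -> //; rewrite preimage_set0.
    + by rewrite -preimage_bigcup; exact: mpre.
  - by move=> A mA; apply: fin_num_measure; exact: mpre.
exists mu; split=> [A mA|q].
  by rewrite muE /pushforward nuE setIC integral_mkcondr.
have mq : measurable_fun setT (fun x : R => q.[x]).
  by apply: continuous_measurable_fun; exact: continuous_horner.
have [C C0 CP] := horner_bounded q B.
have intq : nu.-integrable setT (fun t => (q.[phi t])%:E).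
  apply: (@measurable_bounded_integrable _ _ _ nu (fun t => q.[phi t])) => //.
  - by rewrite ltey_eq fin_num_measure.
  - exact: measurableT_comp mq mphi.
  - exists C; split; first by rewrite num_real.
    by move=> x Cx t _; apply: le_trans (CP _ (phiB t)) (ltW Cx).
rewrite /avg /Rintegral.
have -> : (\int[mu]_x (q.[x])%:E = \int[nu]_t (q.[phi t])%:E)%E.
  have := @integral_pushforward _ _ (measurableTypeR R) (measurableTypeR R) R phi mphi nu setT (fun x => (q.[x])%:E).
  rewrite preimage_setT => <- //; last exact/measurable_EFinP.
  by apply: eq_measure_integral => A _ _; exact: muE.
rewrite (density_integral intf (fun A _ => nuE A)) //.
have -> : (\int[leb]_x ((q.[phi x])%:E * f x) = \int[leb]_(x in D) ((pi^-1)%:E * (q.[phi x] * rho x)%:E))%E.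
  rewrite [RHS]integral_mkcond; apply: eq_integral => t _.
  rewrite /f !patchE; case: ifP => _; last by rewrite mule0.
  by rewrite -!EFinM; congr EFin; ring.
rewrite integralZl //; last first.
  apply: continuous_integrable => t; apply: cvgM; last exact: crho.
  by apply: continuous_comp; [exact: cphi | exact: continuous_horner].
rewrite fineM //; first by rewrite mulrC.
apply: integrable_fin_num => //; apply: continuous_integrable => t; apply: cvgM; last exact: crho.
by apply: continuous_comp; [exact: cphi | exact: continuous_horner].
Qed.

(** A density that is positive except at finitely many points has the null sets
    of the Lebesgue measure. The exceptional points are the zeros of sin(2t). *)
Lemma weighted_null (E : set (measurableTypeR R)) (rho : R -> R) :
  measurable E -> (E `<=` `[0, pi])%classic -> continuous rho -> (forall t, 0 <= rho t) ->
  (forall t : R, 0 < t < pi -> cos t != 0 -> 0 < rho t) ->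
  (\int[leb]_(t in E) (rho t / pi)%:E = 0)%E <-> leb E = 0%E.
Proof.
move=> mE E0 crho rho0 rho_gt0; pose f t := (rho t / pi)%:E.
have mf : measurable_fun E f.
  apply: measurable_funTS; apply/measurable_EFinP; apply: continuous_measurable_fun => t.
  by apply: cvgM; [exact: crho | exact: cvg_cst].
split=> [int0|E00]; last exact: null_set_integral.
have /(ae_eq_integral_abs _ mE mf) : (\int[leb]_(t in E) `|f t| = 0)%E.
  rewrite -[RHS]int0; apply: eq_integral => t _.
  by rewrite gee0_abs // lee_fin divr_ge0 // pi_ge0.
move=> [Z [mZ Z0 ZP]].
(* The points of [0,pi] where rho may vanish. *)
pose Y : set (measurableTypeR R) := ([set 0; pi / 2; pi])%classic.
have Y0 : leb Y = 0%E.
  by apply: countable_lebesgue_measure0; apply: finite_set_countable; rewrite !finite_setU; split=> //; split.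
have mY : measurable Y by do !apply: measurableU; exact: measurable_set1.
apply: (@subset_measure0 _ _ _ leb E (Z `|` Y)%classic) => //.
- exact: measurableU.
- move=> t Et; have [Yt|nYt] := pselect (Y t); [by right | left; apply: ZP].
  apply/not_implyP; split=> //= -[].
  have := E0 _ Et; rewrite /= in_itv /= => /andP[t0 tpi].
  have t0' : 0 < t by rewrite lt_neqAle t0 andbT; apply/eqP => tE; apply: nYt; left; left.
  have tpi' : t < pi by rewrite lt_neqAle tpi andbT; apply/eqP => tE; apply: nYt; right.
  have ct : cos t != 0.
    apply/eqP => ct0; apply: nYt; left; right => /=.
    apply: cos_inj; rewrite ?in_itv /= ?t0 ?tpi ?ct0 ?cos_pihalf //.
    by have := @pi_gt0 R => p0; apply/andP; split; lra.
  have := rho_gt0 t; rewrite t0' tpi' => /(_ isT ct) r0 /eqP.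
  by rewrite mulf_eq0 invr_eq0 !gt_eqF // pi_gt0.
- apply: etrans Z0; exact: (measureU0 mZ mY Y0).
Qed.

End Density.

(** * The spectral weight of the middle eigenvalue *)


Section FibreWeight.
Variables (R : realType) (N : nat) (v : 'rV[R]_(N.*2.+1)).
Local Notation p := (N.*2.+1).

(** A lower bound for the distance between 0 and the eigenvalues other than
    lambda_0, the constant of [spectral_gap_above]. *)
Definition gap : R := (1 + N%:R * 10 ^+ N)^-1.

Lemma gap_gt0 : 0 < gap.
Proof. by rewrite invr_gt0 ltr_wpDr // mulr_ge0 // exprn_ge0. Qed.

(** Equal to 1 on the band and to 0 on the rest of the spectrum, so that the
    function bump of H is the projection onto the band. *)
Definition bump (x : R) : R := Num.min 1 (Num.max 0 (2 - 2 / gap * `|x|)).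

Lemma bump_itv x : 0 <= bump x <= 1.
Proof. by rewrite /bump le_min ler01 le_max lexx /= ge_min lexx. Qed.

Lemma bump1 x : `|x| <= gap / 2 -> bump x = 1.
Proof.
move=> xg; have g0 := gap_gt0; apply: min_l; rewrite le_max; apply/orP; right.
suff : 2 / gap * `|x| <= 1 by lra.
by rewrite mulrAC ler_pdivrMr // mul1r mulrC -ler_pdivlMr.
Qed.

Lemma bump0 x : gap <= `|x| -> bump x = 0.
Proof.
move=> xg; have g0 := gap_gt0; rewrite /bump max_l; first by rewrite min_r.
suff : 2 <= 2 / gap * `|x| by lra.
by rewrite mulrAC ler_pdivlMr // ler_pM2l.
Qed.

Lemma continuous_bump : continuous bump.
Proof.
move=> x; apply: (@continuous_min R R (fun=> 1) (fun x => Num.max 0 (2 - 2 / gap * `|x|))); first exact: cvg_cst.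
apply: (@continuous_max R R (fun=> 0) (fun x => (2 - 2 / gap * `|x|))); first exact: cvg_cst.
apply: cvgB; first exact: cvg_cst.
by apply: cvgM; [exact: cvg_cst | exact: norm_continuous].
Qed.

Hypothesis vr : enorm v <= small_radius R N.

(** A bound for the spectrum of all fibres ([eigenvalue_J_bound]). *)
Definition spec_radius : R := 3 + enorm v + enorm v.

(** The weight w is the squared first entry of the normalized eigenvector of
    lambda_0. A polynomial close to psi times bump on the spectrum gives the
    other eigenvalues almost no weight. Stating this for arbitrary psi covers the
    projection itself (psi = 1), its products with polynomials, and the bound of
    q(J_a) (psi = 0). *)
Lemma fibre_weight (a : R) : `|a| <= 2 -> `|lambda0 a v| <= gap / 2 ->
  exists w : R, [/\ 0 <= w, a != 0 -> 0 < w &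
    forall (psi : R -> R) (q : {poly R}) (e : R), 0 <= e ->
      (forall x : R, `|x| <= spec_radius -> `|q.[x] - psi x * bump x| <= e) ->
      `|horner_mx (J a v) q 0 0 - psi (lambda0 a v) * w| <= e].
Proof.
move=> a2 lam_small.
have vk k : `|coord v k| <= enorm v by exact: coord_le_enorm.
have sm := small_radiusP (sqrtr_ge0 _ : 0 <= enorm v) vr vr.
have [sz srt [P PP JE]] := eigenvalues_spectral (J_sym a v).
have PP' : P^T *m P = 1%:M by apply: mulmx1C.
set ev := eigenvalues (J a v) in srt JE *.
have PTu : P^T \in unitmx by case: (mulmx1_unit PP').
have PTi : invmx P^T = P.
  by apply: (can_inj (mulKmx PTu)); rewrite mulmxV // PP'.
have hE q : horner_mx (J a v) q 0 0 = \sum_k P k 0 ^+ 2 * q.[ev`_k].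
  rewrite JE -{2}PTi horner_mx_uconj // PTi horner_mx_diag -mulmxA mxE.
  apply: eq_bigr => k _; rewrite mul_diag_mx !mxE; ring.
have w1 : \sum_k P k 0 ^+ 2 = 1.
  have := congr1 (fun M : 'M[R]_(N.*2.+1) => M 0 0) PP'; rewrite !mxE eqxx /= => E.
  rewrite -[RHS]E; by apply: eq_bigr => k _; rewrite !mxE.
have Nth : ev`_(ordN N) = lambda0 a v by [].
exists (P (ordN N) 0 ^+ 2); split; first exact: sqr_ge0.
- move=> a0; rewrite exprn_even_gt0 //=.
  have -> : P (ordN N) 0 = coord (row (ordN N) P) 0 by rewrite coord_lt mxE; congr (P _ _); apply: val_inj.
  apply: (@eigenvector_first_neq0 _ _ a v _ (lambda0 a v)); last by left.
    by rewrite {1}JE !mulmxA -row_mul PP row1 -rowE row_diag_mx -scalemxAl -rowE mxE.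
  apply/negP => /eqP r0; have := row_mul (ordN N) P P^T.
  rewrite r0 mul0mx PP => /rowP/(_ (ordN N)); rewrite !mxE eqxx => /eqP.
  by rewrite oner_eq0.
- move=> psi q e e0 qe.
  have -> : psi (lambda0 a v) * P (ordN N) 0 ^+ 2 =
      \sum_k P k 0 ^+ 2 * (psi ev`_k * bump ev`_k).
    rewrite (bigD1 (ordN N)) //= [X in _ + X]big1 ?addr0 => [|k kN].
      by rewrite Nth bump1 // mulr1 mulrC.
    rewrite bump0 ?mulr0 //.
    have [ltk|ltk|eqk] := ltngtP k N.
    + rewrite -normrN; have := spectral_gap_below a2 (fun k => vk k.*2) (fun k => vk k.*2.+1) sm ltk.
      by rewrite -/ev lerNr => h; apply: le_trans h (ler_norm _).
    + have := spectral_gap_above a2 (fun k => vk k.*2) (fun k => vk k.*2.+1) sm ltk.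
      by move=> h; apply: le_trans h (ler_norm _).
    + by move: kN; rewrite -val_eqE /= eqk eqxx.
  rewrite hE -sumrB; apply: le_trans (ler_norm_sum _ _ _) _.
  rewrite -[e]mul1r -w1 mulr_suml; apply: ler_sum => k _.
  rewrite -mulrBr normrM ger0_norm ?sqr_ge0 // ler_wpM2l ?sqr_ge0 //.
  apply: qe; exact: (eigenvalue_J_bound a2 (fun k => vk k.*2) (fun k => vk k.*2.+1)).
Qed.

End FibreWeight.

(** * Band components of the point masses *)


Section BandProjection.
Variables (R : realType) (N : nat) (v : 'rV[R]_(N.*2.+1)).
Local Notation p := (N.*2.+1).
Local Notation Rad := (spec_radius v).
Local Notation chi := (@bump R N).
Implicit Types (q r : {poly R}) (e : R) (m n : int).

Definition disp (t : R) : R := lambda0 (2 * cos t) v.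

Lemma cos_le1_norm (x : R) : `|cos x| <= 1.
Proof. by rewrite ler_norml cos_geN1 cos_le1. Qed.

Lemma twice_cos_bound (t : R) : `|2 * cos t| <= 2.
Proof. by rewrite normrM ger0_norm // ler_piMr // cos_le1_norm. Qed.

Lemma continuous_disp : continuous disp.
Proof.
move=> t; apply: (@continuous_comp _ _ _ (fun t => 2 * cos t) (fun a => lambda0 a v)).
  by apply: cvgM; [exact: cvg_cst | exact: continuous_cos].
exact: lambda0_continuous.
Qed.

Hypothesis vr : enorm v <= small_radius R N.
Hypothesis lam_small : forall a, `|a| <= 2 -> `|lambda0 a v| <= gap R N / 2.

Lemma band_weight_exists : exists omega : R -> R, forall t,
  [/\ 0 <= omega t, cos t != 0 -> 0 < omega t &
    forall (psi : R -> R) q e, 0 <= e ->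
      (forall x : R, `|x| <= Rad -> `|q.[x] - psi x * chi x| <= e) ->
      `|coord (fib v q t) 0 - psi (disp t) * omega t| <= e].
Proof.
suff /choice[om omP] : forall t : R, exists w : R, [/\ 0 <= w, cos t != 0 -> 0 < w &
    forall (psi : R -> R) q e, 0 <= e ->
      (forall x : R, `|x| <= Rad -> `|q.[x] - psi x * chi x| <= e) ->
      `|coord (fib v q t) 0 - psi (disp t) * w| <= e].
  by exists om.
move=> t; have t2 := twice_cos_bound t.
have [w [w0 wpos wP]] := fibre_weight vr t2 (lam_small t2).
exists w; split=> // [ct|psi q e e0 qe].
  by apply: wpos; rewrite mulf_neq0 // pnatr_eq0.
have -> : coord (fib v q t) 0 = horner_mx (J (2 * cos t) v) q 0 0.
  by rewrite -[0%N in LHS]/(nat_of_ord (ord0 : 'I_p)) coordE mxE.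
exact: wP.
Qed.

Variable omega : R -> R.
Hypothesis omegaP : forall t (psi : R -> R) q e, 0 <= e ->
  (forall x : R, `|x| <= Rad -> `|q.[x] - psi x * chi x| <= e) ->
  `|coord (fib v q t) 0 - psi (disp t) * omega t| <= e.

Lemma Rad_gt0 : 0 < Rad.
Proof. by rewrite /spec_radius -addrA ltr_wpDr // addr_ge0 // sqrtr_ge0. Qed.

Lemma bump_approx e : 0 < e ->
  exists q, forall x : R, `|x| <= Rad -> `|q.[x] - chi x| <= e.
Proof.
move=> e0; have R0 := Rad_gt0.
have [q qP] := @weierstrass _ chi (- Rad) Rad e (ltac:(lra))
  (continuous_subspaceT (@continuous_bump R N)) e0.
by exists q => x; rewrite ler_norml distrC => /qP.
Qed.

Lemma bump_approx1 e q : (forall x : R, `|x| <= Rad -> `|q.[x] - chi x| <= e) ->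
  (forall x : R, `|x| <= Rad -> `|q.[x] - 1 * chi x| <= e).
Proof. by move=> qe x /qe; rewrite mul1r. Qed.

Lemma continuous_uniform_limit (f : R -> R) :
  (forall e, 0 < e -> exists2 g : R -> R, continuous g & forall t, `|g t - f t| <= e) ->
  continuous f.
Proof.
move=> H t; apply/cvgrPdist_le => e e0.
have e3 : 0 < e / 3 by lra.
have [g cg gf] := H _ e3.
have /cvgrPdist_le/(_ _ e3) := cg t; apply: filterS => s gs.
have -> : f t - f s = (g t - g s) - (g t - f t) + (g s - f s) by ring.
apply: le_trans (ler_normD _ _) _; apply: le_trans (lerD (ler_normB _ _) (lexx _)) _.
by have := gf t; have := gf s; move: gs => /=; lra.
Qed.

(** omega is a uniform limit of entries of polynomials of the fibres, which are
    continuous in t. *)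
Lemma continuous_omega : continuous omega.
Proof.
apply: continuous_uniform_limit => e e0; have [q qP] := bump_approx e0.
exists (fun t => coord (fib v q t) 0); first exact: continuous_coord_fib.
by move=> t; have := omegaP t (ltW e0) (bump_approx1 qP); rewrite mul1r.
Qed.

Lemma fib_bound q t C : 0 <= C -> (forall x : R, `|x| <= Rad -> `|q.[x]| <= C) ->
  `|coord (fib v q t) 0| <= C.
Proof.
move=> C0 qC; have := @omegaP t (fun=> 0) q C C0; rewrite mul0r subr0; apply => x xR.
by rewrite mul0r subr0 qC.
Qed.

(** A polynomial within 1 of bump is bounded by 2 on the spectrum, hence so are the
    corresponding entries of the fibres. *)
Lemma omega_le3 t : omega t <= 3.
Proof.
have [q qP] := bump_approx ltr01.
have q2 (x : R) : `|x| <= Rad -> `|q.[x]| <= 2.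
  move=> /qP h; have := bump_itv N x; have -> : q.[x] = (q.[x] - chi x) + chi x by ring.
  move=> /andP[c0 c1]; apply: le_trans (ler_normD _ _) _; rewrite (ger0_norm c0); lra.
have := fib_bound t (ler0n R 2) q2.
have := omegaP t ler01 (bump_approx1 qP); rewrite mul1r !ler_norml => /andP[h _] /andP[_ h']; lra.
Qed.

Local Notation H := (Hreal v).
Let Hlin : linear H := Hreal_linear v.
Let Hl2 := @Hreal_l2 R N v.
Let Hsym := @Hreal_sym R N v.
Local Notation dl n := (delta R (n, ord0) : Gam N -> R).
Let Hq_l2 q f : l2 f -> l2 (polop H q f) := @polop_l2 _ _ _ Hlin Hl2 q f.

Lemma dot_polop_delta q n m : dot (polop H q (dl n)) (dl m) = avg (wave v (2 * (m - n)) q 0).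
Proof. by rewrite dot_delta polop_delta /= addr0. Qed.

Lemma wave_bound z q C : 0 <= C -> (forall x : R, `|x| <= Rad -> `|q.[x]| <= C) ->
  forall t, `|wave v z q 0 t| <= C.
Proof.
move=> C0 qC t; rewrite /wave -[C]mul1r; apply: normrM_le; first exact: cos_le1_norm.
exact: fib_bound.
Qed.

(** The norm of q(H) on a point mass is at most the supremum of q on the
    spectrum; this replaces the spectral theorem for H. *)
Lemma nrm_polop_delta q n C : 0 <= C -> (forall x : R, `|x| <= Rad -> `|q.[x]| <= C) ->
  nrm (polop H q (dl n)) <= C.
Proof.
move=> C0 qC; have ld := l2_delta R ((n, ord0) : Gam N).
rewrite -(@ler_pXn2r _ 2) ?nnegrE ?nrm_ge0 // nrm_sqr.
rewrite (polop_sym Hlin Hl2 Hsym q ld (Hq_l2 q ld)) dotC -(polopM Hlin).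
rewrite dot_polop_delta.
have C2 : 0 <= C ^+ 2 by exact: sqr_ge0.
have qC2 (x : R) : `|x| <= Rad -> `|(q * q).[x]| <= C ^+ 2.
  by move=> /qC h; rewrite hornerM expr2 normrM ler_pM.
apply: le_trans (ler_norm _) _.
have := @avg_close _ (wave v (2 * (n - n)) (q * q) 0) (fun=> 0) (C ^+ 2).
rewrite avg_cst subr0; apply; first exact: continuous_wave.
  exact: cst_continuous.
by move=> t; rewrite subr0; exact: wave_bound.
Qed.

(** gam n is the component of the point mass at (n,1) in the band, specified by
    how well it is approximated rather than as a limit of a chosen sequence. *)
Definition is_band_part (gam : int -> Gam N -> R) : Prop :=
  (forall n, l2 (gam n)) /\
  forall n q e, 0 <= e -> (forall x : R, `|x| <= Rad -> `|q.[x] - chi x| <= e) ->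
    nrm (gam n - polop H q (dl n)) <= e.

Lemma polopB q r f : polop H (q - r) f = polop H q f - polop H r f.
Proof. by rewrite polopD -[- r]scaleN1r polopZ scaleN1r. Qed.

Lemma polop_sub q (f g : Gam N -> R) : polop H q (f - g) = polop H q f - polop H q g.
Proof.
have := polop_linear Hlin q (-1) g f.
by rewrite !scaleN1r [- g + f]addrC [_ + polop H q f]addrC.
Qed.

Lemma band_part_exists : exists gam, is_band_part gam.
Proof.
pose u (k : nat) : R := k.+1%:R^-1.
have u0 k : 0 < u k by rewrite invr_gt0 ltr0n.
have /choice[e_ eP] : forall k, exists q, forall x : R, `|x| <= Rad -> `|q.[x] - chi x| <= u k.
  by move=> k; exact: bump_approx.
have lim_u : (u @ \oo --> 0)%classic by exact: cvg_harmonic.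
have diff n q r a b : 0 <= a -> 0 <= b ->
    (forall x : R, `|x| <= Rad -> `|q.[x] - chi x| <= a) ->
    (forall x : R, `|x| <= Rad -> `|r.[x] - chi x| <= b) ->
    nrm (polop H q (dl n) - polop H r (dl n)) <= a + b.
  move=> a0 b0 qa rb; rewrite -polopB; apply: nrm_polop_delta; first exact: addr_ge0.
  move=> x xR; rewrite hornerD hornerN.
  have -> : q.[x] - r.[x] = (q.[x] - chi x) - (r.[x] - chi x) by ring.
  by apply: le_trans (ler_normB _ _) _; apply: lerD; [exact: qa | exact: rb].
have ld n := l2_delta R ((n, ord0) : Gam N).
have /choice[gam gamP] : forall n, exists g, l2 g /\ forall k, nrm (polop H (e_ k) (dl n) - g) <= u k.
  move=> n; have [] := @l2_complete _ _ (fun k => polop H (e_ k) (dl n)) u.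
  - by move=> k; exact: Hq_l2.
  - by move=> k l; apply: diff; [exact: ltW (u0 k) | exact: ltW (u0 l) | exact: eP | exact: eP].
  - exact: lim_u.
  by move=> g lg gP; exists g.
exists gam; split=> [n|n q e e0 qe]; first by case: (gamP n).
have [lg gP] := gamP n.
apply/ler_addgt0Pr => d d0.
have [k kP] : exists k, u k <= d / 2.
  have d2 : 0 < d / 2 by lra.
  have /cvgrPdist_le/(_ _ d2) [k _ kP] := lim_u.
  by exists k; have := kP k (leqnn k); rewrite /= sub0r normrN ger0_norm // ltW.
set f1 := polop H (e_ k) (dl n); set f2 := polop H q (dl n).
have -> : gam n - f2 = (gam n - f1) + (f1 - f2) by rewrite addrA subrK.
have lf1 : l2 f1 by exact: Hq_l2.
have lf2 : l2 f2 by exact: Hq_l2.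
apply: le_trans (nrmD (l2B lg lf1) (l2B lf1 lf2)) _.
have h1 : nrm (gam n - f1) <= u k by rewrite nrm_sub_sym; exact: gP.
have h2 : nrm (f1 - f2) <= u k + e by apply: diff; [exact: ltW (u0 k) | exact: e0 | exact: eP | exact: qe].
by clear -h1 h2 kP; lra.
Qed.

Variable gam : int -> Gam N -> R.
Hypothesis gamP : is_band_part gam.

(** Passage to the limit in [polop_delta], with polynomials r close to bump in
    place of the projection; r q r is close to (q bump) bump. *)
Lemma dot_band_part q n m :
  dot (polop H q (gam n)) (gam m) =
  avg (fun t => cos ((2 * (m - n))%:~R * t) * (q.[disp t] * omega t)).
Proof.
have [lg gP] := gamP.
have [C C0 qC] := horner_bounded q Rad.
have [M M0 qM] := polop_bound Hlin Hl2 (@nrm_Hreal R N v) q.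
have ld k := l2_delta R ((k, ord0) : Gam N).
set A := dot _ _; set B := avg _.
pose K := M * nrm (gam m) + 5 * C.
have K0 : 0 <= K by rewrite addr_ge0 ?mulr_ge0 ?nrm_ge0.
suff close e : 0 < e -> e <= 1 -> `|A - B| <= K * e.
  apply/eqP; rewrite -subr_eq0 -normr_le0; apply/ler_addgt0Pr => d d0.
  have e0 : 0 < Num.min 1 (d / (K + 1)).
    by rewrite lt_min ltr01 divr_gt0 // ltr_wpDl.
  have := close _ e0; rewrite ge_min lexx => /(_ isT) h; rewrite add0r; apply: le_trans h _.
  apply: (@le_trans _ _ (K * (d / (K + 1)))); first by rewrite ler_wpM2l // ge_min lexx orbT.
  rewrite mulrCA ler_piMr ?(ltW d0) // ler_pdivrMr ?ltr_wpDl // mul1r; lra.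
move=> e0 e1; have [r rP] := bump_approx e0.
have r2 (x : R) : `|x| <= Rad -> `|r.[x]| <= 2.
  move=> /rP h; have /andP[c0 c1] := bump_itv N x.
  have -> : r.[x] = (r.[x] - chi x) + chi x by ring.
  by apply: le_trans (ler_normD _ _) _; rewrite (ger0_norm c0); lra.
pose f := polop H q (gam n); pose f' := polop H q (polop H r (dl n)).
pose g' := polop H r (dl m).
have lg' : l2 g' by exact: Hq_l2.
have lf : l2 f by exact: Hq_l2.
have lf' : l2 f' by apply: Hq_l2; exact: Hq_l2.
have ff' : nrm (f - f') <= M * e.
  rewrite -polop_sub.
  apply: le_trans (qM _ (l2B (lg n) (Hq_l2 r (ld n)))) _; apply: ler_wpM2l => //.
  by apply: gP => //; exact: ltW.
have nf' : nrm f' <= 2 * C.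
  rewrite /f' -(polopM Hlin); apply: nrm_polop_delta; first by rewrite mulr_ge0.
  move=> x xR; rewrite hornerM mulrC; apply: normrM_le; [exact: r2 | exact: qC].
have gg' : nrm (gam m - g') <= e by apply: gP => //; exact: ltW.
have AA : `|A - dot f' g'| <= M * e * nrm (gam m) + 2 * C * e.
  apply: le_trans (dot_close lf lf' (lg m) lg') _; apply: lerD.
    by apply: ler_wpM2r => //; exact: nrm_ge0.
  by apply: ler_pM => //; exact: nrm_ge0.
have BB : `|dot f' g' - B| <= 3 * C * e.
  have -> : dot f' g' = avg (wave v (2 * (m - n)) (r * (q * r)) 0).
    rewrite /f' /g' -(polop_sym Hlin Hl2 Hsym r lf' (ld m)) -!(polopM Hlin) dot_polop_delta.
    by rewrite mulrA.
  apply: avg_close; first exact: continuous_wave.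
    move=> t; apply: cvgM; first exact: continuous_cosZ.
    apply: cvgM; last exact: continuous_omega.
    by apply: continuous_comp; [exact: continuous_disp | exact: continuous_horner].
  move=> t; rewrite /wave -mulrBr -[3 * C * e]mul1r; apply: normrM_le; first exact: cos_le1_norm.
  have := @omegaP t (fun x => q.[x] * chi x) (r * (q * r)) (3 * C * e).
  rewrite [chi (disp t)]bump1; last exact/lam_small/twice_cos_bound.
  rewrite mulr1; apply; first by rewrite !mulr_ge0 // ltW.
  move=> x xR; rewrite !hornerM.
  have -> : r.[x] * (q.[x] * r.[x]) - q.[x] * chi x * chi x =
      ((r.[x] - chi x) * q.[x]) * (r.[x] + chi x) by ring.
  have -> : 3 * C * e = e * C * 3 by ring.
  apply: normrM_le; first by apply: normrM_le; [exact: rP | exact: qC].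
  have /andP[c0 c1] := bump_itv N x; apply: le_trans (ler_normD _ _) _.
  by rewrite (ger0_norm c0); have := r2 x xR; lra.
have -> : A - B = (A - dot f' g') + (dot f' g' - B) by rewrite addrA subrK.
apply: le_trans (ler_normD _ _) _; apply: le_trans (lerD AA BB) _.
by rewrite /K le_eqVlt; apply/orP; left; apply/eqP; ring.
Qed.

End BandProjection.

(** * Combinations of band components *)


Section Trigonometry.
Variable R : realType.

Lemma chebyshev_exists (n : nat) : exists P U : {poly R}, forall x : R,
  cos (n%:R * x) = P.[cos x] /\ sin (n%:R * x) = U.[cos x] * sin x.
Proof.
elim: n => [|n [P [U IH]]].
  by exists 1, 0 => x; rewrite mul0r cos0 sin0 hornerC horner0 mul0r.
exists (P * 'X - U * (1 - 'X^2)), (U * 'X + P) => x; have [cE sE] := IH x.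
rewrite -natr1 mulrDl mul1r cosD sinD cE sE.
rewrite !(hornerD, hornerN, hornerM, hornerX, hornerXn, hornerC).
have -> : 1 - cos x * cos x = sin x * sin x by rewrite -(cos2Dsin2 x); ring.
by split; ring.
Qed.

(** A continuous function on [0,2] is a continuous function of L, because the
    inverse of L is continuous; apply the approximation theorem to it. *)
Lemma monotone_approx (h L : R -> R) (e : R) : continuous h -> continuous L ->
  (forall a b : R, 0 <= a -> a < b -> b <= 2 -> L a < L b) -> 0 < e ->
  exists r : {poly R}, forall a : R, 0 <= a <= 2 -> `|h a - r.[L a]| <= e.
Proof.
move=> ch cL Linc e0.
pose g (y : R) : R := xget 0 [set a : R | 0 <= a <= 2 /\ L a = y]%classic.
have gK (a : R) : 0 <= a <= 2 -> g (L a) = a.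
  move=> a02; rewrite /g; case: xgetP => [b _ [b02 Lb]|/(_ a)[]//].
  have /andP[a0 a2] := a02; have /andP[b0 b2] := b02.
  case: (ltgtP a b) => // ab.
    by have := Linc a b a0 ab b2; rewrite Lb ltxx.
  by have := Linc b a b0 ab a2; rewrite Lb ltxx.
have cg : ({within `[L 0, L 2], continuous g})%classic.
  apply: segment_can_le_continuous => //; first exact: continuous_subspaceT.
have chg : ({within `[L 0, L 2], continuous (h \o g)})%classic.
  move=> x; apply: (@continuous_comp _ _ _ (g : subspace `[L 0, L 2]%classic -> R) h x (cg x)).
  exact: ch.
have [r rP] := weierstrass (Linc _ _ (lexx 0) (ltr0n R 2) (lexx _)) chg e0.
exists r => a a02; have /andP[a0 a2] := a02.
have := rP (L a); rewrite /= gK //; apply; apply/andP; split.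
  by move: a0; rewrite le_eqVlt => /predU1P[<-//|a0]; apply/ltW/Linc.
by move: a2; rewrite le_eqVlt => /predU1P[->//|a2]; apply/ltW/Linc.
Qed.

End Trigonometry.

Section BandVectors.
Variables (R : realType) (N : nat) (v : 'rV[R]_(N.*2.+1)).
Local Notation p := (N.*2.+1).
Local Notation Rad := (spec_radius v).
Local Notation chi := (@bump R N).
Implicit Types (q r : {poly R}) (e : R) (m n : int).
Hypothesis lam_small : forall a, `|a| <= 2 -> `|lambda0 a v| <= gap R N / 2.
Variable omega : R -> R.
Hypothesis omega_ge0 : forall t, 0 <= omega t.
Hypothesis omegaP : forall t (psi : R -> R) q e, 0 <= e ->
  (forall x : R, `|x| <= Rad -> `|q.[x] - psi x * chi x| <= e) ->
  `|coord (fib v q t) 0 - psi (disp v t) * omega t| <= e.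
Variable gam : int -> Gam N -> R.
Hypothesis gamP : is_band_part v gam.

Local Notation H := (Hreal v).
Let Hlin : linear H := Hreal_linear v.
Let Hl2 := @Hreal_l2 R N v.
Let Hsym := @Hreal_sym R N v.
Let Hq_l2 q f : l2 f -> l2 (polop H q f) := @polop_l2 _ _ _ Hlin Hl2 q f.
Let gam_l2 n : l2 (gam n). Proof. by case: gamP. Qed.

Implicit Type s : seq ({poly R} * int).

(** The vector of the band that corresponds to the function
    sum of q_j(lambda(t)) exp(2 i n_j t), for s the list of the (q_j, n_j);
    cos_part and sin_part are its real and imaginary part. *)
Definition comb s : Gam N -> R := \sum_(x <- s) polop H x.1 (gam x.2).
Definition cos_part s (t : R) : R := \sum_(x <- s) x.1.[disp v t] * cos ((2 * x.2)%:~R * t).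
Definition sin_part s (t : R) : R := \sum_(x <- s) x.1.[disp v t] * sin ((2 * x.2)%:~R * t).

Lemma l2_0 : l2 (0 : Gam N -> R).
Proof. by rewrite -(subrr (gam 0)); apply: l2B. Qed.

Lemma comb_cons x s : comb (x :: s) = polop H x.1 (gam x.2) + comb s.
Proof. by rewrite /comb big_cons. Qed.

Lemma comb_l2 s : l2 (comb s).
Proof.
elim: s => [|x s IH]; first by rewrite /comb big_nil; exact: l2_0.
by rewrite comb_cons; apply: l2D => //; exact: Hq_l2.
Qed.

Lemma continuous_horner_disp q : continuous (fun t => q.[disp v t]).
Proof.
by move=> t; apply: (@continuous_comp _ _ _ (disp v) (fun x => q.[x]));
  [exact: continuous_disp | exact: continuous_horner].
Qed.

Lemma continuous_sinZ (c : R) : continuous (fun t : R => sin (c * t)).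
Proof.
move=> t; apply: continuous_comp; last exact: continuous_sin.
exact: mulrl_continuous.
Qed.

Lemma continuous_parts s : continuous (cos_part s) /\ continuous (sin_part s).
Proof.
rewrite /cos_part /sin_part; elim: s => [|x s [IHc IHs]].
  by split=> t; under eq_fun do rewrite big_nil; exact: cvg_cst.
split=> t; under eq_fun do rewrite big_cons.
  apply: cvgD; last exact: IHc.
  by apply: cvgM; [exact: continuous_horner_disp | exact: continuous_cosZ].
apply: cvgD; last exact: IHs.
by apply: cvgM; [exact: continuous_horner_disp | exact: continuous_sinZ].
Qed.

Let density s s' t := (cos_part s t * cos_part s' t + sin_part s t * sin_part s' t) * omega t.

Lemma continuous_density s s' : continuous (density s s').
Proof.
have [c1 c2] := continuous_parts s; have [c3 c4] := continuous_parts s'.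
move=> t; apply: cvgM; last exact: (continuous_omega omegaP).
by apply: cvgD; apply: cvgM; [exact: c1 | exact: c3 | exact: c2 | exact: c4].
Qed.

(** The map from functions of t to vectors of the band is an isometry. *)
Lemma dot_comb s s' : dot (comb s) (comb s') = avg (density s s').
Proof.
have base x y : dot (polop H x.1 (gam x.2)) (polop H y.1 (gam y.2)) = avg (density [:: x] [:: y]).
  rewrite -(polop_sym Hlin Hl2 Hsym _ (Hq_l2 x.1 (gam_l2 x.2)) (gam_l2 y.2)) -(polopM Hlin).
  rewrite (dot_band_part lam_small omegaP gamP); congr avg; apply: funext => t.
  rewrite /density /cos_part /sin_part !big_seq1 hornerM.
  have -> : (2 * (y.2 - x.2))%:~R * t = (2 * y.2)%:~R * t - (2 * x.2)%:~R * t.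
    by rewrite mulrBr intrB mulrBl.
  by rewrite cosB; ring.
have dens_consl x s1 s2 : density (x :: s1) s2 = fun t => density [:: x] s2 t + density s1 s2 t.
  by apply: funext => t; rewrite /density /cos_part /sin_part !big_seq1 !big_cons; ring.
have dens_consr x s1 s2 : density s2 (x :: s1) = fun t => density s2 [:: x] t + density s2 s1 t.
  by apply: funext => t; rewrite /density /cos_part /sin_part !big_seq1 !big_cons; ring.
have dens_nill s1 : density [::] s1 = fun=> 0.
  by apply: funext => t; rewrite /density /cos_part /sin_part !big_nil; ring.
have dens_nilr s1 : density s1 [::] = fun=> 0.
  by apply: funext => t; rewrite /density /cos_part /sin_part !big_nil; ring.
have dot0 (f : Gam N -> R) : l2 f -> dot 0 f = 0.
  by move=> lf; rewrite -[in LHS](subrr f) dotBl // subrr.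
have row x s2 : dot (polop H x.1 (gam x.2)) (comb s2) = avg (density [:: x] s2).
  elim: s2 => [|y s2 IH].
    by rewrite /comb big_nil dotC dens_nilr avg_cst dot0 //; exact: Hq_l2.
  rewrite comb_cons (dotDr (Hq_l2 y.1 (gam_l2 y.2)) (comb_l2 s2) (Hq_l2 x.1 (gam_l2 x.2))).
  by rewrite base IH (dens_consr y s2 [:: x]) (avgD (@continuous_density [:: x] [:: y]) (@continuous_density [:: x] s2)).
elim: s => [|x s IH].
  by rewrite /comb big_nil dens_nill avg_cst dot0 //; exact: comb_l2.
rewrite comb_cons (dotDl (Hq_l2 x.1 (gam_l2 x.2)) (comb_l2 s) (comb_l2 s')).
by rewrite row IH (dens_consl x s s') (avgD (@continuous_density [:: x] s') (@continuous_density s s')).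
Qed.

Lemma polop_comb q s : polop H q (comb s) = comb [seq (q * x.1, x.2) | x <- s].
Proof.
elim: s => [|x s IH]; first by rewrite /comb !big_nil; have := polop_sub v q 0 0; rewrite !subrr.
have polop_add f g : polop H q (f + g) = polop H q f + polop H q g.
  by have := polop_linear Hlin q 1 f g; rewrite !scale1r.
by rewrite /= !comb_cons polop_add IH (polopM Hlin).
Qed.

Lemma parts_scale q s t :
  cos_part [seq (q * x.1, x.2) | x <- s] t = q.[disp v t] * cos_part s t /\
  sin_part [seq (q * x.1, x.2) | x <- s] t = q.[disp v t] * sin_part s t.
Proof.
rewrite /cos_part /sin_part !big_map !mulr_sumr.
by split; apply: eq_bigr => x _; rewrite hornerM mulrA.
Qed.

Lemma nrm_comb_le s e : 0 <= e -> (forall t, `|cos_part s t| <= e) ->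
  (forall t, `|sin_part s t| <= e) -> nrm (comb s) <= 3 * e.
Proof.
move=> e0 ce se; rewrite -(@ler_pXn2r _ 2) ?nnegrE ?nrm_ge0 ?mulr_ge0 // nrm_sqr dot_comb.
apply: le_trans (ler_norm _) _.
have := @avg_close _ (density s s) (fun=> 0) ((3 * e) ^+ 2).
rewrite avg_cst subr0; apply; first exact: continuous_density.
  exact: cst_continuous.
move=> t; rewrite subr0 /density.
have h1 : cos_part s t ^+ 2 <= e ^+ 2.
  by rewrite -[cos_part s t ^+ 2](real_normK (num_real _)) lerXn2r // nnegrE.
have h2 : sin_part s t ^+ 2 <= e ^+ 2.
  by rewrite -[sin_part s t ^+ 2](real_normK (num_real _)) lerXn2r // nnegrE.
have := omega_le3 omegaP t; have := omega_ge0 t; move: h1 h2.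
move: (cos_part s t) (sin_part s t) (omega t) => c d w h1 h2 w0 w3.
have := sqr_ge0 c; have := sqr_ge0 d => d0 c0.
rewrite ger0_norm; last by rewrite mulr_ge0 // -!expr2 addr_ge0.
rewrite -!expr2; apply: (@le_trans _ _ ((e ^+ 2 + e ^+ 2) * 3)).
  by apply: ler_pM => //; [exact: addr_ge0 | exact: lerD].
by rewrite exprMn; have := sqr_ge0 e; lra.
Qed.

End BandVectors.

(** * Completeness of the two cyclic subspaces *)


Section Completeness.
Variables (R : realType) (N : nat) (v : 'rV[R]_(N.*2.+1)).
Local Notation p := (N.*2.+1).
Local Notation Rad := (spec_radius v).
Local Notation chi := (@bump R N).
Implicit Types (q r : {poly R}) (e : R) (m n : int) (f : Gam N -> R).
Hypothesis lam_small : forall a, `|a| <= 2 -> `|lambda0 a v| <= gap R N / 2.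
Hypothesis lam_inc : forall a b : R, 0 <= a -> a < b -> b <= 2 -> lambda0 a v < lambda0 b v.
Variable omega : R -> R.
Hypothesis omega_ge0 : forall t, 0 <= omega t.
Hypothesis omegaP : forall t (psi : R -> R) q e, 0 <= e ->
  (forall x : R, `|x| <= Rad -> `|q.[x] - psi x * chi x| <= e) ->
  `|coord (fib v q t) 0 - psi (disp v t) * omega t| <= e.
Variable gam : int -> Gam N -> R.
Hypothesis gamP : is_band_part v gam.

Local Notation H := (Hreal v).
Let Hlin : linear H := Hreal_linear v.
Let Hl2 := @Hreal_l2 R N v.
Let Hsym := @Hreal_sym R N v.
Let Hq_l2 q f : l2 f -> l2 (polop H q f) := @polop_l2 _ _ _ Hlin Hl2 q f.
Let gam_l2 n : l2 (gam n). Proof. by case: gamP. Qed.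

(** cos(2t) = a^2 / 2 - 1 with a = 2 cos t, and lambda is an increasing function of |a|. *)
Lemma band_poly_approx (P : {poly R}) e : 0 < e ->
  exists r, forall t, `|P.[cos (2 * t)] - r.[disp v t]| <= e.
Proof.
move=> e0; have [||r rP] := @monotone_approx R (fun a : R => P.[a ^+ 2 / 2 - 1]) (fun a => lambda0 a v) e _ _ lam_inc e0.
- move=> a; apply: (@continuous_comp R R R (fun a : R => a ^+ 2 / 2 - 1) (fun x : R => P.[x])).
    apply: cvgB; last exact: cvg_cst.
    by apply: cvgM; [exact: exprn_continuous | exact: cvg_cst].
  exact: continuous_horner.
- exact: lambda0_continuous.
exists r => t; have := rP `|2 * cos t|.
rewrite normr_ge0 twice_cos_bound lambda0_norm => /(_ isT).
have -> // : `|2 * cos t| ^+ 2 / 2 - 1 = cos (2 * t).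
have -> : 2 * t = t *+ 2 by rewrite mulr_natl.
by rewrite real_normK ?num_real // cos_mulr2n; field.
Qed.

(** gen0 and gen1 correspond to the functions 1 and 2 i sin(2t). *)
Definition gen0 : Gam N -> R := comb v gam [:: (1, 0)].
Definition gen1 : Gam N -> R := comb v gam [:: (1, 1); (-1, -1)].

Lemma orth_polop f g q : l2 f -> l2 g -> (forall k, dot f (iter k H g) = 0) ->
  dot f (polop H q g) = 0.
Proof.
move=> lf; elim/poly_ind: q g => [|q c IH] g lg fg.
  by rewrite -polyC0 polopC dotZr // mul0r.
rewrite polopD polopC (polopMX Hlin) (polop_X_comm Hlin).
rewrite dotDr //; [|exact: Hq_l2 (Hl2 lg) | exact: l2Z].
rewrite (dotZr c lg lf) (fg 0%N) mulr0 addr0; apply: IH; first exact: Hl2.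
by move=> k; rewrite -iterSr fg.
Qed.

Definition orthogonal_to_gens f := forall k, dot f (iter k H gen0) = 0 /\ dot f (iter k H gen1) = 0.

Lemma polop1 f : polop H 1 f = f.
Proof. by rewrite -polyC1 polopC scale1r. Qed.

Lemma comb1 q n : comb v gam [:: (q, n)] = polop H q (gam n).
Proof. by rewrite /comb big_seq1. Qed.

(** gam n is half the sum of gam n + gam (-n) and gam n - gam (-n). The former is
    the function 2 cos(2nt), a limit of polynomials of H applied to gen0, and the
    latter is 2 i sin(2nt), a limit of polynomials of H applied to gen1. *)
Lemma orth_gam f n : l2 f -> orthogonal_to_gens f -> dot f (gam n) = 0.
Proof.
move=> lf of0.
have o0 q : dot f (polop H q (gam 0)) = 0.
  rewrite -[gam 0]polop1 -comb1; apply: orth_polop => //; first exact: comb_l2.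
  by move=> k; case: (of0 k).
have o1 q : dot f (polop H q (gam 1)) = dot f (polop H q (gam (-1))).
  have : dot f (polop H q gen1) = 0.
    by apply: orth_polop => //; [exact: comb_l2 | move=> k; case: (of0 k)].
  rewrite polop_comb // /comb /= !big_cons big_nil addr0 /= mulr1 mulrN1.
  rewrite dotDr //; [|exact: Hq_l2 | exact: Hq_l2].
  by rewrite -scaleN1r polopZ (dotZr _ (Hq_l2 q (gam_l2 _)) lf) mulN1r => /subr0_eq.
have small (x : R) : (forall e, 0 < e -> `|x| <= nrm f * (6 * e)) -> x = 0.
  move=> xe; apply/eqP; rewrite -normr_le0; apply/ler_addgt0Pr => d d0.
  have nf := nrm_ge0 f.
  have e0 : 0 < d / (6 * (nrm f + 1)) by rewrite divr_gt0 // mulr_gt0 // ltr_wpDl.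
  rewrite add0r; apply: le_trans (xe _ e0) _.
  have -> : nrm f * (6 * (d / (6 * (nrm f + 1)))) = nrm f / (nrm f + 1) * d.
    by field; rewrite gt_eqF // ltr_wpDl.
  by rewrite ler_piMl ?(ltW d0) // ler_pdivrMr ?ltr_wpDl // mul1r; lra.
have comb_small s e : 0 <= e -> (forall t, `|cos_part v s t| <= 2 * e) ->
    (forall t, `|sin_part v s t| <= 2 * e) -> `|dot f (comb v gam s)| <= nrm f * (6 * e).
  move=> e0 ce se; apply: le_trans (cauchy_schwarz lf (comb_l2 gamP s)) _.
  apply: ler_wpM2l; first exact: nrm_ge0.
  apply: le_trans (nrm_comb_le lam_small omega_ge0 omegaP gamP _ ce se) _; lra.
have trig (k : nat) : dot f (gam k) = 0 /\ dot f (gam (- k%:Z)) = 0.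
  have [P [U PU]] := chebyshev_exists R k.
  have zE (t : R) : (2 * k%:Z)%:~R * t = k%:R * (2 * t) by rewrite intrM; ring.
  have zN (t : R) : (2 * - k%:Z)%:~R * t = - (k%:R * (2 * t)) by rewrite mulrN intrN mulNr zE.
  have two (t : R) : (2 * 1 : int)%:~R * t = 2 * t by rewrite mulr1.
  have twoN (t : R) : (2 * -1 : int)%:~R * t = - (2 * t) by rewrite mulrN1 intrN mulNr.
  have sum0 : dot f (gam k) + dot f (gam (- k%:Z)) = 0.
    apply: small => e e0; have [r rP] := band_poly_approx P e0.
    pose s : seq ({poly R} * int) := [:: (1, k%:Z); (1, - k%:Z); (- 2 *: r, 0)].
    have -> : dot f (gam k) + dot f (gam (- k%:Z)) = dot f (comb v gam s).
      rewrite /comb !big_cons big_nil /= addr0 !polop1.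
      rewrite (dotDr (gam_l2 _) (l2D (gam_l2 _) (Hq_l2 _ (gam_l2 _))) lf).
      by rewrite (dotDr (gam_l2 _) (Hq_l2 _ (gam_l2 _)) lf) o0 addr0.
    apply: comb_small => [|t|t]; first exact: ltW.
      rewrite /cos_part !big_cons big_nil /= zE zN cosN mul0r cos0 hornerZ hornerC.
      have [-> _] := PU (2 * t); have := rP t.
      have -> : 1 * P.[cos (2 * t)] + (1 * P.[cos (2 * t)] + (-2 * r.[disp v t] * 1 + 0))
        = 2 * (P.[cos (2 * t)] - r.[disp v t]) by ring.
      by move=> h; rewrite normrM ger0_norm // ler_wpM2l.
    rewrite /sin_part !big_cons big_nil /= zE zN sinN mul0r sin0 hornerC.
    have -> : 1 * sin (k%:R * (2 * t)) + (1 * - sin (k%:R * (2 * t)) +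
       ((-2 *: r).[disp v t] * 0 + 0)) = 0 by ring.
    by rewrite normr0 mulr_ge0 // ltW.
  have diff0 : dot f (gam k) - dot f (gam (- k%:Z)) = 0.
    apply: small => e e0; have [r rP] := band_poly_approx U e0.
    pose s : seq ({poly R} * int) := [:: (1, k%:Z); (-1, - k%:Z); (- r, 1); (r, -1)].
    have -> : dot f (gam k) - dot f (gam (- k%:Z)) = dot f (comb v gam s).
      rewrite /comb !big_cons big_nil /= addr0 !polop1.
      have lr n' := Hq_l2 r (gam_l2 n'); have lNr n' := Hq_l2 (- r) (gam_l2 n').
      have lN1 n' := Hq_l2 (-1) (gam_l2 n').
      have l1 := lN1 (- k%:Z); have l2' := lNr 1; have l3 := lr (-1).
      have l23 := l2D l2' l3; rewrite (dotDr (gam_l2 k) (l2D l1 l23) lf).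
      rewrite (dotDr l1 l23 lf) (dotDr l2' l3 lf).
      have N1 q n' : dot f (polop H (- q) (gam n')) = - dot f (polop H q (gam n')).
        by rewrite -scaleN1r polopZ (dotZr _ (Hq_l2 q (gam_l2 n')) lf) mulN1r.
      by rewrite !N1 polop1 o1 addNr addr0.
    apply: comb_small => [|t|t]; first exact: ltW.
      rewrite /cos_part !big_cons big_nil /= zE zN two twoN !cosN !(hornerN, hornerC).
      have -> : 1 * cos (k%:R * (2 * t)) + (-1 * cos (k%:R * (2 * t)) +
        (- r.[disp v t] * cos (2 * t) + (r.[disp v t] * cos (2 * t) + 0))) = 0.
        by ring.
      by rewrite normr0 mulr_ge0 // ltW.
    rewrite /sin_part !big_cons big_nil /= zE zN two twoN !sinN !(hornerN, hornerC).
    have [_ ->] := PU (2 * t); have := rP t.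
    set S := sin (2 * t).
    have -> : 1 * (U.[cos (2 * t)] * S) + (-1 * - (U.[cos (2 * t)] * S) +
        (- r.[disp v t] * S + (r.[disp v t] * - S + 0)))
       = (U.[cos (2 * t)] - r.[disp v t]) * S * 2 by ring.
    move=> h; rewrite [2 * e]mulrC; apply: normrM_le; last by rewrite ger0_norm.
    rewrite -[e]mulr1; apply: normrM_le => //.
    by rewrite ler_norml sin_geN1 sin_le1.
  by split; lra.
by case: n => k; [case: (trig k) | rewrite NegzE; case: (trig k.+1)].
Qed.

(** What membership in the spectral subspace of the band gives: functional
    calculus bounds that only see the values on the band. *)
Definition band_limited f := exists2 M : R, 0 <= M & forall q C, 0 <= C ->
  (forall x, sigma0 v x -> `|q.[x]| <= C) -> nrm (polop H q f) <= M * C.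

Lemma sigma0_small x : sigma0 v x -> `|x| <= gap R N / 2.
Proof.
move=> [a]; rewrite /= in_itv /= => /andP[a0 a2] <-.
by apply: lam_small; rewrite ger0_norm.
Qed.

Lemma gap_le1 : gap R N <= 1.
Proof.
by rewrite invf_le1 ?ltr_wpDr ?mulr_ge0 ?exprn_ge0 // lerDl mulr_ge0 // exprn_ge0.
Qed.

(** On the band q is close to 1, so f is close to q(H) f; at (n,1) the latter is
    the product of f with q(H) applied to the point mass, which is close to
    gam n, and gam n is orthogonal to f. *)
Lemma band_first_zero f n : l2 f -> band_limited f -> orthogonal_to_gens f -> f (n, ord0) = 0.
Proof.
move=> lf [M M0 fM] of0; have nf := nrm_ge0 f; have g1 := gap_le1; have g0 := gap_gt0 R N.
apply/eqP; rewrite -normr_le0; apply/ler_addgt0Pr => d d0; rewrite add0r.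
have K0 : 0 < M + nrm f + 1 by rewrite ltr_wpDl // addr_ge0.
set K := M + nrm f + 1 in K0.
have e0 : 0 < d / K by rewrite divr_gt0.
set e := d / K in e0.
have [q qP] := bump_approx v e0.
have ld := l2_delta R ((n, ord0) : Gam N).
have lq := Hq_l2 q ld.
have h1 : `|dot f (polop H q (delta R (n, ord0)))| <= nrm f * e.
  have -> : dot f (polop H q (delta R (n, ord0))) =
      - dot f (gam n - polop H q (delta R (n, ord0))).
    by rewrite (dotBr (gam_l2 n) lq lf) orth_gam // sub0r opprK.
  rewrite normrN; apply: le_trans (cauchy_schwarz lf (l2B (gam_l2 n) lq)) _.
  by apply: ler_wpM2l => //; case: gamP => _; apply => //; exact: ltW.
have h2 : `|(polop H (1 - q) f) (n, ord0)| <= M * e.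
  apply: le_trans (normr_le_nrm _ (Hq_l2 _ lf)) _.
  apply: fM; first exact: ltW.
  move=> x /sigma0_small xs; rewrite hornerD hornerN hornerC distrC.
  rewrite -(bump1 (N := N) (x := x)) //; apply: qP; apply: le_trans xs _.
  by rewrite /spec_radius; have := sqrtr_ge0 (\sum_i (v ord0 i) ^+ 2); rewrite -/(enorm v); lra.
have -> : f (n, ord0) = (polop H (1 - q) f) (n, ord0) + dot f (polop H q (delta R (n, ord0))).
  rewrite -(polop_sym Hlin Hl2 Hsym q lf ld) dot_delta polopB polop1.
  by rewrite addrfctE opprfctE subrK.
apply: le_trans (ler_normD _ _) _; apply: le_trans (lerD h2 h1) _.
rewrite -mulrDl /e mulrCA ler_piMr ?(ltW d0) // ler_pdivrMr // mul1r /K; lra.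
Qed.

Definition residual f := [/\ l2 f, band_limited f & orthogonal_to_gens f].

Lemma iter_polop k f : iter k H f = polop H 'X^k f.
Proof. by rewrite (polopXn Hlin). Qed.

Lemma residual_H f : residual f -> residual (H f).
Proof.
move=> [lf [M M0 fM] of0]; split; first exact: Hl2.
  exists M => // q C C0 qC; rewrite -(polop_X_comm Hlin) -(polopMX Hlin); apply: fM => // x xs.
  rewrite hornerM hornerX -[C]mulr1; apply: normrM_le; first exact: qC.
  by have := sigma0_small xs; have := gap_le1; have := gap_gt0 R N; lra.
have lg0 : l2 gen0 by exact: comb_l2.
have lg1 : l2 gen1 by exact: comb_l2.
have lit k g : l2 g -> l2 (iter k H g) by move=> lg; rewrite iter_polop; exact: Hq_l2.
move=> k; rewrite !Hsym //; try exact: lit.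
by have := of0 k.+1.
Qed.

Lemma l2_constant_zero f i : l2 f -> (forall n, `|f (n + 1, i)| = `|f (n, i)|) ->
  forall n, f (n, i) = 0.
Proof.
move=> lf fc n; set c : R := `|f (n, i)|.
have cE (k : nat) : `|f (n + k%:Z, i)| = c.
  elim: k => [|k IH]; first by rewrite addr0.
  have -> : n + k.+1%:Z = n + k%:Z + 1 by lia.
  by rewrite fc.
apply/normr0_eq0; rewrite -/c; apply/eqP; rewrite eq_le normr_ge0 andbT.
have c0 : 0 <= c by exact: normr_ge0.
have bound (k : nat) : k%:R * c ^+ 2 <= nrm f ^+ 2.
  have := @sum_sqr_le _ _ f [seq (n + (j%:Z), i) | j <- iota 0 k] lf.
  rewrite map_inj_uniq ?iota_uniq; last by move=> j j' [] /addrI [].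
  move=> /(_ isT); rewrite big_map (eq_bigr (fun=> c ^+ 2)).
    by rewrite big_const_seq count_predT size_iota iter_addr addr0 mulr_natl.
  by move=> j _; rewrite -(cE j) real_normK // num_real.
rewrite leNgt; apply/negP => cgt.
have c2 : 0 < c ^+ 2 by rewrite exprn_gt0.
have := bound (Num.truncn (nrm f ^+ 2 / c ^+ 2)).+1.
by rewrite -ler_pdivlMr // leNgt truncnS_gt.
Qed.

(** If f vanishes in the rows up to k, then so does H f, and row k of the equation
    involves row k+1 only: directly when one term remains, and as
    f(n-1,k+1) + f(n,k+1) = 0 when there are two. *)
Lemma residual_zero f : residual f -> f = 0.
Proof.
move=> rf.
have claim (k : nat) : forall g, residual g -> forall n (j : 'I_p), (j <= k)%N -> g (n, j) = 0.
  elim: k => [|k IH] g rg n j; rewrite ?leqn0.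
    move=> /eqP j0; have -> : j = ord0 by apply: val_inj.
    by case: rg => lg bg og; exact: band_first_zero.
  rewrite leq_eqVlt => /predU1P[jk|]; last by rewrite ltnS; exact: IH.
  have lg : l2 g by case: rg.
  have kp : (k < p)%N by rewrite -ltnS -jk ltnS ltnW.
  pose i : 'I_p := Ordinal kp.
  have low n' (j' : nat) : (j' <= k)%N -> site g n' j'.+1 = 0.
    move=> j'k; have j'p : (j' < p)%N by exact: leq_ltn_trans j'k kp.
    by rewrite /site (insubT (fun k => (k < p)%N) j'p) /=; exact: IH.
  have low0 n' : site g n' k = 0 by case: (k) low => [|k'] low //; rewrite low.
  have high n' : site g n' k.+2 = g (n', j).
    rewrite /site -jk (insubT (fun k => (k < p)%N) (ltn_ord j)) /=.
    by congr (g (_, _)); apply: val_inj.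
  have row n' : (if odd k then 0 else g (n' - 1, j)) + g (n', j) = 0.
    have := IH _ (residual_H rg) n' i (leqnn k).
    rewrite /Hreal /= (IH g rg n' i (leqnn k)) mulr0 addr0 low0 add0r !high addrC.
    by case: (odd k) => //; case: (k) low => [|k'] low; rewrite ?low.
  have [ok|ek] := boolP (odd k); first by have := row n; rewrite ok add0r.
  apply: (l2_constant_zero lg) => n'.
  have := row (n' + 1); rewrite (negbTE ek) addrK => /eqP.
  by rewrite addr_eq0 => /eqP ->; rewrite normrN.
by apply: funext => -[n j]; rewrite (claim p _ rf) // ltnW.
Qed.

End Completeness.

(** * Complex families and moments *)

Section ComplexFamilies.
Local Open Scope complex_scope.
Variables (R : realType) (I : choiceType).
Implicit Types (f : I -> R[i]) (g : I -> R).

Definition re_part f : I -> R := fun x => complex.Re (f x).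
Definition im_part f : I -> R := fun x => complex.Im (f x).
Definition embed g : I -> R[i] := fun x => (g x)%:C.

Lemma ell2_parts f : ell2 f -> l2 (re_part f) /\ l2 (im_part f).
Proof.
move=> lf; have sb : sumfin (fun x => re_part f x ^+ 2 + im_part f x ^+ 2).
  move: lf; rewrite /ell2 /sumfin; congr (_ < _)%E; apply: eq_esum => x _ /=.
  by rewrite ger0_norm // addr_ge0 ?sqr_ge0.
have nE x : `|re_part f x ^+ 2 + im_part f x ^+ 2| = re_part f x ^+ 2 + im_part f x ^+ 2.
  by rewrite ger0_norm // addr_ge0 ?sqr_ge0.
split; apply: (es_le_sumfin sb) => x.
- by rewrite nE ger0_norm ?sqr_ge0 // lerDl sqr_ge0.
- by rewrite nE ger0_norm ?sqr_ge0 // lerDr sqr_ge0.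
Qed.

Lemma ell2_embed g : l2 g -> ell2 (embed g).
Proof.
rewrite /ell2 /l2 /sumfin; congr (_ < _)%E; apply: eq_esum => x _ /=.
by rewrite expr0n /= addr0 ger0_norm ?sqr_ge0.
Qed.

Lemma ip_embed f g : ip f (embed g) = dot (re_part f) g +i* dot (im_part f) g.
Proof.
rewrite /ip /dot; congr (_ +i* _); congr rsum; apply: funext => x;
  rewrite /re_part /im_part /embed; case: (f x) => a b /=; ring.
Qed.

(** For a complex family f the spectral moments are the sums of those of its
    real and its imaginary part. *)
Lemma Re_ip f f' : l2 (re_part f) -> l2 (im_part f) -> l2 (re_part f') -> l2 (im_part f') ->
  complex.Re (ip f f') = dot (re_part f) (re_part f') + dot (im_part f) (im_part f').
Proof.
move=> l1 l2' l3 l4; rewrite /dot -rsumD; [|exact: sumfinM|exact: sumfinM].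
rewrite /ip /=; congr rsum; apply: funext => x.
by rewrite /re_part /im_part; case: (f x) (f' x) => a b [c d] /=; ring.
Qed.

End ComplexFamilies.

Section CompactMoments.
Variables (R : realType) (mu : {finite_measure set (measurableTypeR R) -> \bar R}).
Implicit Types q r : {poly R}.

Lemma eq_poly_functional (A B : {poly R} -> R) :
  (forall q r, A (q + r) = A q + A r) -> (forall c q, A (c *: q) = c * A q) ->
  (forall q r, B (q + r) = B q + B r) -> (forall c q, B (c *: q) = c * B q) ->
  (forall j, A 'X^j = B 'X^j) -> A =1 B.
Proof.
move=> AD AZ BD BZ AB q.
have A0 : A 0 = 0 by rewrite -(scale0r 0) AZ mul0r.
have B0 : B 0 = 0 by rewrite -(scale0r 0) BZ mul0r.
rewrite -[q]coefK poly_def; elim: (size q) => [|n IH]; first by rewrite !big_ord0 A0 B0.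
by rewrite !big_ord_recr /= AD BD AZ BZ AB IH.
Qed.

Variable M : R.
Hypothesis muM : mu (~` `[- M, M])%classic = 0%E.

Lemma horner_integrable q : mu.-integrable setT (fun x => (q.[x])%:E).
Proof.
have mI : measurable (`[- M, M]%classic : set (measurableTypeR R)) by exact: measurable_itv.
have mq : measurable_fun (setT : set (measurableTypeR R)) (fun x : R => q.[x]).
  by apply: continuous_measurable_fun; exact: continuous_horner.
apply/(@negligible_integrable _ _ _ mu setT (~` `[- M, M])%classic) => //.
- exact: measurableC.
- exact/measurable_EFinP.
rewrite setTD setCK; have [C C0 qC] := horner_bounded q M.
apply: (@measurable_bounded_integrable _ _ _ mu (fun x => q.[x])) => //.
- by rewrite ltey_eq fin_num_measure.
- exact: measurable_funTS.
- exists C; split; first by rewrite num_real.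
  move=> x Cx t /=; rewrite in_itv /= => tM; apply: le_trans (qC _ _) (ltW Cx).
  by rewrite ler_norml.
Qed.

Definition moment q : R := \int[mu]_x q.[x].

Lemma momentD q r : moment (q + r) = moment q + moment r.
Proof.
rewrite /moment -RintegralD //; [|exact: horner_integrable|exact: horner_integrable].
by congr Rintegral; apply: funext => x; rewrite hornerD.
Qed.

Lemma momentZ c q : moment (c *: q) = c * moment q.
Proof.
rewrite /moment -RintegralZl //; last exact: horner_integrable.
by congr Rintegral; apply: funext => x; rewrite hornerZ.
Qed.

(** The bound on S suffices because the complement of S is a null set. *)
Lemma moment_le (S : set R) q C : measurable (S : set (measurableTypeR R)) -> mu (~` S)%classic = 0%E ->
  (forall x, S x -> q.[x] <= C) -> moment q <= C * fine (mu setT).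
Proof.
move=> mS muS qC.
have -> : C * fine (mu setT) = \int[mu]_x C.
  by rewrite Rintegral_cst //.
rewrite /moment /Rintegral.
have mq := measurable_int _ (horner_integrable q).
have intC : mu.-integrable setT (fun _ : measurableTypeR R => C%:E).
  by have := horner_integrable C%:P; under eq_fun do rewrite hornerC.
have mC : measurable (~` S : set (measurableTypeR R))%classic by exact: measurableC.
have toS f : mu.-integrable setT f -> (\int[mu]_x f x = \int[mu]_(x in S) f x)%E.
  by move=> fi; rewrite (negligible_integral mC measurableT fi muS) setTD setCK.
rewrite (toS _ (horner_integrable q)) (toS _ intC).
apply: (@le_Rintegral _ _ _ mu S (fun x => q.[x]) (fun=> C)) => //.
- exact: integrableS (horner_integrable q).
- exact: integrableS intC.
Qed.

End CompactMoments.

(** * Multiplicity of the band *)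

Section RealFacts.
Variable R : realType.

Lemma cos_onto (a : R) : 0 <= a <= 2 -> exists2 t : R, 0 <= t <= pi & 2 * cos t = a.
Proof.
move=> /andP[a0 a2]; have ac : -1 <= a / 2 <= 1 by apply/andP; split; lra.
exists (acos (a / 2)); first by rewrite acos_ge0 // acos_lepi.
by rewrite acosK ?in_itv //=; field.
Qed.

Lemma subinterval_near (t d b : R) : 0 < d -> 0 < b -> 0 <= t <= b ->
  exists c c' : R, c < c' /\ forall s, c <= s <= c' -> 0 <= s <= b /\ `|t - s| < d.
Proof.
move=> d0 b0 /andP[t0 tb].
exists (Num.max 0 (t - d / 2)), (Num.min b (t + d / 2)).
split; first by rewrite gt_max !lt_min; apply/andP; split; apply/andP; split; lra.
move=> s; rewrite ge_max le_min => /andP[/andP[h1 h2] /andP[h3 h4]].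
by rewrite h1 h3 ltr_norml; split=> //; apply/andP; split; lra.
Qed.

End RealFacts.

Section Multiplicity.
Local Open Scope complex_scope.
Variables (R : realType) (N : nat) (v : 'rV[R]_(N.*2.+1)).
Local Notation p := (N.*2.+1).
Local Notation Rad := (spec_radius v).
Local Notation chi := (@bump R N).
Local Notation leb := (@lebesgue_measure R).
Local Notation S := (sigma0 v).
Implicit Types (q r : {poly R}) (e : R) (f : Gam N -> R).
Hypothesis vr : enorm v <= small_radius R N.
Hypothesis lam_small : forall a, `|a| <= 2 -> `|lambda0 a v| <= gap R N / 2.
Hypothesis lam_inc : forall a b : R, 0 <= a -> a < b -> b <= 2 -> lambda0 a v < lambda0 b v.

Local Notation H := (Hreal v).
Let Hlin : linear H := Hreal_linear v.
Let Hl2 := @Hreal_l2 R N v.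
Let Hsym := @Hreal_sym R N v.
Let Hq_l2 q f : l2 f -> l2 (polop H q f) := @polop_l2 _ _ _ Hlin Hl2 q f.

Lemma sigma0_segment : S = `[lambda0 0 v, lambda0 2 v]%classic.
Proof.
have le_inc (a b : R) : 0 <= a -> a <= b -> b <= 2 -> lambda0 a v <= lambda0 b v.
  by move=> a0; rewrite le_eqVlt => /predU1P[->//|ab] b2; apply/ltW/lam_inc.
have le02 : lambda0 0 v <= lambda0 2 v by exact: le_inc (lexx 0) (ler0n R 2) (lexx 2).
apply/seteqP; split=> x.
  move=> [a]; rewrite /= !in_itv /= => /andP[a0 a2] <-.
  by apply/andP; split; [exact: le_inc (lexx 0) a0 a2 | exact: le_inc a0 a2 (lexx 2)].
rewrite /= in_itv /= => xI.
have [] := @IVT R (fun a => lambda0 a v) 0 2 x (ler0n R 2).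
- by apply: continuous_subspaceT; exact: lambda0_continuous.
- by rewrite (min_l le02) (max_r le02).
by move=> c c02 <-; exists c.
Qed.

Lemma measurable_sigma0 : measurable (S : set (measurableTypeR R)).
Proof. by rewrite sigma0_segment; exact: measurable_itv. Qed.

Lemma disp_sigma0 t : S (disp v t).
Proof.
exists `|2 * cos t|; last by rewrite lambda0_norm.
by rewrite /= in_itv /= normr_ge0 twice_cos_bound.
Qed.

Lemma disp_bound t : `|disp v t| <= gap R N / 2.
Proof. exact/lam_small/twice_cos_bound. Qed.

Lemma iter_Hop_embed k f : iter k (Hop v) (embed f) = embed (iter k H f).
Proof.
apply: funext => x; apply/eqP; rewrite eq_complex; apply/andP; split; apply/eqP.
  by have := congr1 (fun h => h x) (iter_Hop_Re v k (embed f)).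
have := congr1 (fun h => h x) (iter_Hop_Im v k (embed f)) => /= ->.
have -> : (fun y => complex.Im (embed f y)) = 0 :> (Gam N -> R) by apply: funext.
elim: k x => [|k IH] x //=; have -> : iter k H 0 = 0 by apply: funext => y; rewrite IH.
by rewrite (op0 Hlin).
Qed.

(** The square of the norm of q(H) f is the integral of q^2 against the spectral
    measure of f, which is carried by the band. *)
Lemma spectral_subspace_band (f : Gam N -> R[i]) : spectral_subspace (Hop v) S f ->
  [/\ l2 (re_part f), l2 (im_part f), band_limited v (re_part f) & band_limited v (im_part f)].
Proof.
move=> [/ell2_parts[l1 l2'] [mu [[M muM] mom] muS]].
set f1 := re_part f in l1 *; set f2 := im_part f in l2' *.
pose A q := dot (polop H q f1) f1 + dot (polop H q f2) f2.
have AE q : A q = moment mu q.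
  apply: (@eq_poly_functional _ A (moment mu)) => [q1 r|c q1|||j].
  - by rewrite /A !polopD !dotDl //; try exact: Hq_l2; ring.
  - by rewrite /A !polopZ !dotZl //; try exact: Hq_l2; ring.
  - exact: (momentD muM).
  - exact: (momentZ muM).
  have lit k g : l2 g -> l2 (iter k H g) by move=> lg; rewrite iter_polop; exact: Hq_l2.
  have reE : re_part (iter j (Hop v) f) = iter j H f1 by exact: iter_Hop_Re.
  have imE : im_part (iter j (Hop v) f) = iter j H f2 by exact: iter_Hop_Im.
  have := congr1 (@complex.Re R) (mom j); rewrite Re_ip ?reE ?imE //; try exact: lit.
  rewrite /A !(polopXn Hlin) => ->; rewrite /moment /=.
  by congr Rintegral; apply: funext => t; rewrite hornerXn.
pose K : R := Num.sqrt (fine (mu setT)).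
have K2 : K ^+ 2 = fine (mu setT) by rewrite sqr_sqrtr // fine_ge0.
have qq q g : l2 g -> dot (polop H (q * q) g) g = nrm (polop H q g) ^+ 2.
  move=> lg; rewrite nrm_sqr (polopM Hlin).
  by rewrite (polop_sym Hlin Hl2 Hsym q (Hq_l2 q lg) lg).
have bound q C : 0 <= C -> (forall x, S x -> `|q.[x]| <= C) ->
    nrm (polop H q f1) ^+ 2 + nrm (polop H q f2) ^+ 2 <= (K * C) ^+ 2.
  move=> C0 qC; rewrite -!qq // -/(A (q * q)) AE exprMn K2 [X in _ <= X]mulrC.
  apply: (moment_le muM measurable_sigma0 muS) => x xS.
  by rewrite hornerM -expr2 -(real_normK (num_real _)) lerXn2r ?nnegrE ?qC.
have K0 : 0 <= K by exact: sqrtr_ge0.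
split=> //; exists K => // q C C0 qC; have KC := bound q C C0 qC.
- rewrite -(@ler_pXn2r _ 2) ?nnegrE ?nrm_ge0 ?mulr_ge0 //.
  by apply: le_trans KC; rewrite lerDl sqr_ge0.
- rewrite -(@ler_pXn2r _ 2) ?nnegrE ?nrm_ge0 ?mulr_ge0 //.
  by apply: le_trans KC; rewrite lerDr sqr_ge0.
Qed.

Lemma disp_preimage_support (A : set R) (rho : R -> R)
  (mu : {finite_measure set (measurableTypeR R) -> \bar R}) :
  (forall A, measurable A ->
    mu A = \int[leb]_(t in (`[0%R, pi] `&` disp v @^-1` A)%classic) (rho t / pi)%:E)%E ->
  measurable (A : set (measurableTypeR R)) -> (forall t, ~ A (disp v t)) -> mu A = 0%E.
Proof.
move=> muE mA noA; rewrite muE // (_ : (_ `&` _)%classic = set0) ?integral_set0 //.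
by apply/seteqP; split=> t // [_ /noA].
Qed.

Lemma measurable_preimage_disp (A : set (measurableTypeR R)) : measurable A ->
  measurable (`[0%R, pi] `&` disp v @^-1` A : set (measurableTypeR R))%classic.
Proof.
move=> mA; apply: measurableI; first exact: measurable_itv.
rewrite -[X in measurable X]setTI.
have mS : @measurable_fun _ _ (measurableTypeR R) (measurableTypeR R) setT (disp v).
  by apply: continuous_measurable_fun; exact: continuous_disp.
exact: mS.
Qed.

Lemma measurable_near (t e : R) :
  measurable ([set s : R | (t - e < s < t + e)%R]%classic : set (measurableTypeR R)).
Proof.
rewrite (_ : [set s | _]%classic = `]t - e, t + e[%classic); first exact: measurable_itv.
by apply/seteqP; split=> s; rewrite /= in_itv.
Qed.

(** Every point of the band is a value of the continuous function lambda(t), so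
    the neighbourhoods of the point have preimages that contain intervals. *)
Lemma disp_open_measure (t e : R) : S t -> 0 < e ->
  leb (`[0%R, pi] `&` disp v @^-1` [set s : R | (t - e < s < t + e)%R])%classic != 0%E.
Proof.
move=> [a]; rewrite /= in_itv /= => a02 <- {t} e0.
have [t0 t0pi ct0] := cos_onto a02.
have dt0 : disp v t0 = lambda0 a v by rewrite /disp ct0.
have /cvgrPdist_lt/(_ _ e0)/nbhs_ballP[d /= d0 dP] := @continuous_disp R N v t0.
have [c [c' [cc' cP]]] := subinterval_near d0 (pi_gt0 R) t0pi.
apply/negP => /eqP E0.
have : (leb `[c, c']%classic <= 0)%E.
  rewrite -E0; apply: le_measure.
  - by apply/mem_set; exact: measurable_itv.
  - by apply/mem_set; apply: measurable_preimage_disp; exact: measurable_near.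
  move=> s; rewrite /= !in_itv /= => /cP[s0pi t0s]; split=> //.
  by have := dP s t0s; rewrite dt0 ltr_distlC.
by rewrite lebesgue_measure_itv /= lte_fin cc' -EFinD lee_fin subr_le0 leNgt cc'.
Qed.

(** The cyclic subspaces are orthogonal because one consists of real and the other
    of purely imaginary functions of t. The spectral densities omega and
    (2 sin(2t))^2 omega vanish on ]0,pi[ at most where cos t = 0, so both measures
    have the null sets of the image of the Lebesgue measure. *)
Lemma multiplicity_two : spectrum_has_multiplicity (Hop v) S 2.
Proof.
have [omega om] := band_weight_exists vr lam_small.
have om0 t : 0 <= omega t by case: (om t).
have ompos t : cos t != 0 -> 0 < omega t by case: (om t).
have omP t (psi : R -> R) q e : 0 <= e ->
    (forall x : R, `|x| <= Rad -> `|q.[x] - psi x * chi x| <= e) ->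
    `|coord (fib v q t) 0 - psi (disp v t) * omega t| <= e.
  by case: (om t) => _ _; apply.
have com : continuous omega by exact: continuous_omega omP.
have [gam gamP] := band_part_exists omP.
pose sg (i : 'I_2) : seq ({poly R} * int) := if i == ord0 then [:: (1, 0)] else [:: (1, 1); (-1, -1)].
pose gen i := comb v gam (sg i).
pose rho (i : 'I_2) (t : R) : R := (if i == ord0 then 1 else (2 * sin (2 * t)) ^+ 2) * omega t.
have lgen i : l2 (gen i) by exact: comb_l2.
have two (t : R) : (2 * 1 : int)%:~R * t = 2 * t by rewrite mulr1.
have twoN (t : R) : (2 * -1 : int)%:~R * t = - (2 * t) by rewrite mulrN1 intrN mulNr.
have parts0 t : cos_part v (sg ord0) t = 1 /\ sin_part v (sg ord0) t = 0.
  rewrite /cos_part /sin_part /sg eqxx !big_seq1 /= mulr0 mul0r cos0 sin0 hornerC.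
  by rewrite mulr1 mulr0.
have parts1 i t : i != ord0 -> cos_part v (sg i) t = 0 /\ sin_part v (sg i) t = 2 * sin (2 * t).
  move=> i0; rewrite /cos_part /sin_part /sg (negbTE i0) !big_cons !big_nil /=.
  by rewrite two twoN cosN sinN !(hornerN, hornerC); split; ring.
have rhoE i t : (cos_part v (sg i) t * cos_part v (sg i) t +
    sin_part v (sg i) t * sin_part v (sg i) t) * omega t = rho i t.
  rewrite /rho; have [->|i0] := eqVneq i ord0.
    by have [-> ->] := parts0 t; ring.
  by have [-> ->] := parts1 i t i0; ring.
have crho i : continuous (rho i).
  move=> t; apply: cvgM; last exact: com.
  case: (i == ord0); first exact: cvg_cst.
  have cs : continuous (fun t : R => 2 * sin (2 * t)).
    by move=> u; apply: cvgM; [exact: cvg_cst | exact: continuous_sinZ].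
  by under eq_fun do rewrite expr2; apply: cvgM; exact: cs.
have rho0 i t : 0 <= rho i t.
  by rewrite mulr_ge0 //; case: ifP => // _; exact: sqr_ge0.
have rho_pos i t : 0 < t < pi -> cos t != 0 -> 0 < rho i t.
  move=> tpi ct; rewrite mulr_gt0 ?ompos //; case: ifP => // _.
  rewrite exprn_even_gt0 //= mulf_neq0 ?pnatr_eq0 //.
  have -> : 2 * t = t *+ 2 by rewrite mulr_natl.
  by rewrite sin_mulr2n mulrn_eq0 /= mulf_neq0 // gt_eqF // sin_gt0_pi.
have dispB := disp_bound.
have /choice[mu muP] : forall i : 'I_2, exists mu : {finite_measure set (measurableTypeR R) -> \bar R},
    (forall A, measurable A ->
       mu A = \int[leb]_(t in (`[0%R, pi] `&` disp v @^-1` A)%classic) (rho i t / pi)%:E)%E /\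
    forall q, \int[mu]_x q.[x] = avg (fun t => q.[disp v t] * rho i t).
  by move=> i; apply: weighted_pushforward (crho i) (rho0 i); [exact: continuous_disp | exact: dispB].
have muE i := (muP i).1; have muI i := (muP i).2.
have mu0 i (A : set (measurableTypeR R)) : measurable A ->
    mu i A = 0%E <-> leb (`[0%R, pi] `&` disp v @^-1` A)%classic = 0%E.
  move=> mA; rewrite muE //; apply: weighted_null (crho i) (rho0 i) (rho_pos i).
    exact: measurable_preimage_disp.
  by move=> t [].
have dot_gen i j q r : dot (polop H q (gen i)) (polop H r (gen j)) =
    avg (fun t => (q * r).[disp v t] * ((cos_part v (sg i) t * cos_part v (sg j) t +
      sin_part v (sg i) t * sin_part v (sg j) t) * omega t)).
  rewrite /gen !polop_comb // (dot_comb lam_small omP gamP); congr avg; apply: funext => t.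
  have [-> ->] := parts_scale v q (sg i) t; have [-> ->] := parts_scale v r (sg j) t.
  by rewrite hornerM; ring.
have ipE i j k l : ip (iter k (Hop v) (embed (gen i))) (iter l (Hop v) (embed (gen j))) =
    (dot (polop H 'X^k (gen i)) (polop H 'X^l (gen j)))%:C.
  rewrite !iter_Hop_embed ip_embed !iter_polop; congr (_ +i* _).
  have -> : im_part (embed (polop H 'X^k (gen i))) = 0 by apply: funext.
  rewrite -[X in dot X _](subrr (gen i)) dotBl ?subrr //; exact: Hq_l2.
exists (fun i => embed (gen i)), mu; split.
- move=> i; split; first exact/ell2_embed/lgen.
    split.
      exists (gap R N / 2); apply: (disp_preimage_support (muE i)).
        by apply: measurableC; exact: measurable_itv.
      by move=> t /=; rewrite in_itv /= -ler_norml; apply.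
    move=> j; rewrite (ipE i i j 0%N) expr0; congr (_ %:C).
    rewrite dot_gen mulr1.
    under eq_fun do rewrite rhoE.
    by rewrite -muI; congr Rintegral; apply: funext => t; rewrite hornerXn.
  apply: (disp_preimage_support (muE i)); first by apply: measurableC; exact: measurable_sigma0.
  by move=> t; apply; exact: disp_sigma0.
- by move=> i j A mA /(mu0 i _ mA) /(mu0 j _ mA).
- move=> i t e St e0; rewrite lt0e measure_ge0 andbT; apply/eqP => /mu0.
  by move=> /(_ (measurable_near t e)) /eqP; apply/negP/disp_open_measure.
- move=> i j ij k l; rewrite ipE dot_gen.
  suff -> : (fun t : R => ('X^k * 'X^l).[disp v t] * ((cos_part v (sg i) t * cos_part v (sg j) t +
      sin_part v (sg i) t * sin_part v (sg j) t) * omega t)) = fun=> 0.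
    by rewrite avg_cst.
  apply: funext => t; have [i0|i0] := eqVneq i ord0.
    have j0 : j != ord0 by rewrite -i0 eq_sym.
    by rewrite i0; have [-> ->] := parts0 t; have [-> ->] := parts1 j t j0; ring.
  have [-> ->] := parts1 i t i0.
  have j0 : j = ord0.
    by move: i0 ij; case: i => [[|[|?]] ?] //; case: j => [[|[|?]] ?] // _ _; apply: val_inj.
  by rewrite j0; have [-> ->] := parts0 t; ring.
- move=> f /spectral_subspace_band[l1 l2' b1 b2] orth.
  have orth' i k : dot (re_part f) (iter k H (gen i)) = 0 /\ dot (im_part f) (iter k H (gen i)) = 0.
    by have := orth i k; rewrite iter_Hop_embed ip_embed => -[-> ->].
  have z1 : re_part f = 0.
    apply: (residual_zero lam_small lam_inc om0 omP gamP); split=> // k.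
    by split; [case: (orth' ord0 k) | case: (orth' ord_max k)].
  have z2 : im_part f = 0.
    apply: (residual_zero lam_small lam_inc om0 omP gamP); split=> // k.
    by split; [case: (orth' ord0 k) | case: (orth' ord_max k)].
  apply: funext => x; apply/eqP; rewrite eq_complex; apply/andP; split; apply/eqP.
    exact: (congr1 (fun h => h x) z1).
  exact: (congr1 (fun h => h x) z2).
Qed.

End Multiplicity.

(** * Band edges, monotonicity and multiplicity for small potentials *)

Section BandRadius.
Variables (R : realType) (N : nat).

(** |F| is at most the norm of v, and the quadratic error is smaller. *)
Lemma lambda0_le_gap (v : 'rV[R]_(N.*2.+1)) : enorm v <= small_radius R N ->
  enorm v <= gap R N / 4 -> forall a, `|a| <= 2 -> `|lambda0 a v| <= gap R N / 2.
Proof.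
move=> vr vg a a2; rewrite -lambda0_norm.
have e0 : 0 <= enorm v by exact: sqrtr_ge0.
have vk k : `|coord v k.*2| <= enorm v by exact: coord_le_enorm.
have [close _ _] := lambda0_uniform vk vr vr.
have := close `|a|; rewrite normr_ge0 a2 => /(_ isT) h1.
have h2 := F_bound `|a| vk; have g1 := gap_le1 R N; have g0 := gap_gt0 R N.
move: (enorm v) (gap R N) (lambda0 _ _) (F _ _) h1 h2 vg e0 g1 g0 => e g l f h1 h2 eg e0 g1 g0.
have -> : l = (l - f) + f by rewrite subrK.
apply: le_trans (ler_normD _ _) _; nra.
Qed.

End BandRadius.

Local Open Scope classical_set_scope.
Local Open Scope ring_scope.

Theorem theorem1p5 (R : realType) (N : nat) (hN : (1 <= N)%N) :
  (* i) *)
  (exists K d : R, 0 < d /\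
     forall v : 'rV[R]_(N.*2.+1), enorm v < d ->
       [/\ forall a : R, 0 <= a <= 2 ->
             `|lambda0 a v - F a v| <= K * enorm v ^+ 2,
           `|lambda0m v - inf [set F a v | a in `[0, 2]]| <= K * enorm v ^+ 2
         & `|lambda0p v - sup [set F a v | a in `[0, 2]]| <= K * enorm v ^+ 2])
  /\
  (* ii) *)
  (exists K d : R, 0 < d /\
     forall v : 'rV[R]_(N.*2.+1), odd_entries_increasing v -> enorm v < d ->
       `|lambda0m v| <= K * entry v N.*2.+1 ^+ 2 /\
       `|lambda0p v - 3 / (4 ^+ N.+1 - 1) *
           \sum_(1 <= k < N.+1) 4 ^+ k * entry v k.*2.+1|
         <= K * entry v N.*2.+1 ^+ 2)
  /\
  (forall C : R, 0 < C ->
     exists d : R, 0 < d /\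
     forall v : 'rV[R]_(N.*2.+1), odd_entries_increasing v ->
       entry v 1 < entry v 3 -> entry v 3 <= entry v N.*2.+1 ->
       entry v N.*2.+1 <= C * entry v 3 ->
       enorm v < d ->
       (forall a b : R, 0 <= a -> a < b -> b <= 2 ->
          lambda0 a v < lambda0 b v) /\
       spectrum_has_multiplicity (Hop v) (sigma0 v) 2).
Proof.
split; first exact: band_asymptotics.
split; first exact: band_asymptotics_increasing.
move=> C C0; have [d d0 dP] := lambda0_increasing hN C0.
exists (Num.min d (Num.min (small_radius R N) (gap R N / 4))).
split; first by rewrite !lt_min d0 small_radius_gt0 divr_gt0 // gap_gt0.
move=> v vinc v13 _ vpC; rewrite !lt_min => /andP[vd /andP[vr vg]].
have inc := dP v vinc v13 vpC vd.
split; first exact: inc.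
apply: multiplicity_two inc; first exact: ltW.
by apply: lambda0_le_gap; exact: ltW.
Qed.
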